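(* Let $A$ be an infinite dimensional simple separable unital C*-algebra, let $G$ be a second countable compact group, and let $\alpha \colon G \to \operatorname{Aut}(A)$ be an action which has the tracial Rokhlin property with comparison. For every $\varepsilon > 0$, every $n \in \{1,2,\ldots\}$, every compact subset $F_1 \subseteq A$, every compact subset $F_2 \subseteq A^{\alpha}$, every $x \in A_{+}$ with $\|x\| = 1$, and every $y \in (A^{\alpha})_{+} \setminus \{0\}$, there exist a projection $p \in A^{\alpha}$ and a unital completely positive contractive map $\psi \colon A \to p A^{\alpha} p$ (unital means $\psi(1)=p$) such that the following hold. (1) Whenever $m \in \{1, 2, \ldots, n\}$ and $a_1, a_2, \ldots, a_m \in F_1 \cup F_2$, we have $\|\psi(a_1 a_2 \cdots a_m) - \psi(a_1)\psi(a_2)\cdots\psi(a_m)\| < \varepsilon$. (2) $\|pa - ap\| < \varepsilon$ for all $a \in F_1 \cup F_2$. (3) $\|\psi(a) - pap\| < \varepsilon$ for all $a \in F_2$. (4) $\|\psi(a)\| > \|a\| - \varepsilon$ for all $a \in F_1 \cup F_2$. (5) $1 - p \precsim_{A} x$. (6) $1 - p \precsim_{A^{\alpha}} y$. (7) $1 - p \precsim_{A^{\alpha}} p$. (8) $\|pxp\| > 1 - \varepsilon$.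
   Context: All group actions $\alpha\colon G\to\operatorname{Aut}(A)$ on C*-algebras are continuous (that is, $g\mapsto\alpha_g(a)$ is norm continuous for every $a\in A$), and $A^\alpha=\{a\in A:\alpha_g(a)=a\text{ for all }g\in G\}$. For a C*-algebra $A$ let $M_\infty(A)=\bigcup_n M_n(A)$; for $a,b\in M_\infty(A)_+$, write $a\precsim_A b$ (Cuntz subequivalence in $A$) if there is a sequence $(v_n)$ in $M_\infty(A)$ with $\lim_n v_nbv_n^*=a$. For a compact group $G$, let $\mathrm{Lt}\colon G\to\operatorname{Aut}(C(G))$ be given by $\mathrm{Lt}_g(f)(h)=f(g^{-1}h)$. Definition. Let $A$ be an infinite dimensional simple unital C*-algebra, and let $\alpha\colon G\to\operatorname{Aut}(A)$ be an action of a second countable compact group $G$ on $A$. The action $\alpha$ has the tracial Rokhlin property with comparison if for every finite set $F\subseteq A$, every finite set $S\subseteq C(G)$, every $\varepsilon>0$, every $x\in A_+$ with $\|x\|=1$, and every $y\in(A^\alpha)_+\setminus\{0\}$, there exist a projection $p\in A^\alpha$ and a unital completely positive map $\varphi\colon C(G)\to pAp$ (unital means $\varphi(1)=p$) such that: (1) $\|\varphi(f_1f_2)-\varphi(f_1)\varphi(f_2)\|<\varepsilon$ for all $f_1,f_2\in S$; $\|\varphi(f)a-a\varphi(f)\|<\varepsilon$ for all $f\in S$, $a\in F$; and $\sup_{g\in G}\|\varphi(\mathrm{Lt}_g(f))-\alpha_g(\varphi(f))\|<\varepsilon$ for all $f\in S$; (2) $1-p\precsim_A x$; (3) $1-p\precsim_{A^\alpha}y$;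 (4) $1-p\precsim_{A^\alpha}p$; (5) $\|pxp\|>1-\varepsilon$. *)

(* Defs.v *)
From HB Require Import structures.
From mathcomp Require Import all_boot all_order all_algebra.
From mathcomp Require Import complex.
From mathcomp Require Import all_classical all_reals all_analysis.

Set Implicit Arguments.
Unset Strict Implicit.
Unset Printing Implicit Defensive.

Import Order.TTheory GRing.Theory Num.Theory.
Import numFieldNormedType.Exports.

Local Open Scope classical_set_scope.
Local Open Scope ring_scope.
Local Open Scope complex_scope.

HB.mixin Record isStarRing A & GRing.PzRing A := {
  star : A -> A;
  starK : involutive star;
  starD : {morph star : a b / a + b};
  starM : forall a b, star (a * b) = star b * star a
}.

#[short(type="starRingType")]
HB.structure Definition StarRing := {A of GRing.PzRing A & isStarRing A}.

(* Unital C*-algebras over the complex numbers R[i]. The norm is a separate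
   field: Hierarchy Builder admits no join of rings with NormedModule (or even
   with PseudoMetric) besides NumDomain and its descendants. The field
   cnorm_entourage makes the uniform structure of A, hence its topology and its
   Cauchy filters, that of the distance cnorm (a - b). *)
HB.mixin Record isCStarAlgebra (R : realType) A
    & GRing.Algebra R[i] A & Uniform A & StarRing A := {
  cnorm : A -> R;
  cnorm0_eq0 : forall a, cnorm a = 0 -> a = 0;
  cnormD : forall a b, cnorm (a + b) <= cnorm a + cnorm b;
  cnormZ : forall (c : R[i]) a, cnorm (c *: a) = complex.Re `|c| * cnorm a;
  cnormM : forall a b, cnorm (a * b) <= cnorm a * cnorm b;
  cnorm_entourage : @entourage A =
    filter_from [set e : R | 0 < e]
                (fun e => [set ab | cnorm (ab.1 - ab.2) < e]);
  cstar_complete : forall F : set_system A,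
    ProperFilter F -> cauchy F -> exists a : A, F --> a;
  starZ : forall (c : R[i]) (a : A), star (c *: a) = c^* *: star a;
  cnorm_star : forall a : A, cnorm (star a * a) = cnorm a ^+ 2
}.

#[short(type="cstarAlgType")]
HB.structure Definition CStarAlgebra (R : realType) :=
  {A of GRing.Algebra R[i] A & Uniform A & StarRing A & isCStarAlgebra R A}.

HB.mixin Record isTopologicalGroup G & Group G & Topological G := {
  mulg_continuous : continuous (fun xy : G * G => (xy.1 * xy.2)%g);
  invg_continuous : continuous (fun x : G => x^-1%g)
}.

#[short(type="topologicalGroupType")]
HB.structure Definition TopologicalGroup :=
  {G of Group G & Topological G & isTopologicalGroup G}.

Definition compact_group (G : topologicalGroupType) : Prop :=
  compact [set: G] /\ hausdorff_space G.

Section ContinuousFunctions.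
Variables (R : realType) (T : Type).
Implicit Types f g : T -> R[i].

Let fstar f : T -> R[i] := fun t => (f t)^*.

Let fstarK : involutive fstar.
Proof. by move=> f; apply/funext => t; rewrite /fstar conjcK. Qed.

Let fstarD : {morph fstar : f g / f + g}.
Proof. by move=> f g; apply/funext => t; rewrite /fstar !fctE rmorphD. Qed.

Let fstarM f g : fstar (f * g) = fstar g * fstar f.
Proof. by apply/funext => t; rewrite /fstar !fctE rmorphM mulrC. Qed.

HB.instance Definition _ :=
  isStarRing.Build (T -> R[i]) fstarK fstarD fstarM.
End ContinuousFunctions.

(* C(T), as a *-subalgebra of the algebra of all functions; R[i]^o is R[i] with
   its usual topology. *)
Definition contfun (R : realType) (T : topologicalType) : set (T -> R[i]) :=
  [set f | continuous (f : T -> R[i]^o)].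
Arguments contfun : clear implicits.

Definition Lt (R : realType) (G : topologicalGroupType) (g : G)
  (f : G -> R[i]) : G -> R[i] := fun h => f (g^-1 * h)%g.

(* A C*-algebra is given below as a set D that is a *-subalgebra of an ambient
   star ring: all of A, the fixed point algebra, a corner, or C(G). *)
Section Positivity.
Variable A : starRingType.
Implicit Types D : set A.

Definition mxstar m n (a : 'M[A]_(m, n)) : 'M[A]_(n, m) := map_mx star a^T.

Definition mx_over m n D : set 'M[A]_(m, n) :=
  [set a | forall i j, D (a i j)].

Definition mx_pos n D : set 'M[A]_n :=
  [set mxstar b *m b | b in @mx_over n n D].

Definition pos D : set A := [set star b * b | b in D].

Definition is_projection (p : A) : Prop := star p = p /\ p * p = p.

Definition corner D (p : A) : set A := [set p * a * p | a in D].
End Positivity.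

Definition completely_positive (A B : starRingType) (D : set A) (E : set B)
  (phi : A -> B) : Prop :=
  forall n (a : 'M[A]_n), mx_pos D a -> mx_pos E (map_mx phi a).

Definition linear_on (K : pzRingType) (U V : lmodType K) (D : set U)
  (phi : U -> V) : Prop :=
  forall (c : K) u v, D u -> D v -> phi (c *: u + v) = c *: phi u + phi v.

Section CStar.
Variables (R : realType) (A : cstarAlgType R).
Implicit Types (D I : set A) (a b p : A).

Definition infinite_dimensional : Prop :=
  ~ exists n (e : 'I_n -> A),
      forall a, exists c : 'I_n -> R[i], a = \sum_i c i *: e i.

Definition separable : Prop := exists2 D : set A, countable D & dense D.

Definition ideal I : Prop :=
  [/\ I 0, forall a b, I a -> I b -> I (a + b) &
      forall a b, I b -> I (a * b) /\ I (b * a)].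

Definition cstar_simple : Prop :=
  forall I : set A, ideal I -> closed I -> I = [set 0] \/ I = [set: A].

(* The norm of the Hilbert module A^n: the square root of the norm of the sum
   of the (xi_i)^* xi_i. *)
Definition hnorm n (xi : 'cV[A]_n) : R :=
  Num.sqrt (cnorm (\sum_i star (xi i ord0) * xi i ord0)).

(* The C*-norm of M_n(A): the norm of left multiplication on A^n. It is also
   the norm of M_n(D) for a C*-subalgebra D, since inclusions of C*-algebras
   are isometric. *)
Definition mxnorm n (a : 'M[A]_n) : \bar R :=
  ereal_sup [set (hnorm (a *m xi))%:E | xi in [set xi | hnorm xi <= 1]].

(* The image of a in M_n(A) under the upper left corner inclusion
   M_m(A) -> M_n(A), for m <= n. *)
Definition mxpad m n (a : 'M[A]_m) : 'M[A]_n :=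
  \matrix_(i, j) match insub (i : nat), insub (j : nat) with
                 | Some i', Some j' => a i' j'
                 | _, _ => 0
                 end.

(* Cuntz subequivalence in the C*-subalgebra D, with M_oo(D) the union of the
   M_k(D) along the upper left corner inclusions; v_j lies in M_(k j)(D). *)
Definition mx_cuntz D m n (a : 'M[A]_m) (b : 'M[A]_n) : Prop :=
  exists (k : nat -> nat) (v : forall j, 'M[A]_(k j)),
    (forall j, [/\ (m <= k j)%N, (n <= k j)%N & mx_over D (v j)]) /\
    mxnorm (v j *m mxpad (k j) b *m mxstar (v j) - mxpad (k j) a)
      @[j --> \oo] --> 0%E.

Definition cuntz D a b : Prop :=
  mx_cuntz D (\matrix_(i < 1, j < 1) a) (\matrix_(i < 1, j < 1) b).
End CStar.

Section Actions.
Variables (R : realType) (A : cstarAlgType R) (G : topologicalGroupType).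
Implicit Types alpha : G -> {lrmorphism A -> A}.

Definition continuous_action alpha : Prop :=
  [/\ forall g a, alpha g (star a) = star (alpha g a),
      forall a, alpha 1%g a = a,
      forall g h a, alpha (g * h)%g a = alpha g (alpha h a) &
      forall a, continuous (fun g => alpha g a)].

Definition fixed alpha : set A := [set a | forall g, alpha g a = a].

Definition tracial_Rokhlin_comparison alpha : Prop :=
  forall (F : set A) (S : set (G -> R[i])) (eps : R) (x y : A),
  finite_set F -> finite_set S -> S `<=` contfun R G ->
  0 < eps ->
  pos setT x -> cnorm x = 1 ->
  pos (fixed alpha) y -> y <> 0 ->
  exists (p : A) (phi : (G -> R[i]) -> A),
    (fixed alpha p /\ is_projection p) /\
    [/\ forall f, contfun R G f -> corner setT p (phi f),
        linear_on (contfun R G) phi,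
        completely_positive (contfun R G) (corner setT p) phi &
        phi 1 = p] /\
    [/\ forall f1 f2, S f1 -> S f2 ->
          cnorm (phi (f1 * f2) - phi f1 * phi f2) < eps,
        forall f a, S f -> F a -> cnorm (phi f * a - a * phi f) < eps &
        forall f, S f ->
          (ereal_sup [set (cnorm (phi (Lt g f) - alpha g (phi f)))%:E
                     | g in [set: G]] < eps%:E)%E] /\
    cuntz setT (1 - p) x /\
    cuntz (fixed alpha) (1 - p) y /\
    cuntz (fixed alpha) (1 - p) p /\
    1 - eps < cnorm (p * x * p).
End Actions.

(* Main.v *)
(* Let the e_i be a partition of unity on G (sum of e_i^2 = 1) such that, for a
   in a given finite set, alpha_h(a) is within delta of alpha_{g_i}(a) on the
   support of e_i. With phi as in the tracial Rokhlin property put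
     psi0(a) = sum_i phi(e_i) alpha_{g_i}(a) phi(e_i).
   This map is completely positive. Up to errors that vanish as phi becomes
   multiplicative and central, two such sums for partitions of unity (v_i),
   (w_j) with coefficients c_i, d_j differ by
     sum_{i,j} phi(v_i w_j) (c_i - d_j) phi(v_i w_j),
   whose norm is at most the supremum of |c_i - d_j| over the pairs with
   v_i w_j <> 0, whatever the number of terms. Comparing psi0(a) psi0(b) with
   psi0(ab), and alpha_g(psi0(a)) with psi0(a), in this way shows that psi0 is
   almost multiplicative and almost invariant. Composing with a completely
   positive projection E of A onto the fixed points and correcting the value at
   1 gives psi. The mean E is a limit of finite averages of the alpha_g, which
   replaces Haar measure.

   For the lower bound on |psi(a)|, take a sequence of such maps psi_k that is
   asymptotically multiplicative on all of A. If |psi_k(a)| <= |a| - eps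
   infinitely often, then for h = a^*a and some t < |h| there is a nonzero
   positive b with h b >= t b and |psi_k(h)| stays below a bound r < t, which forces
   psi_k(b) -> 0 along the subsequence; but the elements killed in the limit
   form a closed ideal that does not contain 1. *)

(* Two obstacles shape the argument. The number of terms of a partition of unity grows as delta
   shrinks, and the tolerance of phi can only be chosen afterwards. So the partition is fixed first,
   phi becomes a sequence of maps with tolerances 1/(k+1), and identities are used up to null
   sequences; the one estimate that does not tend to 0 is a Cauchy-Schwarz bound free of the number
   of terms. The second obstacle is the lower bound on psi: killed elements form an ideal only if
   multiplicativity holds in the limit on all of A, hence the passage from finite sets to a dense
   sequence; and the ideal misses 1 because [1 - e < cnorm (p * x * p)] keeps the norms of p_k =
   psi_k(1) away from 0. No spectrum is used. Positivity is the norm condition |t - h| <= t for a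
   self-adjoint h, square roots come from an iteration that stays inside closed subalgebras, and
   order facts are read off from roots that commute with everything h commutes with. The same
   development serves A and every M_n(A), whose norm is the operator norm on A^n. *)
Require Import Defs.
From mathcomp Require Import all_boot all_order all_algebra.
From mathcomp Require Import complex.
From mathcomp Require Import all_classical all_reals all_analysis.
From mathcomp Require Import ring lra.

Set Implicit Arguments.
Unset Strict Implicit.
Unset Printing Implicit Defensive.

Import Order.TTheory GRing.Theory Num.Theory.
Import numFieldNormedType.Exports.

Local Open Scope classical_set_scope.
Local Open Scope ring_scope.

(** * Positivity for C*-norms, without spectra *)

(* One record serves both A and the matrix rings 'M[A]_n: MathComp makes 'M[A]_n
   a module over A rather than over R[i], so the scalars enter through a central
   ring morphism sc. *)
Record cstar_norm (R : realType) (X : pzRingType) (st : X -> X)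
    (sc : {rmorphism R[i] -> X}) (N : X -> R) : Prop := CStarNorm {
  cn_stK : involutive st;
  cn_stD : {morph st : a b / a + b};
  cn_stM : forall a b, st (a * b) = st b * st a;
  cn_st_sc : forall c, st (sc c) = sc (c^*)%C;
  cn_sc_comm : forall c a, sc c * a = a * sc c;
  cn_eq0 : forall a, N a = 0 -> a = 0;
  cn_D : forall a b, N (a + b) <= N a + N b;
  cn_M : forall a b, N (a * b) <= N a * N b;
  cn_sc : forall c a, N (sc c * a) = complex.Re `|c| * N a;
  cn_st : forall a, N (st a * a) = N a ^+ 2;
  cn_complete : forall u : nat -> X,
    (forall e, 0 < e -> exists K, forall i j, (K <= i)%N -> (K <= j)%N ->
       N (u i - u j) < e) ->
    exists l, forall e, 0 < e -> exists K, forall i, (K <= i)%N ->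
       N (u i - l) < e
}.

Section CStarNorm.
Variables (R : realType) (X : pzRingType) (st : X -> X).
Variables (sc : {rmorphism R[i] -> X}) (N : X -> R).
Hypothesis cn : cstar_norm st sc N.

Definition rsc (r : R) : X := sc (r%:C)%C.

Definition adherent (D : X -> Prop) (a : X) : Prop :=
  forall e : R, 0 < e -> exists2 b, D b & N (b - a) < e.

(** Real scalars only, no unit and no stability under [st]: commutants of a single element and
    corners qualify alike. *)
Record closed_subalg (D : X -> Prop) : Prop := ClosedSubalg {
  csa_D : forall a b, D a -> D b -> D (a + b);
  csa_M : forall a b, D a -> D b -> D (a * b);
  csa_sc : forall r a, D a -> D (rsc r * a);
  csa_closed : forall a, adherent D a -> D a
}.

Lemma rscD r s : rsc (r + s) = rsc r + rsc s.
Proof. by rewrite /rsc !rmorphD. Qed.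
Lemma rscN r : rsc (- r) = - rsc r.
Proof. by rewrite /rsc !rmorphN. Qed.
Lemma rscB r s : rsc (r - s) = rsc r - rsc s.
Proof. by rewrite rscD rscN. Qed.
Lemma rscM r s : rsc (r * s) = rsc r * rsc s.
Proof. by rewrite /rsc !rmorphM. Qed.
Lemma rsc1 : rsc 1 = 1.
Proof. by rewrite /rsc !rmorph1. Qed.
Lemma rsc0 : rsc 0 = 0.
Proof. by rewrite /rsc !rmorph0. Qed.
Lemma rsc_nat n : rsc n%:R = n%:R.
Proof. by rewrite /rsc !rmorph_nat. Qed.
Lemma rscC r a : rsc r * a = a * rsc r.
Proof. exact: (cn_sc_comm cn). Qed.
Lemma rscVK r a : r != 0 -> rsc r * (rsc r^-1 * a) = a.
Proof. by move=> r0; rewrite mulrA -rscM divff// rsc1 mul1r. Qed.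
Lemma rscKV r a : r != 0 -> rsc r^-1 * (rsc r * a) = a.
Proof. by move=> r0; rewrite mulrA -rscM mulVf// rsc1 mul1r. Qed.
Lemma rsc2 a : rsc 2 * a = a + a.
Proof. by rewrite rsc_nat mulr_natl mulr2n. Qed.
Lemma rsc_half a : rsc 2^-1 * a + rsc 2^-1 * a = a.
Proof. by rewrite -rsc2 rscVK. Qed.
Lemma rscMM r a b : (rsc r * a) * (rsc r * b) = rsc (r ^+ 2) * (a * b).
Proof. by rewrite expr2 rscM -!mulrA; congr (_ * _); rewrite !mulrA rscC. Qed.
Lemma st_rsc r : st (rsc r) = rsc r.
Proof.
by rewrite (cn_st_sc cn); congr (sc _); apply/eqP; rewrite eq_complex /= oppr0 !eqxx.
Qed.

Lemma st0 : st 0 = 0.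
Proof. by rewrite -(rsc0) st_rsc. Qed.
Lemma st1 : st 1 = 1.
Proof. by rewrite -(rsc1) st_rsc. Qed.
Lemma stN a : st (- a) = - st a.
Proof. by apply/eqP; rewrite -addr_eq0 -(cn_stD cn) addNr st0. Qed.
Lemma stB a b : st (a - b) = st a - st b.
Proof. by rewrite (cn_stD cn) stN. Qed.
Lemma st_sum I (r : seq I) (P : pred I) (F : I -> X) :
  st (\sum_(i <- r | P i) F i) = \sum_(i <- r | P i) st (F i).
Proof. by apply: (big_morph st (cn_stD cn) st0). Qed.

Lemma nrm_rsc r a : N (rsc r * a) = `|r| * N a.
Proof. by rewrite (cn_sc cn) normc_def /= expr0n /= addr0 sqrtr_sqr. Qed.
Lemma nrm0 : N 0 = 0.
Proof. by rewrite -(mul0r 0) -{1}rsc0 nrm_rsc normr0 mul0r. Qed.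
Lemma nrmN a : N (- a) = N a.
Proof. by rewrite -mulN1r -{1}rsc1 -rscN nrm_rsc normrN normr1 mul1r. Qed.
Lemma nrmB a b : N (a - b) <= N a + N b.
Proof. by rewrite -(nrmN b) (cn_D cn). Qed.
Lemma nrm_ge0 a : 0 <= N a.
Proof. by have := nrmB a a; rewrite subrr nrm0 -mulr2n pmulrn_lge0. Qed.
Lemma nrm_distC a b : N (a - b) = N (b - a).
Proof. by rewrite -nrmN opprB. Qed.
Lemma nrm_tri a b c : N (a - c) <= N (a - b) + N (b - c).
Proof. by apply: le_trans (cn_D cn _ _); rewrite addrA subrK. Qed.
Lemma nrm_st a : N (st a) = N a.
Proof.
suff le b : N b <= N (st b) by apply/eqP; rewrite eq_le -{2}(cn_stK cn a) !le.
have := cn_M cn (st b) b; rewrite (cn_st cn) expr2.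
have [->|b0] := eqVneq (N b) 0; first by rewrite nrm_ge0.
by rewrite ler_pM2r// lt_def b0 nrm_ge0.
Qed.
(** An inequality, since the zero ring is allowed, in particular the matrices of size 0. *)
Lemma nrm1 : N 1 <= 1.
Proof.
have [->|n0] := eqVneq (N 1) 0; first exact: ler01.
have := cn_st cn 1; rewrite st1 mulr1 expr2 => /eqP.
by rewrite -{1}(mulr1 (N 1)) (inj_eq (mulfI n0)) => /eqP <-.
Qed.
Lemma nrm_rsc1 r : 0 <= r -> N (rsc r) <= r.
Proof.
by move=> r0; rewrite -(mulr1 (rsc r)) nrm_rsc ger0_norm// ler_piMr// nrm1.
Qed.
Lemma nrm_sum I (r : seq I) (P : pred I) (F : I -> X) :
  N (\sum_(i <- r | P i) F i) <= \sum_(i <- r | P i) N (F i).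
Proof.
by elim/big_ind2 : _ => [|a b c d ab cd|//]; rewrite ?nrm0// (le_trans (cn_D cn _ _))// lerD.
Qed.
Lemma nrm_sa a : st a = a -> N (a * a) = N a ^+ 2.
Proof. by move=> {1}<-; exact: (cn_st cn). Qed.
Lemma nrm_le0 a : N a <= 0 -> a = 0.
Proof. by move=> a0; apply: (cn_eq0 cn); apply/eqP; rewrite eq_le a0 nrm_ge0. Qed.
Lemma nrm_small a b : (forall e, 0 < e -> N (a - b) < e) -> a = b.
Proof.
move=> h; apply/eqP; rewrite -subr_eq0; apply/eqP/nrm_le0.
by apply/ler_addgt0Pl => e /h/ltW; rewrite addr0.
Qed.

(* Visser's iteration y <- (x + y^2)/2 for y = e - sqrt(e - x) *)
Fixpoint visser (x : X) (j : nat) : X :=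
  if j is j'.+1 then rsc 2^-1 * (x + visser x j' * visser x j') else 0.
(** The same iteration for the number 1, increasing to 1. It majorizes [visser x] and its increments
    once N x <= 1. *)
Fixpoint rvisser (j : nat) : R :=
  if j is j'.+1 then (1 + rvisser j' ^+ 2) / 2 else 0.

Lemma rvisser_bound j : 0 <= rvisser j <= 1.
Proof.
elim: j => [|j /andP[h1 h2]] /=; first by rewrite lexx ler01.
by apply/andP; split; nra.
Qed.

Lemma rvisser_homo i j : (i <= j)%N -> rvisser i <= rvisser j.
Proof.
apply: (@homo_leq _ rvisser (fun a b => a <= b)) => //; first exact: le_trans.
by move=> k /=; have /andP[? ?] := rvisser_bound k; nra.
Qed.

Lemma rvisser_cauchy e : 0 < e ->
  exists K, forall i j, (K <= i)%N -> (K <= j)%N -> `|rvisser i - rvisser j| < e.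
Proof.
move=> e0; have : cvgn rvisser.
  apply: nondecreasing_is_cvgn; first by move=> i j; exact: rvisser_homo.
  by exists 1 => _ [n _ <-]; have /andP[] := rvisser_bound n.
move=> /cvgrPdist_lt /(_ (e / 2)); rewrite divr_gt0// => /(_ isT).
case=> K _ hK; exists K => i j Ki Kj.
have := hK i Ki; have := hK j Kj => /=.
set l := limn _ => h1 h2.
by have := ler_distD l (rvisser i) (rvisser j); rewrite (distrC _ l); lra.
Qed.

Lemma visser_bound x j : N x <= 1 -> N (visser x j) <= rvisser j.
Proof.
move=> x1; elim: j => [|j IH] /=; first by rewrite nrm0.
rewrite nrm_rsc ger0_norm ?invr_ge0// mulrC ler_pM2r ?invr_gt0//.
apply: le_trans (cn_D cn _ _) _; apply: lerD => //.
apply: le_trans (cn_M cn _ _) _; rewrite expr2.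
by apply: ler_pM; rewrite ?nrm_ge0.
Qed.

(** A difference of squares splits as u(u - v) + (u - v)v without commutativity, and the scalar
    sequence satisfies the same recursion, so domination passes from one step to the next. *)
Lemma visser_step x j : N x <= 1 ->
  N (visser x j.+1 - visser x j) <= rvisser j.+1 - rvisser j.
Proof.
move=> x1; elim: j => [|j IH].
  rewrite /= mulr0 addr0 !subr0 nrm_rsc ger0_norm ?invr_ge0// ?expr0n /=; lra.
have E : visser x j.+2 - visser x j.+1 = rsc 2^-1 *
   (visser x j.+1 * (visser x j.+1 - visser x j) +
    (visser x j.+1 - visser x j) * visser x j).
  rewrite [visser x j.+2]/= {2}[visser x j.+1]/= -mulrBr; congr (_ * _).
  rewrite [x + _]addrC opprD addrA addrK mulrBr mulrBl addrA subrK.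
  by [].
rewrite E nrm_rsc ger0_norm ?invr_ge0//.
have /andP[t0 t1] := rvisser_bound j.
have /andP[s0 s1] := rvisser_bound j.+1.
have h1 := le_trans (cn_M cn _ _) (ler_pM (nrm_ge0 _) (nrm_ge0 _) (visser_bound j.+1 x1) IH).
have h2 := le_trans (cn_M cn _ _) (ler_pM (nrm_ge0 _) (nrm_ge0 _) IH (visser_bound j x1)).
have h3 := le_trans (cn_D cn _ _) (lerD h1 h2).
have -> : rvisser j.+2 - rvisser j.+1 = 2^-1 *
  (rvisser j.+1 * (rvisser j.+1 - rvisser j) + (rvisser j.+1 - rvisser j) * rvisser j).
  by rewrite /=; field.
by rewrite ler_pM2l ?invr_gt0.
Qed.

Lemma visser_dist x i j : N x <= 1 -> (i <= j)%N ->
  N (visser x j - visser x i) <= rvisser j - rvisser i.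
Proof.
move=> x1 /subnK <-; elim: (j - i)%N => [|k IH]; first by rewrite !subrr nrm0.
apply: le_trans (nrm_tri _ (visser x (k + i)) _) _.
have := visser_step (k + i) x1; rewrite -addSn => h.
by apply: le_trans (lerD h IH) _; rewrite addrA subrK.
Qed.

Lemma visser_cvg x : N x <= 1 ->
  exists l, forall e, 0 < e -> exists K, forall i, (K <= i)%N ->
       N (visser x i - l) < e.
Proof.
move=> x1; apply: (cn_complete cn) => e /rvisser_cauchy[K hK]; exists K.
move=> i j Ki Kj; apply: le_lt_trans (hK i j Ki Kj).
have [ij|/ltnW ji] := leqP i j.
  rewrite nrm_distC distrC ger0_norm ?subr_ge0 ?rvisser_homo//.
  exact: visser_dist.
by rewrite ger0_norm ?subr_ge0 ?rvisser_homo// visser_dist.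
Qed.

(** The fixed points of a Lipschitz map are closed. Self-adjoint elements, solutions of e b = b,
    corners and invariant elements are all of this kind. *)
Lemma fixed_adherent (f : X -> X) (k : R) a : 0 <= k ->
  (forall b, N (f a - f b) <= k * N (a - b)) ->
  adherent (fun b => f b = b) a -> f a = a.
Proof.
move=> k0 lip ad; apply: nrm_small => e e0.
have [b fb ab] := ad (e / (k + 1)) (divr_gt0 e0 (ltr_wpDl k0 ltr01)).
have k1 : 0 < k + 1 by rewrite ltr_wpDl.
apply: le_lt_trans (nrm_tri _ b _) _.
rewrite -{1}fb; apply: le_lt_trans (lerD (lip b) (lexx _)) _.
rewrite (nrm_distC a b) -{2}(mul1r (N (b - a))) -mulrDl mulrC.
by rewrite -ltr_pdivlMr.
Qed.

Lemma csaB D a b : closed_subalg D -> D a -> D b -> D (a - b).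
Proof.
move=> cD Da Db; apply: (csa_D cD) => //.
by rewrite -mulN1r -rsc1 -rscN; apply: (csa_sc cD).
Qed.

Lemma csa0 D a : closed_subalg D -> D a -> D 0.
Proof. by move=> cD Da; rewrite -(mul0r a) -rsc0; apply: (csa_sc cD). Qed.

(** Taken as D in the square root lemmas, this makes the root of h commute with whatever commutes
    with h. *)
Lemma commutant_closed b : closed_subalg (fun a => a * b = b * a).
Proof.
split=> [a c ha hc|a c ha hc|r a ha|a ad].
- by rewrite mulrDl mulrDr ha hc.
- by rewrite -mulrA hc mulrA ha mulrA.
- by rewrite -mulrA ha mulrA rscC mulrA.
apply: nrm_small => e e0.
have d0 : 0 < e / (2 * (N b + 1)).
  by rewrite divr_gt0// mulr_gt0// ltr_wpDl// nrm_ge0.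
have [c hc ac] := ad _ d0.
have -> : a * b - b * a = (a - c) * b - b * (a - c).
  by rewrite mulrBl mulrBr hc opprB addrA subrK.
apply: le_lt_trans (nrmB _ _) _.
apply: le_lt_trans (lerD (cn_M cn _ _) (cn_M cn _ _)) _.
rewrite nrm_distC; move: ac; rewrite ltr_pdivlMr ?mulr_gt0// ?ltr_wpDl ?nrm_ge0//.
have := nrm_ge0 b; have := nrm_ge0 (c - a); nra.
Qed.

Lemma visser_closed D x j : closed_subalg D -> D x -> D (visser x j).
Proof.
move=> cD Dx; elim: j => [|j IH] /=; first exact: csa0 cD Dx.
by apply: (csa_sc cD); apply: (csa_D cD) => //; apply: (csa_M cD).
Qed.

Lemma sa_adherent a : adherent (fun b => st b = b) a -> st a = a.
Proof.
apply: (@fixed_adherent _ 1) => // b.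
by rewrite -stB nrm_st mul1r.
Qed.

(** With l the limit of the iteration for x = e - h one has 2l = x + l^2, that is (e - l)^2 = e - x
    = h, so s = e - l. A projection e in the role of 1 produces roots inside a corner; quantifying
    over D gives both membership and commutation. *)
Lemma sqrt_unit e h : st e = e -> e * e = e -> st h = h ->
  e * h = h -> N (e - h) <= 1 ->
  exists s, [/\ st s = s, s * s = h, N (e - s) <= 1 &
    forall D, closed_subalg D -> D e -> D h -> D s].
Proof.
move=> se ee sh eh eh1; have he : h * e = h by rewrite -{1}sh -{1}se -(cn_stM cn) eh.
pose x := e - h; have [l hl] := visser_cvg eh1.
have adl (D : X -> Prop) : (forall j, D (visser x j)) -> adherent D l.
  by move=> Dj d /hl[K hK]; exists (visser x K) => //; exact: hK.
have sx : st x = x by rewrite stB se sh.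
have ex : e * x = x by rewrite mulrBr ee eh.
have sl : st l = l.
  apply/sa_adherent/adl => j; elim: j => [|j IH] /=; first exact: st0.
  by rewrite (cn_stM cn) (cn_stD cn) (cn_stM cn) IH sx st_rsc -rscC.
have el : e * l = l.
  apply: (@fixed_adherent _ (N e)); first exact: nrm_ge0.
    by move=> b; rewrite -mulrBr (cn_M cn).
  apply: adl; elim=> [|j IH] /=; first by rewrite mulr0.
  by rewrite mulrA -rscC -mulrA mulrDr ex mulrA IH.
have le : l * e = l by rewrite -{1}sl -{1}se -(cn_stM cn) el.
have l1 : N l <= 1.
  apply/ler_addgt0Pl => d /hl[K hK]; have := hK K (leqnn _); rewrite nrm_distC => hk.
  have /andP[_ t1] := rvisser_bound K.
  have := cn_D cn (l - visser x K) (visser x K); rewrite subrK => h1.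
  by have := visser_bound K eh1; rewrite -/x; lra.
have E : rsc 2^-1 * (x + l * l) = l.
  apply: nrm_small => d d0; have [K hK] := hl (d / 2) (divr_gt0 d0 (ltr0Sn R 1)).
  apply: le_lt_trans (nrm_tri _ (visser x K.+1) _) _.
  have h1 := hK K.+1 (leqnSn _); have h2 := hK K (leqnn _).
  have /andP[_ t1] := rvisser_bound K.
  have v1 := le_trans (visser_bound K eh1) t1; rewrite -/x in v1.
  have h3 : N (rsc 2^-1 * (x + l * l) - visser x K.+1) <= N (visser x K - l).
    rewrite /= -mulrBr nrm_rsc ger0_norm ?invr_ge0//.
    have -> : x + l * l - (x + visser x K * visser x K) =
       l * (l - visser x K) + (l - visser x K) * visser x K.
      by rewrite opprD addrACA subrr add0r mulrBr mulrBl addrA subrK.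
    have := cn_D cn (l * (l - visser x K)) ((l - visser x K) * visser x K).
    have := cn_M cn l (l - visser x K); have := cn_M cn (l - visser x K) (visser x K).
    rewrite (nrm_distC l) => a1 a2 a3; have := nrm_ge0 (visser x K - l); nra.
  lra.
exists (e - l); split.
- by rewrite stB se sl.
- have : x + l * l = l + l by rewrite -(rsc_half (x + l * l)) E.
  rewrite mulrBl !mulrBr ee el le => /(canRL (addKr _)) ->.
  have -> : l - (- x + (l + l)) = x - l by rewrite opprD opprK (opprD l) addrCA addNKr.
  by rewrite opprB addrA subrK opprB addrC subrK.
- by rewrite opprB addrC subrK.
- move=> D cD De Dh; apply: csaB => //; apply: (csa_closed cD); apply: adl => j.
  by apply: visser_closed => //; exact: csaB.
Qed.

(* By cpos_nrm below one may always take t = N h. *)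
Definition cpos (h : X) : Prop :=
  st h = h /\ exists2 t : R, 0 <= t & N (rsc t - h) <= t.

(** For u = s + iw commutation gives u^*u = s^2 + w^2, while 2s = u + u^* yields |s| <= |u|. *)
Lemma nrm_sqr_le s w : st s = s -> st w = w -> s * w = w * s ->
  N s ^+ 2 <= N (s * s + w * w).
Proof.
move=> ss sw com; pose J := sc 'i%C; pose u := s + w * J.
have JC a : a * J = J * a by rewrite (cn_sc_comm cn).
have JJ : J * J = -1.
  by rewrite -rmorphM -expr2 sqr_i rmorphN rmorph1.
have sJ : st J = - J.
  rewrite (cn_st_sc cn) -rmorphN; congr (sc _).
  by apply/eqP; rewrite eq_complex /= oppr0 !eqxx.
have su : st u = s - w * J.
  by rewrite (cn_stD cn) (cn_stM cn) ss sw sJ mulNr JC.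
have E : st u * u = s * s + w * w.
  rewrite su mulrBl !mulrDr opprD addrA mulrA com -[w * J * s]mulrA -JC mulrA.
  by rewrite addrK -[w * J * _]mulrA [J * (w * J)]mulrA -(JC w) -[w * J * J]mulrA JJ
             mulrN1 mulrN opprK.
rewrite -E (cn_st cn) ler_pXn2r ?nnegrE ?nrm_ge0//.
have : N (rsc 2 * s) <= N u + N (st u).
  apply: le_trans (cn_D cn _ _); rewrite su /u.
  by rewrite addrACA subrr addr0 rsc2.
by rewrite nrm_rsc nrm_st ger0_norm//; lra.
Qed.

Lemma nrm_proj e : st e = e -> e * e = e -> N e <= 1.
Proof.
move=> se ee; have := nrm_sa se; rewrite ee expr2 => h.
by have := nrm_ge0 e; nra.
Qed.

(** Dividing by t reduces to [sqrt_unit]; t = 0 forces h = 0. For e = 1 the norm bound is the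
    witness that s is itself positive. *)
Lemma cpos_sqrt_proj e h t : st e = e -> e * e = e -> st h = h -> e * h = h ->
  0 <= t -> N (rsc t - h) <= t ->
  exists s, [/\ st s = s, s * s = h, N (rsc (Num.sqrt t) * e - s) <= Num.sqrt t &
    forall D, closed_subalg D -> D e -> D h -> D s].
Proof.
move=> se ee sh eh t0 ht; have he : h * e = h by rewrite -{1}sh -{1}se -(cn_stM cn) eh.
have [tE|tN0] := eqVneq t 0.
  have -> : h = 0.
    by apply: nrm_le0; move: ht; rewrite tE rsc0 sub0r nrmN.
  exists 0; split; rewrite ?st0 ?mul0r ?tE ?sqrtr0 ?rsc0 ?mul0r ?subr0 ?nrm0//.
have tp : 0 < t by rewrite lt_def tN0.
have [|||s [ss sE s1 sD]] := @sqrt_unit e (rsc t^-1 * h) se ee.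
- by rewrite (cn_stM cn) sh st_rsc -rscC.
- by rewrite mulrA -rscC -mulrA eh.
- have -> : e - rsc t^-1 * h = rsc t^-1 * (e * (rsc t - h)).
    by rewrite !mulrBr -[e * rsc t]rscC rscKV// eh.
  rewrite nrm_rsc ger0_norm ?invr_ge0// mulrC ler_pdivrMr// mul1r.
  apply: le_trans (cn_M cn _ _) _.
  by have := nrm_proj se ee; have := nrm_ge0 e; have := nrm_ge0 (rsc t - h); nra.
have r0 : 0 <= Num.sqrt t by rewrite sqrtr_ge0.
exists (rsc (Num.sqrt t) * s); split.
- by rewrite (cn_stM cn) ss st_rsc -rscC.
- by rewrite rscMM sE sqr_sqrtr// rscVK.
- rewrite -mulrBr nrm_rsc ger0_norm//; nra.
- by move=> D cD De Dh; apply: (csa_sc cD); apply: sD => //; apply: (csa_sc cD).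
Qed.

Lemma cpos_sqrt h : cpos h -> exists s, [/\ st s = s, s * s = h, cpos s &
    forall D, closed_subalg D -> D 1 -> D h -> D s].
Proof.
move=> [sh [t t0 ht]].
have [s [ss sE s1 sD]] := cpos_sqrt_proj st1 (mul1r 1) sh (mul1r h) t0 ht.
exists s; split => //; split => //; exists (Num.sqrt t); rewrite ?sqrtr_ge0//.
by move: s1; rewrite mulr1.
Qed.

(** Normalize to |z| = 1. Then 1 - z^2 has a self-adjoint root w by [sqrt_unit], which commutes with
    z, and |1 - z^2| = |w|^2 <= |w^2 + z^2| = |1| <= 1. *)
Lemma cpos_sqr_nrm s : st s = s -> N (rsc (N s ^+ 2) - s * s) <= N s ^+ 2.
Proof.
move=> ss; have [s0|sn0] := eqVneq (N s) 0.
  by rewrite s0 expr0n rsc0 (cn_eq0 cn s0) mulr0 subr0 nrm0.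
have sp : 0 < N s by rewrite lt_def sn0 nrm_ge0.
pose z := rsc (N s)^-1 * s.
have sz : st z = z by rewrite (cn_stM cn) ss st_rsc -rscC.
have z1 : N z = 1 by rewrite nrm_rsc ger0_norm ?invr_ge0 ?nrm_ge0// mulVf.
have -> : s * s = rsc (N s ^+ 2) * (z * z).
  by rewrite rscMM exprVn rscVK// expf_neq0.
rewrite -{1}[rsc _]mulr1 -mulrBr nrm_rsc ger0_norm ?exprn_ge0 ?nrm_ge0//.
rewrite ler_piMr ?exprn_ge0 ?nrm_ge0//.
have szz : st (1 - z * z) = 1 - z * z by rewrite stB st1 (cn_stM cn) sz.
have [|w [sw wE _ wD]] := @sqrt_unit 1 (1 - z * z) st1 (mul1r 1) szz (mul1r _).
  by rewrite opprB addrC subrK (nrm_sa sz) z1 expr1n.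
have com : w * z = z * w.
  apply: (wD _ (commutant_closed z)); first by rewrite mul1r mulr1.
  by rewrite mulrBl mulrBr mul1r mulr1 mulrA.
have := nrm_sqr_le sw sz com; rewrite wE subrK => h.
by rewrite -wE nrm_sa// (le_trans h)// nrm1.
Qed.

Lemma cpos_sqr s : st s = s -> cpos (s * s).
Proof.
move=> ss; split; first by rewrite (cn_stM cn) ss.
by exists (N s ^+ 2); rewrite ?exprn_ge0 ?nrm_ge0// cpos_sqr_nrm.
Qed.

Lemma cpos_nrm h : cpos h -> N (rsc (N h) - h) <= N h.
Proof.
by move=> /cpos_sqrt[s [ss <- _ _]]; rewrite (nrm_sa ss); exact: cpos_sqr_nrm.
Qed.

Lemma cpos_st h : cpos h -> st h = h. Proof. by case. Qed.

Lemma cpos0 : cpos 0.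
Proof. by rewrite -(mul0r 0); apply/cpos_sqr/st0. Qed.

Lemma cposD h k : cpos h -> cpos k -> cpos (h + k).
Proof.
move=> [sh [t t0 ht]] [sk [r r0 hr]]; split; first by rewrite (cn_stD cn) sh sk.
exists (t + r); first by rewrite addr_ge0.
by rewrite rscD opprD addrACA (le_trans (cn_D cn _ _))// lerD.
Qed.

Lemma cpos_sum I (r : seq I) (P : pred I) (F : I -> X) :
  (forall i, P i -> cpos (F i)) -> cpos (\sum_(i <- r | P i) F i).
Proof. by move=> hF; apply: (big_ind cpos); [exact: cpos0|exact: cposD|]. Qed.

Lemma cpos_rsc r h : 0 <= r -> cpos h -> cpos (rsc r * h).
Proof.
move=> r0 [sh [t t0 ht]]; split; first by rewrite (cn_stM cn) sh st_rsc -rscC.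
exists (r * t); first by rewrite mulr_ge0.
by rewrite rscM -mulrBr nrm_rsc ger0_norm// ler_wpM2l.
Qed.

Lemma cpos_closed h : adherent cpos h -> cpos h.
Proof.
move=> ad; split.
  by apply: sa_adherent => e /ad[b [sb _] hb]; exists b.
exists (N h); first exact: nrm_ge0.
apply/ler_addgt0Pl => e e0; have [b pb hb] := ad (e / 3) (divr_gt0 e0 (ltr0Sn R 2)).
have h1 := cpos_nrm pb.
have h2 : N b <= N (b - h) + N h by apply: le_trans (cn_D cn _ _); rewrite subrK.
have h3 : N (rsc (N h) - rsc (N b)) <= N (b - h).
  rewrite -rscB -[rsc _]mulr1 nrm_rsc.
  have h4 : N h <= N (b - h) + N b.
    by rewrite (nrm_distC b); apply: le_trans (cn_D cn _ _); rewrite subrK.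
  have h5 : `|N h - N b| <= N (b - h) by rewrite ler_norml; apply/andP; split; lra.
  by have := nrm1; have := nrm_ge0 1; have := normr_ge0 (N h - N b); nra.
have -> : rsc (N h) - h = (rsc (N h) - rsc (N b)) + ((rsc (N b) - b) + (b - h)).
  by rewrite [X in _ = _ + X]addrA subrK addrA subrK.
apply: le_trans (cn_D cn _ _) _; apply: le_trans (lerD (lexx _) (cn_D cn _ _)) _.
lra.
Qed.

Lemma cpos_mul a b : cpos a -> cpos b -> a * b = b * a -> cpos (a * b).
Proof.
move=> /cpos_sqrt[s [ss <- _ sD]] /cpos_sqrt[w [sw <- _ wD]] com.
have c1 : s * (w * w) = (w * w) * s.
  by apply: (sD _ (commutant_closed (w * w))); rewrite ?mul1r ?mulr1.
have c2 : w * s = s * w.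
  by apply: (wD _ (commutant_closed s)); rewrite ?mul1r ?mulr1 // c1.
have -> : s * s * (w * w) = (s * w) * (s * w).
  by rewrite -!mulrA; congr (_ * _); rewrite !mulrA c2.
by apply: cpos_sqr; rewrite (cn_stM cn) ss sw c2.
Qed.

(** The roots s of h and w of t - h commute, so |h| = |s|^2 is at most |s^2 + w^2| = |t|. *)
Lemma cpos_le_rsc h t : 0 <= t -> cpos h -> cpos (rsc t - h) -> N h <= t.
Proof.
move=> t0 /cpos_sqrt[s [ss <- _ sD]] /cpos_sqrt[w [sw wE _ wD]].
have com : w * s = s * w.
  apply: (wD _ (commutant_closed s)); first by rewrite mul1r mulr1.
  by rewrite mulrBl mulrBr rscC mulrA.
rewrite nrm_sa// (le_trans (nrm_sqr_le ss sw _))// wE addrC subrK.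
exact: nrm_rsc1.
Qed.

Lemma cpos_rsc_sub h t : st h = h -> N h <= t -> cpos (rsc t - h).
Proof.
move=> sh ht; have t0 := le_trans (nrm_ge0 h) ht.
split; first by rewrite stB st_rsc sh.
by exists t => //; rewrite opprB addrC subrK.
Qed.

Lemma cpos_le_nrm h k : cpos h -> cpos (k - h) -> N h <= N k.
Proof.
move=> ph pkh; apply: cpos_le_rsc => //; first exact: nrm_ge0.
have pk : cpos k by rewrite -(subrK h k); exact: cposD.
have := cposD (cpos_rsc_sub (cpos_st pk) (lexx _)) pkh.
by rewrite addrA subrK.
Qed.

(** A Bernoulli inequality, whose linear growth in n is played against a fixed bound in
    [cpos_intertwine]. The commutation clause is carried along because positivity of a product is
    available only for commuting factors. *)
Lemma cpos_pow k n : cpos k ->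
  [/\ cpos ((1 + k) ^+ n), cpos ((1 + k) ^+ n - 1),
      k * (1 + k) ^+ n = (1 + k) ^+ n * k & cpos (k * (1 + k) ^+ n - n%:R * (k * k))].
Proof.
move=> pk; elim: n => [|n [p1 p2 com p3]].
  rewrite !expr0 subrr mul0r subr0 !mulr1 mul1r; split => //; last exact: cpos0.
  by rewrite -(mulr1 1); apply/cpos_sqr/st1.
have p1k : cpos ((1 + k) ^+ n * k) by apply: cpos_mul.
have E : (1 + k) ^+ n.+1 = (1 + k) ^+ n + (1 + k) ^+ n * k.
  by rewrite exprSr mulrDr mulr1.
have comS : k * (1 + k) ^+ n.+1 = (1 + k) ^+ n.+1 * k.
  by rewrite E mulrDr mulrDl mulrA com.
rewrite comS E; split => //; first exact: cposD.
- by rewrite addrAC; apply: cposD.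
- rewrite mulrDl -com -addn1 natrD mulrDl mul1r opprD addrACA; apply: cposD => //.
  have -> : k * (1 + k) ^+ n * k - k * k = (k * k) * ((1 + k) ^+ n - 1).
    by rewrite mulrBr mulr1 -!mulrA com.
  apply: cpos_mul => //; first exact: cpos_sqr (cpos_st pk).
  by rewrite mulrBr mulrBl mulr1 mul1r -mulrA com mulrA com mulrA.
Qed.

(** After division by T >= |m| the relation becomes (1 - m')c = c(1 + k'), hence (1 - m')^j c = c(1
    + k')^j for all j. The left side has norm at most |c|. The squared norm of the right side is
    T|k'(1 + k')^(2j)|, which is at least 2jT|k'^2|. So k' = 0. *)
Lemma cpos_intertwine c k m : cpos k -> cpos m -> st c * c = - k ->
  m * c = - (c * k) -> k = 0.
Proof.
move=> pk pm ck mc; pose T := N m + 1.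
have Tp : 0 < T by rewrite ltr_wpDl ?nrm_ge0.
have Tn : T != 0 by rewrite gt_eqF.
have hT : N (rsc T - m) <= T.
  rewrite /T rscD addrAC; apply: le_trans (cn_D cn _ _) _.
  by apply: lerD; [exact: cpos_nrm|rewrite rsc1 nrm1].
pose k' := rsc T^-1 * k; pose m' := rsc T^-1 * m.
have pk' : cpos k' by apply: cpos_rsc => //; rewrite invr_ge0 ltW.
have h1 : (1 - m') * c = c * (1 + k').
  by rewrite mulrBl mulrDr mul1r mulr1 -mulrA mc mulrN opprK mulrA rscC -mulrA.
have n1 : N (1 - m') <= 1.
  have -> : 1 - m' = rsc T^-1 * (rsc T - m).
    by rewrite mulrBr -rscM mulVf// rsc1.
  rewrite nrm_rsc ger0_norm ?invr_ge0 ?(ltW Tp)// mulrC ler_pdivrMr//.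
  by rewrite mul1r.
pose v j := c * (1 + k') ^+ j.
have vE j : v j = (1 - m') ^+ j * c.
  elim: j => [|j IH]; first by rewrite /v !expr0 mulr1 mul1r.
  by rewrite /v exprSr mulrA -/(v j) IH -mulrA -h1 mulrA exprSr.
have vn j : N (v j) <= N c.
  rewrite vE; elim: j => [|j IH]; first by rewrite expr0 mul1r.
  rewrite exprS -mulrA; apply: le_trans (cn_M cn _ _) _.
  apply: le_trans IH; rewrite ler_piMl ?nrm_ge0//.
have stv j : st (v j) * v j = - (rsc T * (k' * (1 + k') ^+ (j + j))).
  have [pj _ cj _] := cpos_pow j pk'.
  rewrite (cn_stM cn) (cpos_st pj) -mulrA [st c * _]mulrA ck.
  have {1}-> : k = rsc T * k' by rewrite rscVK.
  rewrite mulNr mulrN exprD -mulrA; congr (- _).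
  by rewrite mulrA -rscC -mulrA; congr (_ * _); rewrite mulrA -cj -mulrA.
have fn j : N (k' * (1 + k') ^+ (j + j)) <= N c ^+ 2 / T.
  rewrite ler_pdivlMr//.
  have := cn_st cn (v j); rewrite stv nrmN nrm_rsc ger0_norm ?(ltW Tp)// mulrC => ->.
  by rewrite ler_pXn2r ?nnegrE ?nrm_ge0.
have kk j : (j + j)%:R * N (k' * k') <= N c ^+ 2 / T.
  have [_ _ _ pj] := cpos_pow (j + j) pk'.
  apply: le_trans (fn j); rewrite -(ger0_norm (ler0n R (j + j))) -nrm_rsc rsc_nat.
  apply: cpos_le_nrm => //; rewrite -rsc_nat; apply: cpos_rsc => //.
  exact: cpos_sqr (cpos_st pk').
have k'0 : k' = 0.
  apply: (cn_eq0 cn); apply/eqP; rewrite -sqrf_eq0 -(nrm_sa (cpos_st pk')).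
  apply/eqP; apply: contrapT => /eqP n0.
  have np : 0 < N (k' * k') by rewrite lt_def n0 nrm_ge0.
  pose B := N c ^+ 2 / T; have [B0 BE] : 0 <= B /\ B = N c ^+ 2 / T.
    by split=> //; rewrite divr_ge0 ?exprn_ge0 ?nrm_ge0// ltW.
  have hB := archi_boundP (divr_ge0 B0 (ltW np)).
  have := kk (Num.bound (B / N (k' * k'))); rewrite -BE natrD mulrDl.
  move: hB; rewrite ltr_pdivrMr// ltNge => /negP hB h.
  by apply: hB; apply: le_trans h; rewrite lerDl mulr_ge0// ltW.
by rewrite -(rscVK k Tn) -/k' k'0 mulr0.
Qed.

(* With q = |a^*a| and b = q - a^*a one has b a^*a b = - q b^2, so the defect
   of positivity is carried by c = a b, for which c^*c <= 0. *)
Lemma cpos_mulst a : cpos (st a * a).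
Proof.
pose h := st a * a; have sh : st h = h by rewrite (cn_stM cn) (cn_stK cn).
have [q [sq qE pq qD]] := cpos_sqrt (cpos_sqr sh).
have qh : q * h = h * q.
  by apply: (qD _ (commutant_closed h)); rewrite ?mul1r ?mulr1 ?mulrA.
pose b := q - h; have sb : st b = b by rewrite stB sq sh.
have qb : q * b = b * q by rewrite mulrBr mulrBl qh.
have bh : b * h = - (q * b) by rewrite mulrBl mulrBr qE opprB.
have bb : b * b = q * b + q * b.
  by rewrite {1}/b mulrBl; congr (_ + _); rewrite mulrBr -qE -qh mulrBr opprB qE.
pose k := q * (b * b).
have pk : cpos k.
  apply: cpos_mul => //; first exact: cpos_sqr.
  by rewrite mulrA qb -mulrA qb mulrA.
pose c := a * b.
have cc : st c * c = - k.
  by rewrite (cn_stM cn) sb -mulrA [st a * _]mulrA -/h mulrA bh mulNr -mulrA.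
have pm : cpos (c * st c).
  pose x := c + st c; pose y := sc 'i%C * (c - st c).
  have sx : st x = x by rewrite (cn_stD cn) (cn_stK cn) addrC.
  have sy : st y = y.
    rewrite (cn_stM cn) stB (cn_stK cn) (cn_st_sc cn) -(cn_sc_comm cn).
    have -> : ('i%C : R[i])^*%C = - 'i%C.
      by apply/eqP; rewrite eq_complex /= oppr0 !eqxx.
    by rewrite rmorphN mulNr -mulrN opprB.
  have yy : y * y = - ((c - st c) * (c - st c)).
    rewrite /y -mulrA [(c - _) * (_ * _)]mulrA -[(c - _) * sc _](cn_sc_comm cn).
    by rewrite -mulrA mulrA -rmorphM -expr2 sqr_i rmorphN rmorph1 mulN1r.
  have E : rsc 2 * (c * st c) = (x * x + y * y) + rsc 2 * k.
    apply: (canRL (subrK _)).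
    have -> : rsc 2 * k = - (rsc 2 * (st c * c)) by rewrite cc mulrN opprK.
    rewrite opprK !rsc2 yy /x mulrDl mulrBl !mulrDr !mulrN.
    set cc' := c * c; set cs := c * st c; set s_c := st c * c; set ss := st c * st c.
    rewrite !opprB [s_c - ss + _]addrC [RHS]addrACA; congr (_ + _).
      by rewrite [RHS]addrC addrA subrK.
    by rewrite [RHS]addrC [s_c + ss]addrC addrA subrK.
  have n2 : 2 != 0 :> R by rewrite pnatr_eq0.
  rewrite -(rscKV (c * st c) n2) E; apply: cpos_rsc; first by rewrite invr_ge0.
  by apply: cposD; [apply: cposD; exact: cpos_sqr|exact: cpos_rsc].
have k0 : k = 0.
  apply: (@cpos_intertwine c k (c * st c)) => //.
  by rewrite -mulrA cc mulrN.
(* Now b^4 = 2bk = 0, and two uses of the C*-identity recover |b| from |b^4|. *)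
have b0 : b = 0.
  apply: (cn_eq0 cn); apply/eqP; rewrite -sqrf_eq0 -(nrm_sa sb) -sqrf_eq0.
  rewrite -(nrm_sa (cpos_st (cpos_sqr sb))) {1}bb.
  by rewrite mulrDl qb -mulrA -/k k0 mulr0 addr0 nrm0.
rewrite -/h; suff -> : h = q by [].
by apply/esym/eqP; rewrite -subr_eq0 -/b b0.
Qed.

Lemma cposP h : cpos h <-> exists b, h = st b * b.
Proof.
split=> [/cpos_sqrt[s [ss <- _ _]]|[b ->]]; last exact: cpos_mulst.
by exists s; rewrite ss.
Qed.

Lemma cpos_conj c h : cpos h -> cpos (st c * h * c).
Proof.
move=> /cpos_sqrt[s [ss <- _ _]].
have -> : st c * (s * s) * c = st (s * c) * (s * c) by rewrite (cn_stM cn) ss !mulrA.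
exact: cpos_mulst.
Qed.

Lemma cpos_sqrt_corner D e h : closed_subalg D -> st e = e -> e * e = e ->
  D e -> D h -> e * h = h -> cpos h -> exists s, [/\ st s = s, s * s = h & D s].
Proof.
move=> cD se ee De Dh eh ph.
have [s [ss sh _ sD]] :=
  cpos_sqrt_proj se ee (cpos_st ph) eh (nrm_ge0 h) (cpos_nrm ph).
by exists s; split=> //; exact: sD.
Qed.

End CStarNorm.

(** * Matrices over a C*-algebra and completely positive maps *)

Section CStarAlgebraNorm.
Variables (R : realType) (A : cstarAlgType R).

Lemma nbhs_cnormP (a : A) (U : set A) :
  nbhs a U <-> exists2 e : R, 0 < e & forall b, cnorm (a - b) < e -> U b.
Proof.
rewrite -nbhs_entourageE /nbhs_ cnorm_entourage /=; split.
  case=> V [e e0 eV] VU; exists e => // b ab; apply: VU; rewrite /= -inE in_setE.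
  by apply/xsectionP; apply: eV.
case=> e e0 eU; exists [set ab | cnorm (ab.1 - ab.2) < e]; first by exists e.
by move=> b /xsectionP/= /eU.
Qed.

Lemma cnorm_nbhs (a : A) (e : R) : 0 < e -> nbhs a [set b | cnorm (a - b) < e].
Proof. by move=> e0; apply/nbhs_cnormP; exists e. Qed.

Lemma cstar_norm_alg : cstar_norm (@star A) (in_alg A) (@cnorm R A).
Proof.
split.
- exact: starK.
- exact: starD.
- exact: starM.
- move=> c; have s1 : star (1 : A) = 1.
    by rewrite -[LHS]mulr1 -[X in _ * X](@starK A) -starM mulr1 starK.
  by rewrite /= starZ s1.
- by move=> c a; rewrite /= -scalerAl mul1r -scalerAr mulr1.
- exact: cnorm0_eq0.
- exact: cnormD.
- exact: cnormM.
- by move=> c a; rewrite /= -scalerAl mul1r cnormZ.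
- exact: cnorm_star.
- move=> u hu; have : cauchy (u @ \oo).
    move=> V; rewrite cnorm_entourage => -[e /= e0 eV].
    have [K hK] := hu e e0.
    exists ([set u i | i in [set i | (K <= i)%N]], [set u i | i in [set i | (K <= i)%N]]).
      by split; exists K => // i /= Ki; exists i.
    by move=> [_ _] /= [[i Ki <-] [j Kj <-]]; apply: eV; apply: hK.
  move=> /cstar_complete[l hl]; exists l => e e0.
  have [K _ hK] := hl _ (cnorm_nbhs l e0); exists K => i Ki.
  have := hK i Ki => /=; set x := l - u i.
  suff -> : u i - l = - x by rewrite -scaleN1r cnormZ normrN normr1 mul1r.
  by rewrite opprB.
Qed.

Local Notation hA := (cstar_norm_alg).

Definition cspos (a : A) : Prop := cpos (@star A) (in_alg A) (@cnorm R A) a.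

Definition ip (I : finType) (x y : I -> A) : A := \sum_i star (x i) * y i.

Lemma ip_st (I : finType) (x y : I -> A) : star (ip x y) = ip y x.
Proof.
rewrite /ip (st_sum hA); apply: eq_bigr => i _.
by rewrite starM starK.
Qed.

Lemma ip_pos (I : finType) (x : I -> A) : cspos (ip x x).
Proof. by apply: (cpos_sum hA) => i _; apply: (cpos_mulst hA). Qed.

(** For b = <x,y> and z = yT - xb one finds <z,z> + b^*(T - <x,x>)b = T(T<y,y> - b^*b), and the left
    side is positive when T >= |<x,x>|. Taking T slightly larger than |<x,x>| allows the division by
    T. *)
Lemma ip_CS (I : finType) (x y : I -> A) : cnorm (ip x y) ^+ 2 <= cnorm (ip x x) * cnorm (ip y y).
Proof.
suff H T : 0 < T -> cnorm (ip x x) <= T -> cnorm (ip x y) ^+ 2 <= T * cnorm (ip y y).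
  have y0 := nrm_ge0 hA (ip y y); have x0 := nrm_ge0 hA (ip x x).
  apply/ler_addgt0Pl => e e0.
  have d0 : 0 < e / (cnorm (ip y y) + 1) by rewrite divr_gt0// ltr_wpDl.
  have := H (e / (cnorm (ip y y) + 1) + cnorm (ip x x)).
  rewrite ltr_pwDl// lerDr (ltW d0) => /(_ isT isT) h; apply: le_trans h _.
  rewrite mulrDl lerD2r -mulrA ler_piMr ?(ltW e0)// mulrC ler_pdivrMr ?ltr_wpDl//.
  by rewrite mul1r lerDl.
move=> T0 xT; pose b := ip x y; pose t := rsc (in_alg A) T.
have tC a : t * a = a * t by exact: (rscC hA).
pose z i := y i * t - x i * b.
have E : ip z z + star b * (t - ip x x) * b = t * (t * ip y y - star b * b).
  have -> : ip z z = t * ip y y * t - t * (star b * b) - star b * b * t + star b * ip x x * b.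
    have -> : t * (star b * b) = \sum_i t * star (y i) * (x i * b).
      rewrite ip_st /ip mulr_suml mulr_sumr; apply: eq_bigr => i _.
      by rewrite !mulrA.
    have -> : star b * b * t = \sum_i star (x i * b) * (y i * t).
      rewrite {2}/b /ip mulr_sumr mulr_suml; apply: eq_bigr => i _.
      by rewrite starM !mulrA.
    have -> : star b * ip x x * b = \sum_i star (x i * b) * (x i * b).
      rewrite /ip mulr_sumr mulr_suml; apply: eq_bigr => i _.
      by rewrite starM !mulrA.
    have -> : t * ip y y * t = \sum_i t * star (y i) * (y i * t).
      rewrite /ip mulr_sumr mulr_suml; apply: eq_bigr => i _.
      by rewrite !mulrA.
    rewrite -!sumrB -big_split /=; apply: eq_bigr => i _.
    rewrite /z starD (stN hA) starM [star t](st_rsc hA) mulrBl !mulrBr.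
    by rewrite opprB addrA addrAC.
  rewrite -[t * ip y y * t]tC -(tC (star b * b)).
  rewrite 2!mulrBr mulrBl -(tC (star b)) -[t * star b * b]mulrA.
  by rewrite -addrA [_ + (_ - _)]addrCA subrr addr0 subrK.
have pE : cspos (rsc (in_alg A) T * (t * ip y y - star b * b)).
  rewrite -/t -E; apply: (cposD hA); first exact: ip_pos.
  apply: (cpos_conj hA); apply: (cpos_rsc_sub hA) => //.
  exact: cpos_st (ip_pos x).
have pE' : cspos (t * ip y y - star b * b).
  rewrite -(rscKV (in_alg A) (t * ip y y - star b * b) (lt0r_neq0 T0)).
  by apply: (cpos_rsc hA) => //; rewrite invr_ge0 ltW.
have := cpos_le_nrm hA (cpos_mulst hA b) pE'.
by rewrite (nrm_rsc hA) (ger0_norm (ltW T0)) (cn_st hA).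
Qed.

Lemma cnorm_term_le_ip (I : finType) (x : I -> A) (i : I) :
  cnorm (x i) ^+ 2 <= cnorm (ip x x).
Proof.
rewrite -cnorm_star; apply: (cpos_le_nrm hA); first exact: (cpos_mulst hA).
rewrite /ip (bigD1 i)//= addrC addrK; apply: (cpos_sum hA) => j _.
exact: (cpos_mulst hA).
Qed.

Lemma mxstarK m n : cancel (@mxstar A m n) (@mxstar A n m).
Proof. by move=> a; apply/matrixP => i j; rewrite !mxE starK. Qed.

Lemma mxstarM m n p (a : 'M[A]_(m, n)) (b : 'M[A]_(n, p)) :
  mxstar (a *m b) = mxstar b *m mxstar a.
Proof.
apply/matrixP => i j; rewrite !mxE (st_sum hA); apply: eq_bigr => k _.
by rewrite !mxE starM.
Qed.

(** * The operator norm on the Hilbert module A^n as a complete C*-norm on M_n(A) *)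

Section MatrixNorm.
Variable n : nat.
Implicit Types (a b : 'M[A]_n) (x y : 'cV[A]_n).

Definition cip x y : A := ip (x^~ ord0) (y^~ ord0).

Lemma cipE x y : cip x y = (mxstar x *m y) ord0 ord0.
Proof. by rewrite mxE; apply: eq_bigr => i _; rewrite !mxE. Qed.

Lemma cip_adj a x y : cip x (a *m y) = cip (mxstar a *m x) y.
Proof. by rewrite !cipE mxstarM mxstarK mulmxA. Qed.

Lemma hnorm_ge0 x : 0 <= hnorm x. Proof. exact: sqrtr_ge0. Qed.

Lemma hnorm_sqr x : hnorm x ^+ 2 = cnorm (cip x x).
Proof. by rewrite sqr_sqrtr ?(nrm_ge0 hA). Qed.

Lemma cip_CS x y : cnorm (cip x y) <= hnorm x * hnorm y.
Proof.
rewrite -(@ler_pXn2r _ 2) ?nnegrE ?mulr_ge0 ?hnorm_ge0 ?(nrm_ge0 hA)//.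
by rewrite exprMn !hnorm_sqr ip_CS.
Qed.

Lemma cipDl x y z : cip (x + y) z = cip x z + cip y z.
Proof. by rewrite -big_split /=; apply: eq_bigr => i _; rewrite !mxE starD mulrDl. Qed.

Lemma cipDr x y z : cip x (y + z) = cip x y + cip x z.
Proof. by rewrite -big_split /=; apply: eq_bigr => i _; rewrite !mxE mulrDr. Qed.

Lemma hnormD x y : hnorm (x + y) <= hnorm x + hnorm y.
Proof.
rewrite -(@ler_pXn2r _ 2) ?nnegrE ?addr_ge0 ?hnorm_ge0//.
rewrite hnorm_sqr cipDl !cipDr.
have h1 := cip_CS x y; have h2 := cip_CS y x.
have h3 := cip_CS x x; have h4 := cip_CS y y.
have h5 := cnormD (cip x x + cip x y) (cip y x + cip y y).
have h6 := cnormD (cip x x) (cip x y); have h7 := cnormD (cip y x) (cip y y).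
rewrite sqrrD; lra.
Qed.

Lemma hnorm_entry x i : cnorm (x i ord0) <= hnorm x.
Proof.
rewrite -(@ler_pXn2r _ 2) ?nnegrE ?hnorm_ge0 ?(nrm_ge0 hA)// hnorm_sqr.
exact: (cnorm_term_le_ip (x^~ ord0)).
Qed.

Lemma hnorm_le_sum x : hnorm x <= \sum_i cnorm (x i ord0).
Proof.
have s0 : 0 <= \sum_i cnorm (x i ord0) by apply: sumr_ge0 => i _; exact: (nrm_ge0 hA).
rewrite -(@ler_pXn2r _ 2) ?nnegrE ?hnorm_ge0// hnorm_sqr.
apply: le_trans (nrm_sum hA _ _ _) _; rewrite expr2 mulr_suml; apply: ler_sum => i _.
rewrite cnorm_star expr2 ler_wpM2l ?(nrm_ge0 hA)//.
by rewrite (bigD1 i)//= lerDl; apply: sumr_ge0 => j _; exact: (nrm_ge0 hA).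
Qed.

Lemma hnorm_sum_bound a x :
  hnorm (a *m x) <= (\sum_i \sum_j cnorm (a i j)) * hnorm x.
Proof.
apply: le_trans (hnorm_le_sum _) _; rewrite mulr_suml; apply: ler_sum => i _.
rewrite mxE; apply: le_trans (nrm_sum hA _ _ _) _.
rewrite mulr_suml; apply: ler_sum => j _; apply: le_trans (cnormM _ _) _.
by rewrite ler_wpM2l ?(nrm_ge0 hA)// hnorm_entry.
Qed.

(** The operator norm as a greatest lower bound of constants, so that it is a real number from the
    start; [hnorm_sum_bound] provides one such constant. *)
Definition mnorm a : R :=
  inf [set t | 0 <= t /\ forall x, hnorm (a *m x) <= t * hnorm x].

Lemma mnorm_le a t : 0 <= t -> (forall x, hnorm (a *m x) <= t * hnorm x) ->
  mnorm a <= t.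
Proof.
by move=> t0 ht; apply: ge_inf => //; exists 0 => s [].
Qed.

Let mnorm_set_nonempty a :
  [set t | 0 <= t /\ forall x, hnorm (a *m x) <= t * hnorm x] !=set0.
Proof.
exists (\sum_i \sum_j cnorm (a i j)); split; last exact: hnorm_sum_bound.
by apply: sumr_ge0 => i _; apply: sumr_ge0 => j _; exact: (nrm_ge0 hA).
Qed.

Lemma mnorm_ge0 a : 0 <= mnorm a.
Proof. by apply: lb_le_inf => // t []. Qed.

Lemma mnormP a x : hnorm (a *m x) <= mnorm a * hnorm x.
Proof.
have [x0|xn0] := eqVneq (hnorm x) 0.
  by have := hnorm_sum_bound a x; rewrite x0 !mulr0.
have xp : 0 < hnorm x by rewrite lt_def xn0 hnorm_ge0.
rewrite -ler_pdivrMr//; apply: lb_le_inf => // t [t0 /(_ x)].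
by rewrite ler_pdivrMr.
Qed.

Lemma mnorm_sum a : mnorm a <= \sum_i \sum_j cnorm (a i j).
Proof.
apply: mnorm_le; last exact: hnorm_sum_bound.
by apply: sumr_ge0 => i _; apply: sumr_ge0 => j _; exact: (nrm_ge0 hA).
Qed.

Lemma mnorm_entry a i j : cnorm (a i j) <= mnorm a.
Proof.
pose e : 'cV[A]_n := \col_k (k == j)%:R.
have -> : a i j = (a *m e) i ord0.
  rewrite mxE (bigD1 j)//= big1 ?addr0 => [|k kj]; rewrite mxE ?eqxx ?mulr1//.
  by rewrite (negbTE kj) mulr0.
apply: le_trans (hnorm_entry _ _) _; apply: le_trans (mnormP _ _) _.
apply: ler_piMr; first exact: mnorm_ge0.
apply: le_trans (hnorm_le_sum _) _; rewrite (bigD1 j)//= big1 => [|k kj].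
  by rewrite mxE eqxx addr0 (nrm1 hA).
by rewrite mxE (negbTE kj) (nrm0 hA).
Qed.

Definition mx_sc := (@scalar_mx A n \o in_alg A) : {rmorphism R[i] -> 'M[A]_n}.

Lemma mx_sc_entry c a i j : (mx_sc c * a) i j = c *: a i j.
Proof. by rewrite -[_ * _]/(_ *m _) mul_scalar_mx mxE /= -scalerAl mul1r. Qed.

Lemma mx_sc_col c x i : (mx_sc c *m x) i ord0 = c *: x i ord0.
Proof. by rewrite mul_scalar_mx mxE /= -scalerAl mul1r. Qed.

Lemma mx_sc_comm c a : mx_sc c * a = a * mx_sc c.
Proof.
apply/matrixP => i j; rewrite mx_sc_entry -[_ * _]/(_ *m _) mxE (bigD1 j)//= big1.
  by rewrite addr0 !mxE eqxx mulr1n -scalerAr mulr1.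
by move=> k kj; rewrite !mxE (negbTE kj) mulr0n mulr0.
Qed.

Lemma hnorm_sc c x : hnorm (mx_sc c *m x) = complex.Re `|c| * hnorm x.
Proof.
have r0 : 0 <= complex.Re `|c| by rewrite normc_def /= sqrtr_ge0.
apply/eqP; rewrite -(@eqrXn2 _ 2) ?mulr_ge0 ?hnorm_ge0// exprMn !hnorm_sqr.
apply/eqP; have -> : cip (mx_sc c *m x) (mx_sc c *m x) = (c * c^*%C) *: cip x x.
  rewrite /cip /ip scaler_sumr; apply: eq_bigr => i _.
  by rewrite mx_sc_col starZ -scalerAl -scalerAr scalerA mulrC.
rewrite cnormZ; congr (_ * _).
by rewrite -sqr_normc [in LHS]normrX normr_id normc_def -rmorphXn.
Qed.

(** |bx|^2 = |<b^*bx, x>| <= |b^*b| |x|^2 by Cauchy-Schwarz: the nontrivial half of the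
    C*-identity. *)
Let mnorm_sqr_le b : mnorm b ^+ 2 <= mnorm (mxstar b *m b).
Proof.
pose t := Num.sqrt (mnorm (mxstar b *m b)).
have t0 : 0 <= t by apply: sqrtr_ge0.
have tE : t ^+ 2 = mnorm (mxstar b *m b) by rewrite sqr_sqrtr ?mnorm_ge0.
rewrite -tE ler_pXn2r ?nnegrE ?mnorm_ge0//.
apply: mnorm_le => // x.
rewrite -(@ler_pXn2r _ 2) ?nnegrE ?mulr_ge0 ?hnorm_ge0// exprMn tE.
rewrite hnorm_sqr cip_adj mulmxA.
have h1 := cip_CS (mxstar b *m b *m x) x; apply: le_trans h1 _.
by rewrite [hnorm x ^+ 2]expr2 mulrA ler_wpM2r ?hnorm_ge0// mnormP.
Qed.

Lemma mnormM a b : mnorm (a *m b) <= mnorm a * mnorm b.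
Proof.
apply: mnorm_le => [|x]; first by rewrite mulr_ge0 ?mnorm_ge0.
rewrite -mulmxA; apply: le_trans (mnormP _ _) _.
by rewrite -mulrA ler_wpM2l ?mnorm_ge0// mnormP.
Qed.

Lemma mnorm_mxstar a : mnorm (mxstar a) = mnorm a.
Proof.
have H b : mnorm b <= mnorm (mxstar b).
  have := le_trans (mnorm_sqr_le b) (mnormM _ _).
  have [->|b0] := eqVneq (mnorm b) 0; first by rewrite mnorm_ge0.
  by rewrite expr2 ler_pM2r// lt_def b0 mnorm_ge0.
by apply/eqP; rewrite eq_le H -{2}[a]mxstarK H.
Qed.

Lemma mnormD a b : mnorm (a + b) <= mnorm a + mnorm b.
Proof.
apply: mnorm_le => [|x]; first by rewrite addr_ge0 ?mnorm_ge0.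
rewrite mulmxDl mulrDl; apply: le_trans (hnormD _ _) _.
by apply: lerD; exact: mnormP.
Qed.

Lemma mnorm_sc c a : mnorm (mx_sc c *m a) = complex.Re `|c| * mnorm a.
Proof.
have r0 d : 0 <= complex.Re `|d : R[i]| by rewrite normc_def /= sqrtr_ge0.
have H d b : mnorm (mx_sc d *m b) <= complex.Re `|d| * mnorm b.
  apply: mnorm_le => [|x]; first by rewrite mulr_ge0 ?mnorm_ge0.
  by rewrite -mulmxA hnorm_sc -mulrA ler_wpM2l// mnormP.
apply/eqP; rewrite eq_le H andTb; have [->|c0] := eqVneq c 0.
  by rewrite normr0 mul0r mnorm_ge0.
have E : complex.Re `|c| * complex.Re `|c^-1| = 1.
  have : `|c| * `|c^-1| = 1 by rewrite -normrM divff// normr1.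
  by rewrite !normc_def -rmorphM => -[].
have := H c^-1 (mx_sc c *m a); rewrite mulmxA -[mx_sc _ *m mx_sc _]/(mx_sc _ * mx_sc _).
rewrite -rmorphM mulVf// rmorph1 mul1mx => /(ler_wpM2l (r0 c)).
by rewrite mulrA E mul1r.
Qed.

Lemma mnorm_lim (u : nat -> 'M[A]_n) (l : 'M[A]_n) :
  (forall i j e, 0 < e -> exists K, forall k, (K <= k)%N -> cnorm (u k i j - l i j) < e) ->
  forall e, 0 < e -> exists K, forall k, (K <= k)%N -> mnorm (u k - l) < e.
Proof.
(* The successor covers n = 0 and makes the final estimate, with n * n summands, strict. *)
move=> H e e0; have d0 : 0 < e / (n * n).+1%:R by rewrite divr_gt0.
pose K i j := sval (cid (H i j _ d0)).
exists (\max_i \max_j K i j) => k Kk.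
apply: le_lt_trans (mnorm_sum _) _.
have B i j : cnorm ((u k - l) i j) <= e / (n * n).+1%:R.
  rewrite !mxE; apply/ltW/(svalP (cid (H i j _ d0))).
  apply: leq_trans Kk; apply: leq_trans (leq_bigmax i).
  exact: (leq_bigmax j).
apply: le_lt_trans (ler_sum _ (fun i _ => ler_sum _ (fun j _ => B i j))) _.
rewrite !sumr_const !card_ord -mulrnA -[ltLHS]mulr_natr mulrAC ltr_pdivrMr//.
by rewrite ltr_pM2l// ltr_nat.
Qed.

Lemma cstar_norm_mx : cstar_norm (@mxstar A n n) mx_sc mnorm.
Proof.
split.
- exact: mxstarK.
- by move=> a b; apply/matrixP => i j; rewrite !mxE starD.
- exact: mxstarM.
- move=> c; apply/matrixP => i j; rewrite !mxE eq_sym -(cn_st_sc hA).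
  by case: eqP => _; rewrite ?mulr1n// mulr0n (st0 hA).
- exact: mx_sc_comm.
- move=> a a0; apply/matrixP => i j; rewrite mxE; apply: (nrm_le0 hA).
  by rewrite -a0 mnorm_entry.
- exact: mnormD.
- exact: mnormM.
- exact: mnorm_sc.
- move=> a; apply/eqP; rewrite eq_le mnorm_sqr_le andbT.
  by apply: le_trans (mnormM _ _) _; rewrite mnorm_mxstar expr2.
move=> u hu.
have H i j : exists l, forall e, 0 < e -> exists K, forall k, (K <= k)%N ->
       cnorm (u k i j - l) < e.
  apply: (cn_complete hA) => e /hu[K hK]; exists K => k l Kk Kl.
  apply: le_lt_trans (hK k l Kk Kl); have := mnorm_entry (u k - u l) i j.
  by rewrite !mxE.
pose l i j := sval (cid (H i j)); exists (\matrix_(i, j) l i j).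
by apply: mnorm_lim => i j; rewrite mxE; exact: (svalP (cid (H i j))).
Qed.

Definition mxcpos (a : 'M[A]_n) : Prop := cpos (@mxstar A n n) mx_sc mnorm a.

End MatrixNorm.

Local Notation hM := (cstar_norm_mx).

(** Positivity is taken in the whole of M_n(A) throughout; corners and fixed points enter only at
    the end, through [cp_map_corner]. *)
Definition cp_map (th : A -> A) : Prop :=
  forall n (a : 'M[A]_n), mxcpos a -> mxcpos (map_mx th a).

Lemma mxcposP n (a : 'M[A]_n) : mxcpos a <-> exists b : 'M[A]_n, a = mxstar b *m b.
Proof. exact: (cposP (hM n)). Qed.

Lemma cp_mapD th1 th2 : cp_map th1 -> cp_map th2 -> cp_map (fun a => th1 a + th2 a).
Proof.
move=> c1 c2 n a pa.
have -> : map_mx (fun a => th1 a + th2 a) a = map_mx th1 a + map_mx th2 a.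
  by apply/matrixP => i j; rewrite !mxE.
by apply: (cposD (hM n)); [exact: c1|exact: c2].
Qed.

Lemma cp_map0 : cp_map (fun=> 0).
Proof.
move=> n a _; have -> : map_mx (fun=> 0) a = 0 :> 'M[A]_n.
  by apply/matrixP => i j; rewrite !mxE.
exact: (cpos0 (hM n)).
Qed.

Lemma cp_map_sum (I : Type) (r : seq I) (th : I -> A -> A) :
  (forall i, cp_map (th i)) -> cp_map (fun a => \sum_(i <- r) th i a).
Proof.
move=> cth; elim: r => [|i r IH].
  by under [X in cp_map X]funext => a do rewrite big_nil; exact: cp_map0.
by under [X in cp_map X]funext => a do rewrite big_cons; exact: cp_mapD.
Qed.

Lemma cp_map_conj v th : cp_map th -> cp_map (fun a => star v * th a * v).
Proof.
move=> cth n a pa.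
have -> : map_mx (fun a => star v * th a * v) a = mxstar (v%:M : 'M[A]_n) *m map_mx th a *m (v%:M : 'M[A]_n).
  apply/matrixP => i j; rewrite !mxE (bigD1 j)//= big1 => [|k kj].
    rewrite addr0 !mxE eqxx mulr1n (bigD1 i)//= big1 => [|k ki].
      by rewrite addr0 !mxE eqxx mulr1n.
    by rewrite !mxE (negbTE ki) mulr0n (st0 hA) mul0r.
  by rewrite !mxE (negbTE kj) mulr0n mulr0.
by apply: (cpos_conj (hM n)); exact: cth.
Qed.

Lemma cp_map_scale r th : 0 <= r -> cp_map th -> cp_map (fun a => (r%:C)%C *: th a).
Proof.
move=> r0 cth n a pa.
have -> : map_mx (fun a => (r%:C)%C *: th a) a = mx_sc n (r%:C)%C * map_mx th a.
  by apply/matrixP => i j; rewrite mx_sc_entry !mxE.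
by apply: (cpos_rsc (hM n)) => //; exact: cth.
Qed.

Lemma cp_map_comp th1 th2 : cp_map th1 -> cp_map th2 -> cp_map (th1 \o th2).
Proof. by move=> c1 c2 n a pa; rewrite map_mx_comp; apply/c1/c2. Qed.

Lemma cp_map_hom (f : {lrmorphism A -> A}) :
  (forall a, f (star a) = star (f a)) -> cp_map f.
Proof.
move=> fst n a /mxcposP[b ->]; apply/mxcposP; exists (map_mx f b).
rewrite map_mxM; congr (_ *m _).
by apply/matrixP => i j; rewrite !mxE; exact: fst.
Qed.

Lemma cp_map_lim (th : nat -> A -> A) (l : A -> A) :
  (forall k, cp_map (th k)) ->
  (forall a e, 0 < e -> exists K, forall k, (K <= k)%N -> cnorm (th k a - l a) < e) ->
  cp_map l.
Proof.
move=> cth lim n a pa; apply: (cpos_closed (hM n)) => e e0.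
have H i j d : 0 < d -> exists K, forall k, (K <= k)%N ->
    cnorm (map_mx (th k) a i j - map_mx l a i j) < d.
  by move=> /(lim (a i j))[K hK]; exists K => k /hK; rewrite !mxE.
have [K hK] := mnorm_lim H e0.
by exists (map_mx (th K) a); [exact: cth|exact: hK].
Qed.

Lemma mx_over_closed n (D : set A) : closed_subalg (in_alg A) (@cnorm R A) D -> D 0 ->
  closed_subalg (mx_sc n) (@mnorm n) (mx_over D).
Proof.
move=> cD D0; split => [a b Da Db i j|a b Da Db i j|r a Da i j|a ad i j].
- by rewrite mxE; apply: (csa_D cD).
- rewrite mxE; apply: (big_ind D) => // [x y|k _]; first exact: (csa_D cD).
  exact: (csa_M cD).
- rewrite mx_sc_entry; have := csa_sc cD r (Da i j).
  by rewrite /rsc /= -scalerAl mul1r.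
- apply: (csa_closed cD) => e /ad[b Db ab]; exists (b i j) => //.
  apply: le_lt_trans ab; have := mnorm_entry (b - a) i j.
  by rewrite !mxE.
Qed.

(** The target demands a factor b^*b with entries of b in D. A positive matrix with entries in D has
    a self-adjoint root with entries in D, because p times the identity matrix is a unit for it and
    can play the role of e in [cpos_sqrt_corner]. *)
Lemma cp_map_corner (D : set A) (p : A) (th : A -> A) :
  closed_subalg (in_alg A) (@cnorm R A) D -> D p -> is_projection p ->
  (forall a, D (th a)) -> (forall a, p * th a = th a) -> cp_map th ->
  completely_positive setT D th.
Proof.
move=> cD Dp [sp pp] Dth pth cth n a [b _ <-].
have pa : mxcpos (map_mx th (mxstar b *m b)).
  by apply: cth; apply/mxcposP; exists b.
have cM := @mx_over_closed n D cD (csa0 cD Dp).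
have [|||||s [ss sE Ds]] := @cpos_sqrt_corner _ _ _ _ _ (hM n) _ (p%:M) _ cM _ _ _ _ _ pa.
- apply/matrixP => i j; rewrite !mxE eq_sym.
  by case: eqP => _; rewrite ?mulr1n ?sp// mulr0n (st0 hA).
- by rewrite -rmorphM pp.
- move=> i j; rewrite mxE; case: eqP => _; first by rewrite mulr1n.
  by rewrite mulr0n; exact: (csa0 cD Dp).
- by move=> i j; rewrite mxE; exact: Dth.
- by rewrite -[_ * _]/(_ *m _) mul_scalar_mx; apply/matrixP => i j; rewrite !mxE pth.
by exists s => //; rewrite ss.
Qed.

(** The matrix is b^*b for b with rows (1, a) and (0, s), where s is the root of 1 - a^*a. *)
Lemma mx2_cpos (a : A) : cnorm a <= 1 ->
  mxcpos (\matrix_(i < 2, j < 2) if i == ord0 then if j == ord0 then 1 else a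
                                  else if j == ord0 then star a else 1).
Proof.
move=> a1.
have [||s [ss sE _ _]] := cpos_sqrt hA (@cpos_rsc_sub _ _ _ _ _ hA (star a * a) 1 _ _).
- by rewrite starM starK.
- by rewrite cnorm_star expr_le1 ?(nrm_ge0 hA).
apply/mxcposP; exists (\matrix_(i < 2, j < 2) if i == ord0 then if j == ord0 then 1 else a
                                  else if j == ord0 then 0 else s).
have s1 := st1 hA; have s0 := st0 hA.
apply/matrixP => i j; rewrite mxE !mxE 2!big_ord_recl big_ord0 !mxE /=.
case: (i == ord0); case: (j == ord0);
  rewrite ?s1 ?s0 ?mul0r ?mulr0 ?mulr1 ?mul1r ?addr0//.
by rewrite ss sE (rsc1 (in_alg A)) addrC subrK.
Qed.

(** On the unit ball apply th to the matrix of [mx2_cpos]. The image is a Gram matrix with upper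
    left entry p and off-diagonal entry th(a), so Cauchy-Schwarz bounds |th(a)|^2 by a product of
    two norms of p. *)
Lemma cp_map_contractive (th : A -> A) (p : A) :
  (forall r a, th ((r%:C)%C *: a) = (r%:C)%C *: th a) ->
  is_projection p -> th 1 = p -> cp_map th -> forall a, cnorm (th a) <= cnorm a.
Proof.
move=> thZ [sp pp] th1 cth.
have p1 : cnorm p <= 1 by exact: (nrm_proj hA sp pp).
suff H a : cnorm a <= 1 -> cnorm (th a) <= 1.
  move=> a; have [a0|an0] := eqVneq (cnorm a) 0.
    have -> : th a = 0.
      by rewrite (cnorm0_eq0 _ a0) -[X in th X](scale0r (0 : A)) (thZ 0) scale0r.
    by rewrite a0 (nrm0 hA).
  have ap : 0 < cnorm a by rewrite lt_def an0 (nrm_ge0 hA).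
  have nZ (r : R) (b : A) : cnorm ((r%:C)%C *: b) = `|r| * cnorm b.
    by have := nrm_rsc hA r b; rewrite /rsc /= -scalerAl mul1r.
  have := H (((cnorm a)^-1%:C)%C *: a); rewrite thZ !nZ.
  by rewrite !ger0_norm ?invr_ge0 ?(ltW ap)// mulVf// lexx ler_pdivrMl// mulr1; apply.
move=> /mx2_cpos/cth/mxcposP[b bE].
have E i j : map_mx th (\matrix_(i < 2, j < 2) if i == ord0 then if j == ord0 then 1 else a
   else if j == ord0 then star a else 1) i j = ip (b^~ i) (b^~ j).
  by rewrite bE !mxE; apply: eq_bigr => k _; rewrite !mxE.
have := ip_CS (b^~ ord0) (b^~ ord_max); rewrite -!E !mxE /= th1 => h.
rewrite -(@expr_le1 _ 2) ?(nrm_ge0 hA)//; apply: le_trans h _.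
by rewrite mulr_ile1 ?(nrm_ge0 hA).
Qed.

End CStarAlgebraNorm.

(** * Null sequences *)

(** The near-covering form of compactness is applied to the filter of finite lists in K directed by
    inclusion. *)
Lemma compact_finite_cover (T : topologicalType) (K : set T) (U : T -> set T) :
  compact K -> (forall x, K x -> nbhs x (U x)) ->
  exists s : seq T, (forall x, x \in s -> K x) /\
    forall y, K y -> exists2 x, x \in s & U x y.
Proof.
move=> /compact_near_coveringP cK hU.
pose F : set_system (seq T) := filter_from [set s0 : seq T | forall x, x \in s0 -> K x]
  (fun s0 : seq T => [set s : seq T | (forall x, x \in s -> K x) /\ {subset s0 <= s}]).
have FF : Filter F.
  apply: filter_from_filter; first by exists [::].
  move=> s1 s2 K1 K2; exists (s1 ++ s2).
    by move=> x; rewrite mem_cat => /orP[/K1|/K2].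
  move=> s [Ks sub]; split; split=> // x xs; apply: sub; rewrite mem_cat xs ?orbT//.
have [|s0 /= K0 hs] := cK _ F (fun (s : seq T) y => exists2 x, x \in s & U x y) FF.
  move=> x Kx; exists (U x, [set s : seq T | (forall y, y \in s -> K y) /\ x \in s]).
    split; first exact: hU.
    exists [:: x]; first by move=> y; rewrite inE => /eqP ->.
    by move=> s [Ks sub]; split=> //; apply: sub; rewrite inE.
  by move=> [y s] /= [Uxy [_ xs]]; exists x.
by exists s0; split=> // y Ky; have := hs s0 (conj K0 (fun _ h => h)) y Ky.
Qed.

Section Asymptotics.
Variables (R : realType) (A : cstarAlgType R).
Local Notation hA := (cstar_norm_alg A).
Implicit Types (u v w : nat -> A) (a b : A).

(** On bounded sequences this is equality in the quotient of the bounded by the null sequences. *)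
Definition aeq u v : Prop :=
  forall e : R, 0 < e -> \forall k \near \oo, cnorm (u k - v k) < e.

Definition tends u a : Prop := aeq u (fun=> a).

Definition bdd u : Prop := exists M : R, forall k, cnorm (u k) <= M.

Lemma aeq_refl u : aeq u u.
Proof. by move=> e e0; near=> k; rewrite subrr (nrm0 hA). Unshelve. all: by end_near. Qed.

Lemma aeq_ext u' v' u v : u =1 u' -> v =1 v' -> aeq u' v' -> aeq u v.
Proof. by move=> uu vv h e /h; apply: filterS => k; rewrite uu vv. Qed.

Lemma aeq_eq u v : u =1 v -> aeq u v.
Proof. by move=> uv; apply: aeq_ext uv (frefl _) (aeq_refl v). Qed.

Lemma aeq_sym u v : aeq u v -> aeq v u.
Proof. by move=> uv e /uv; apply: filterS => k; rewrite (nrm_distC hA). Qed.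

Lemma aeq_le u v w (M : R) : aeq v w ->
  (forall k, cnorm (u k) <= M * cnorm (v k - w k)) -> aeq u (fun=> 0).
Proof.
move=> vw h e e0; have M0 : 0 < `|M| + 1 by rewrite ltr_wpDl.
have := vw _ (divr_gt0 e0 M0); apply: filterS => k; rewrite ltr_pdivlMr// => hk.
rewrite subr0; apply: le_lt_trans (h k) _; apply: le_lt_trans hk.
have := nrm_ge0 hA (v k - w k); have := ler_norm M; nra.
Qed.

Lemma aeq_trans v u w : aeq u v -> aeq v w -> aeq u w.
Proof.
move=> uv vw e e0; have e2 : 0 < e / 2 by rewrite divr_gt0.
near=> k; apply: le_lt_trans (nrm_tri hA _ (v k) _) _.
rewrite (splitr e) ltrD//; near: k; [exact: uv|exact: vw].
Unshelve. all: by end_near. Qed.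

Lemma aeqD u v u' v' : aeq u u' -> aeq v v' -> aeq (fun k => u k + v k) (fun k => u' k + v' k).
Proof.
move=> uv vw e e0; have e2 : 0 < e / 2 by rewrite divr_gt0.
near=> k; rewrite opprD addrACA; apply: le_lt_trans (cnormD _ _) _.
rewrite (splitr e) ltrD//; near: k; [exact: uv|exact: vw].
Unshelve. all: by end_near. Qed.

Lemma aeqN u v : aeq u v -> aeq (fun k => - u k) (fun k => - v k).
Proof. by move=> uv e /uv; apply: filterS => k; rewrite -opprD (nrmN hA). Qed.

Lemma aeqB u v u' v' : aeq u u' -> aeq v v' -> aeq (fun k => u k - v k) (fun k => u' k - v' k).
Proof. by move=> uu vv; apply: aeqD => //; exact: aeqN. Qed.

Lemma aeq_sum (I : Type) (r : seq I) (u v : I -> nat -> A) :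
  (forall i, aeq (u i) (v i)) ->
  aeq (fun k => \sum_(i <- r) u i k) (fun k => \sum_(i <- r) v i k).
Proof.
move=> uv; elim: r => [|i r IH].
  by move=> e e0; near=> k; rewrite !big_nil subrr (nrm0 hA).
move=> e e0; have := aeqD (uv i) IH e0; apply: filterS => k.
by rewrite !big_cons.
Unshelve. all: by end_near. Qed.

Lemma aeq_eventually_bdd u v : bdd v -> aeq u v ->
  exists2 M : R, 0 <= M & \forall k \near \oo, cnorm (u k) <= M.
Proof.
move=> [M hM] uv; exists (`|M| + 1); first by rewrite addr_ge0.
have := uv 1 ltr01; apply: filterS => k h.
have := cnormD (u k - v k) (v k); rewrite subrK => h1; apply: le_trans h1 _.
by rewrite addrC lerD ?(ltW h)// (le_trans (hM k))// ler_norm.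
Qed.

Lemma aeqM u v u' v' : bdd u' -> bdd v' -> aeq u u' -> aeq v v' ->
  aeq (fun k => u k * v k) (fun k => u' k * v' k).
Proof.
move=> [M hM] bv uu vv; have [B B0 hB] := aeq_eventually_bdd bv vv.
have M0 : 0 <= M by apply: le_trans (hM 0%N); exact: (nrm_ge0 hA).
move=> e e0; have d0 : 0 < e / (B + M + 1) by rewrite divr_gt0// ltr_wpDl// addr_ge0.
near=> k.
have -> : u k * v k - u' k * v' k = (u k - u' k) * v k + u' k * (v k - v' k).
  by rewrite mulrBl mulrBr addrA subrK.
have h1 : cnorm (u k - u' k) < e / (B + M + 1) by near: k; exact: uu.
have h2 : cnorm (v k - v' k) < e / (B + M + 1) by near: k; exact: vv.
have h3 : cnorm (v k) <= B by near: k.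
apply: le_lt_trans (cnormD _ _) _.
apply: le_lt_trans (lerD (cnormM _ _) (cnormM _ _)) _.
have S0 : 0 < B + M + 1 by rewrite ltr_wpDl// addr_ge0.
move: h1 h2; rewrite !ltr_pdivlMr// => h1 h2.
have n1 := nrm_ge0 hA (u k - u' k); have n2 := nrm_ge0 hA (v k - v' k).
have n3 := nrm_ge0 hA (v k); have n4 := nrm_ge0 hA (u' k); have h4 := hM k.
have p1 : cnorm (u k - u' k) * cnorm (v k) <= cnorm (u k - u' k) * B by rewrite ler_wpM2l.
have p2 : cnorm (u' k) * cnorm (v k - v' k) <= M * cnorm (v k - v' k) by rewrite ler_wpM2r.
pose m := Num.max (cnorm (u k - u' k)) (cnorm (v k - v' k)).
have m0 : 0 <= m by rewrite le_max n1.
have q1 : cnorm (u k - u' k) <= m by rewrite le_max lexx.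
have q2 : cnorm (v k - v' k) <= m by rewrite le_max lexx orbT.
have q3 : m * (B + M + 1) < e by rewrite /m /Num.max; case: ifP.
have : cnorm (u k - u' k) * B <= m * B by rewrite ler_wpM2r.
have : M * cnorm (v k - v' k) <= M * m by rewrite ler_wpM2l.
lra.
Unshelve. all: by end_near. Qed.

Lemma bdd_cst a : bdd (fun=> a). Proof. by exists (cnorm a). Qed.

Lemma bddM u v : bdd u -> bdd v -> bdd (fun k => u k * v k).
Proof.
move=> [M hM] [B hB]; exists (M * B) => k; apply: le_trans (cnormM _ _) _.
by apply: ler_pM; rewrite ?(nrm_ge0 hA).
Qed.

Lemma bdd_sum (I : Type) (r : seq I) (u : I -> nat -> A) :
  (forall i, bdd (u i)) -> bdd (fun k => \sum_(i <- r) u i k).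
Proof.
move=> bu; elim: r => [|i r [M hM]].
  by exists 0 => k; rewrite big_nil (nrm0 hA).
have [B hB] := bu i; exists (B + M) => k; rewrite big_cons.
by apply: le_trans (cnormD _ _) _; exact: lerD.
Qed.

Lemma cnormZr (r : R) a : cnorm ((r%:C)%C *: a) = `|r| * cnorm a.
Proof. by have := nrm_rsc hA r a; rewrite /rsc /= -scalerAl mul1r. Qed.

Lemma aeqZ (c : R[i]) u v : aeq u v -> aeq (fun k => c *: u k) (fun k => c *: v k).
Proof.
move=> uv e e0; have n0 : 0 <= complex.Re `|c| by rewrite normc_def /= sqrtr_ge0.
have M0 : 0 < complex.Re `|c| + 1 by rewrite ltr_wpDl.
have := uv _ (divr_gt0 e0 M0); apply: filterS => k; rewrite ltr_pdivlMr// => hk.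
rewrite -scalerBr cnormZ; apply: le_lt_trans hk.
by rewrite mulrDr mulr1 mulrC lerDl (nrm_ge0 hA).
Qed.

Lemma tends_le u a b (t : R) : tends u a -> (\forall k \near \oo, cnorm (u k - b) <= t) ->
  cnorm (a - b) <= t.
Proof.
move=> ua ut; apply/ler_addgt0Pl => e e0.
suff: \forall k \near \oo, cnorm (a - b) <= e + t.
  by move=> [K _ h]; exact: (h K (leqnn K)).
near=> k; apply: le_trans (nrm_tri hA _ (u k) _) _; apply: lerD.
  by rewrite (nrm_distC hA); apply/ltW; near: k; exact: ua.
by near: k.
Unshelve. all: by end_near. Qed.

Lemma tends_unique u a b : tends u a -> tends u b -> a = b.
Proof.
move=> ua ub; apply: (nrm_small hA) => e e0.
apply: le_lt_trans (_ : _ <= e / 2) _; last by rewrite ltr_pdivrMr// ltr_pMr// ltr1n.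
apply: tends_le ua _; near=> k; apply/ltW; near: k; apply: ub.
by rewrite divr_gt0.
Unshelve. all: by end_near. Qed.

Lemma tends_complete u :
  (forall e : R, 0 < e -> exists K, forall i j, (K <= i)%N -> (K <= j)%N ->
     cnorm (u i - u j) < e) -> exists a, tends u a.
Proof.
move=> /(cn_complete hA)[a ha]; exists a => e /ha[K hK].
by exists K.
Qed.

Lemma lipschitz_aeq (f : nat -> A -> A) (M : R) u v :
  (forall k a b, cnorm (f k a - f k b) <= M * cnorm (a - b)) -> aeq u v ->
  aeq (fun k => f k (u k)) (fun k => f k (v k)).
Proof.
move=> lf uv e e0; have := aeq_le uv (fun k => lf k (u k) (v k)) e0.
by apply: filterS => k; rewrite subr0.
Qed.

End Asymptotics.

(** * An invariant mean *)

Section Averaging.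
Variables (R : realType) (A : cstarAlgType R) (G : topologicalGroupType).
Variable alpha : G -> {lrmorphism A -> A}.
Hypothesis alpha_action : continuous_action alpha.
Local Notation hA := (cstar_norm_alg A).

(** A *-homomorphism preserves elements b^*b, hence positivity; applied to |a|^2 - a^*a this bounds
    f(a)^*f(a) by |a|^2. *)
Lemma cnorm_hom (f : {lrmorphism A -> A}) (a : A) :
  (forall a, f (star a) = star (f a)) -> cnorm (f a) <= cnorm a.
Proof.
move=> fs; have fM b c : f (b * c) = f b * f c by exact: rmorphM.
have fpos h : cspos h -> cspos (f h).
  by move=> /(cposP hA)[b ->]; apply/(cposP hA); exists (f b); rewrite fM fs.
rewrite -(@ler_pXn2r _ 2) ?nnegrE ?(nrm_ge0 hA)// -cnorm_star -fs -fM.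
apply: (cpos_le_rsc hA); first by rewrite exprn_ge0 ?(nrm_ge0 hA).
  exact/fpos/(cpos_mulst hA).
have : cspos (rsc (in_alg A) (cnorm a ^+ 2) - star a * a).
  by apply: (cpos_rsc_sub hA); rewrite ?starM ?starK// cnorm_star.
by move=> /fpos; rewrite rmorphB /rsc /= linearZ /= rmorph1.
Qed.

Let ast g a : alpha g (star a) = star (alpha g a).
Proof. by case: alpha_action => + _ _ _; apply. Qed.
Let a1 a : alpha 1%g a = a.
Proof. by case: alpha_action => _ + _ _; apply. Qed.
Let aM g h a : alpha (g * h)%g a = alpha g (alpha h a).
Proof. by case: alpha_action => _ _ + _; apply. Qed.
Let aV g a : alpha g^-1%g (alpha g a) = a.
Proof. by rewrite -aM mulVg a1. Qed.
Lemma cnorm_act g a : cnorm (alpha g a) = cnorm a.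
Proof.
apply/eqP; rewrite eq_le (cnorm_hom _ (ast g)) andTb.
by rewrite -{1}(aV g a) (cnorm_hom _ (ast _)).
Qed.

Lemma act_nbhs a g (e : R) : 0 < e ->
  nbhs g [set h | cnorm (alpha g a - alpha h a) < e].
Proof.
move=> e0; case: alpha_action => _ _ _ ca.
exact: (ca a g _ (cnorm_nbhs (alpha g a) e0)).
Qed.

(** A list, so that repetitions act as weights and a mean of means is the mean over the list of
    products. *)
Definition mean (s : seq G) (a : A) : A :=
  (((size s)%:R^-1)%:C)%C *: \sum_(h <- s) alpha h a.

Lemma mean_lin s (c : R[i]) a b : mean s (c *: a + b) = c *: mean s a + mean s b.
Proof.
rewrite /mean scalerA mulrC -scalerA -scalerDr; congr (_ *: _).
rewrite scaler_sumr -big_split /=; apply: eq_bigr => h _.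
by rewrite linearD linearZ.
Qed.

Lemma mean_mean s r a : mean s (mean r a) = mean [seq (h * k)%g | h <- s, k <- r] a.
Proof.
rewrite /mean size_allpairs natrM invfM rmorphM -scalerA; congr (_ *: _).
rewrite big_allpairs_dep /= [RHS]scaler_sumr; apply: eq_bigr => h _; rewrite linearZ /=.
by congr (_ *: _); rewrite linear_sum; apply: eq_bigr => k _; rewrite aM.
Qed.

Lemma mean_bound s (f : G -> A) (b : A) (t : R) : s != [::] ->
  (forall h, h \in s -> cnorm (f h - b) <= t) ->
  cnorm ((((size s)%:R^-1)%:C)%C *: \sum_(h <- s) f h - b) <= t.
Proof.
move=> s0 ht; have n0 : (size s)%:R != 0 :> R by rewrite pnatr_eq0 size_eq0.
have bE : b = (((size s)%:R^-1)%:C)%C *: \sum_(h <- s) b.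
  rewrite big_const_seq count_predT iter_addr_0 -[b *+ _]scaler_nat scalerA.
  have -> : ((size s)%:R : R[i]) = ((size s)%:R%:C)%C by rewrite rmorph_nat.
  by rewrite -rmorphM mulVf// rmorph1 scale1r.
rewrite {1}bE -scalerBr cnormZr ger0_norm ?invr_ge0// mulrC.
rewrite ler_pdivrMr ?lt_def ?n0 ?ler0n// -sumrB.
apply: le_trans (nrm_sum hA _ _ _) _.
rewrite mulr_natr -[size s]count_predT -iter_addr_0 -big_const_seq.
by rewrite big_seq [leRHS]big_seq; apply: ler_sum => h; exact: ht.
Qed.

Lemma mean_hull s a b (t : R) : s != [::] -> (forall h, cnorm (alpha h a - b) <= t) ->
  cnorm (mean s a - b) <= t.
Proof. by move=> s0 ht; apply: mean_bound => // h _. Qed.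

Lemma act_mean g s a : alpha g (mean s a) =
  (((size s)%:R^-1)%:C)%C *: \sum_(h <- s) alpha (g * h)%g a.
Proof.
by rewrite /mean linearZ linear_sum; congr (_ *: _); apply: eq_bigr => h _; rewrite aM.
Qed.

Lemma cnorm_mean s a : s != [::] -> cnorm (mean s a) <= cnorm a.
Proof.
move=> s0; rewrite -[mean s a]subr0; apply: mean_hull => // h.
by rewrite subr0 cnorm_act.
Qed.

Lemma mean_fixed s b a c : s != [::] -> fixed alpha b -> fixed alpha c ->
  mean s (b * a * c) = b * mean s a * c.
Proof.
move=> _ fb fc; rewrite /mean -scalerAr -scalerAl; congr (_ *: _).
rewrite mulr_sumr mulr_suml; apply: eq_bigr => h _.
by rewrite !rmorphM; congr (_ * _ * _); [exact: fb|exact: fc].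
Qed.

Lemma mean1 s : s != [::] -> mean s 1 = 1.
Proof.
move=> s0; apply/eqP; rewrite -subr_eq0; apply/eqP/(nrm_le0 hA).
by apply: mean_hull => // h; rewrite rmorph1 subrr (nrm0 hA).
Qed.

Definition osc_le a (d : R) : Prop := forall g, cnorm (alpha g a - a) <= d.

Lemma osc_le2 a d g h : osc_le a d -> cnorm (alpha g a - alpha h a) <= d.
Proof.
move=> od; have -> : alpha g a - alpha h a = alpha h (alpha (h^-1 * g)%g a - a).
  by rewrite raddfB /= -aM mulgA mulgV mul1g.
by rewrite cnorm_act.
Qed.

(** The average and its translates are averages of points of the orbit of a, any two of which are
    within d. Thus further averaging never spoils what was gained. *)
Lemma osc_mean s a d : s != [::] -> osc_le a d ->
  osc_le (mean s a) d /\ cnorm (mean s a - a) <= d.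
Proof.
move=> s0 od; split; last by apply: mean_hull => // h; exact: od.
move=> g; rewrite (nrm_distC hA); apply: mean_hull => // h; rewrite (nrm_distC hA) act_mean.
by apply: mean_bound => // k _; exact: osc_le2.
Qed.

Hypothesis G_compact : compact [set: G].

(** Uniformity in k lets one net serve every average of the orbit: alpha_g(mean r a) is an average
    of the alpha_{gk}(a). For the proof, k is replaced by a point of an e/4-net r of the orbit, and
    the net s controls only the finitely many alpha_l(a) with l in r, up to e/2. *)
Lemma orbit_cover a (e : R) : 0 < e -> exists2 s : seq G, s != [::] &
  forall g, exists2 h, h \in s & forall k, cnorm (alpha (g * k)%g a - alpha (h * k)%g a) <= e.
Proof.
move=> e0; have e4 : 0 < e / 4 by rewrite divr_gt0.
have e2 : 0 < e / 2 by rewrite divr_gt0.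
have [r [_ hr]] := compact_finite_cover G_compact (fun k _ => act_nbhs a k e4).
pose V g := [set h | forall k, k \in r -> cnorm (alpha g (alpha k a) - alpha h (alpha k a)) < e / 2].
have hV g : [set: G] g -> nbhs g (V g).
  move=> _; rewrite /V; elim: r {hr V} => [|k r IH].
    by apply: filterS filterT => h _ k; rewrite in_nil.
  apply: filterS (filterI (act_nbhs (alpha k a) g e2) IH) => h [hk hrr] l.
  by rewrite inE => /orP[/eqP ->|/hrr].
have [s [_ hs]] := compact_finite_cover G_compact hV.
exists s; first by have [h + _] := hs 1%g I; case: s {hs}.
move=> g; have [h hin gh] := hs g I; exists h => // k; rewrite !aM.
have [l lr kl] := hr k I; have hl : cnorm (alpha h (alpha l a) - alpha g (alpha l a)) < e / 2 by exact: gh.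
have h1 := nrm_tri hA (alpha h (alpha k a)) (alpha h (alpha l a)) (alpha g (alpha k a)).
have h2 := nrm_tri hA (alpha h (alpha l a)) (alpha g (alpha l a)) (alpha g (alpha k a)).
have n1 : cnorm (alpha h (alpha k a) - alpha h (alpha l a)) < e / 4.
  by rewrite -raddfB cnorm_act (nrm_distC hA).
have n2 : cnorm (alpha g (alpha l a) - alpha g (alpha k a)) < e / 4.
  by rewrite -raddfB cnorm_act.
rewrite (nrm_distC hA); lra.
Qed.

(* Averaging over a finite e-net of the orbit shrinks the excess d - e of its
   diameter by the factor 1 - 1/size s. *)
Lemma osc_contract b (s : seq G) (e d : R) : s != [::] ->
  (forall g, exists2 h, h \in s & cnorm (alpha g b - alpha h b) <= e) ->
  osc_le b d -> osc_le (mean s b) (d - (d - e) / (size s)%:R).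
Proof.
move=> s0 cov od; set N := size s; set r := d - _.
have Np : 0 < N%:R :> R by rewrite ltr0n lt0n size_eq0.
have H x : cnorm (mean s b - alpha x b) <= r.
  have [h hs xh] := cov x.
  have -> : mean s b - alpha x b = ((N%:R^-1)%:C)%C *: \sum_(k <- s) (alpha k b - alpha x b).
    rewrite sumrB scalerBr; congr (_ - _).
    rewrite big_const_seq count_predT iter_addr_0 -[alpha x b *+ _]scaler_nat scalerA.
    have -> : (N%:R : R[i]) = (N%:R%:C)%C by rewrite rmorph_nat.
    by rewrite -rmorphM mulVf ?gt_eqF// rmorph1 scale1r.
  rewrite cnormZr ger0_norm ?invr_ge0// mulrC ler_pdivrMr//.
  (* The net point h close to x contributes at most e, the remaining N - 1 terms at most d each. *)
  rewrite (big_rem h hs)/=; apply: le_trans (cnormD _ _) _.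
  have -> : r * N%:R = e + (N%:R - 1) * d.
    by rewrite /r mulrBl mulfVK ?gt_eqF//; ring.
  apply: lerD; first by rewrite (nrm_distC hA).
  apply: le_trans (nrm_sum hA _ _ _) _.
  apply: le_trans (ler_sum _ (fun k _ => osc_le2 k x od)) _.
  rewrite big_const_seq count_predT iter_addr_0 size_rem// -/N -[leLHS]mulr_natl.
  by rewrite -subn1 natrB// lt0n size_eq0.
move=> g; rewrite (nrm_distC hA); have -> : alpha g (mean s b) =
  (((size s)%:R^-1)%:C)%C *: \sum_(h <- s) alpha (g * h)%g b by exact: act_mean.
rewrite (nrm_distC hA); apply: mean_bound => // h _.
by rewrite (nrm_distC hA); exact: H.
Qed.

(** [osc_contract] is iterated with one and the same net s, so the excess over e/2 decays
    geometrically with ratio q = 1 - 1/size s, from at most 2|a|. *)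
Lemma exists_mean_osc a (e : R) : 0 < e -> exists2 s : seq G, s != [::] & osc_le (mean s a) e.
Proof.
move=> e0; have e2 : 0 < e / 2 by rewrite divr_gt0.
have [s s0 cov] := orbit_cover a e2.
have cov' r : r != [::] -> forall g, exists2 h, h \in s &
    cnorm (alpha g (mean r a) - alpha h (mean r a)) <= e / 2.
  move=> r0 g; have [h hs gh] := cov g; exists h => //.
  rewrite !act_mean -scalerBr -sumrB -[X in cnorm X]subr0.
  by apply: mean_bound => // k _; rewrite subr0.
have Np : 0 < (size s)%:R :> R by rewrite ltr0n lt0n size_eq0.
pose q : R := 1 - (size s)%:R^-1.
have q0 : 0 <= q by rewrite subr_ge0 invf_le1// ler1n lt0n size_eq0.
have q1 : q < 1 by rewrite ltrBlDr ltrDl invr_gt0.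
have it j : exists2 r : seq G, r != [::] & osc_le (mean r a) (e / 2 + q ^+ j * (2 * cnorm a)).
  elim: j => [|j [r r0 IH]].
    exists [:: 1%g] => // g; rewrite expr0 mul1r.
    apply: le_trans (nrmB hA _ _) _; rewrite cnorm_act.
    have := @cnorm_mean [:: 1%g] a isT; lra.
  exists [seq (h * k)%g | h <- s, k <- r].
    by rewrite -size_eq0 size_allpairs muln_eq0 !size_eq0 negb_or s0.
  rewrite -mean_mean; have := osc_contract s0 (cov' r r0) IH.
  set d := (X in osc_le _ X -> _) => h.
  suff <- : d = e / 2 + q ^+ j.+1 * (2 * cnorm a) by [].
  by rewrite /d exprSr; set w := q ^+ j; rewrite /q; ring.
have : (fun j => q ^+ j * (2 * cnorm a)) @ \oo --> (0 : R).
  rewrite -(mul0r (2 * cnorm a)); apply: cvgMl.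
  by apply: cvg_expr; rewrite ger0_norm.
move=> /cvgrPdist_lt /(_ _ e2)[K _ /(_ K (leqnn K))] /=; rewrite sub0r normrN => hK.
have [r r0 hr] := it K; exists r => // g; apply: le_trans (hr g) _.
by have := ler_norm (q ^+ K * (2 * cnorm a)); lra.
Qed.

(** The elements are treated one after another; by [osc_mean] the later averages keep the earlier
    oscillations small. *)
Lemma exists_mean_osc_seq (l : seq A) (e : R) : 0 < e ->
  exists2 s : seq G, s != [::] & forall a, a \in l -> osc_le (mean s a) e.
Proof.
move=> e0; elim: l => [|a l [s s0 IH]]; first by exists [:: 1%g].
have [r r0 hr] := exists_mean_osc (mean s a) e0.
exists [seq (h * k)%g | h <- r, k <- s].
  by rewrite -size_eq0 size_allpairs muln_eq0 !size_eq0 negb_or s0 r0.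
move=> b; rewrite inE -mean_mean => /orP[/eqP -> //|/IH ob].
by have [] := osc_mean r0 ob.
Qed.

Lemma mean_id a : mean [:: 1%g] a = a.
Proof. by rewrite /mean big_seq1 a1 invr1 scale1r. Qed.

Lemma separable_seq : separable A ->
  exists d : nat -> A, forall a (e : R), 0 < e -> exists k, cnorm (a - d k) < e.
Proof.
move=> [D /countable_injP[f fI] dD].
pose d k := xget 0 [set a | D a /\ f a = k]; exists d => a e e0.
have [|b [ab Db]] := dD (interior [set b | cnorm (a - b) < e]) _ (open_interior _).
  by exists a; exact: cnorm_nbhs.
exists (f b); suff -> : d (f b) = b by exact: (interior_subset ab).
rewrite /d; case: xgetP => [c _ [Dc fc]|/(_ b)[]//].
by apply: fI; rewrite ?in_setE.
Qed.

(* Instead of integrating against Haar measure, compose finite means that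
   make more and more elements of a dense sequence almost invariant. *)
Lemma exists_mean_sequence : separable A -> exists2 r : nat -> seq G,
  (forall n, r n != [::]) & forall a (e : R), 0 < e -> exists K,
    (forall i j, (K <= i)%N -> (K <= j)%N -> cnorm (mean (r i) a - mean (r j) a) < e) /\
    (forall i, (K <= i)%N -> osc_le (mean (r i) a) e).
Proof.
move=> /separable_seq[d dD].
have step (p : seq G * nat) : exists s : seq G, s != [::] /\ forall k, (k <= p.2)%N ->
    osc_le (mean s (mean p.1 (d k))) (p.2.+1%:R^-1).
  have [|s s0 hs] := @exists_mean_osc_seq [seq mean p.1 (d k) | k <- iota 0 p.2.+1] (p.2.+1%:R^-1).
    by rewrite invr_gt0.
  exists s; split=> // k kp; apply: hs; apply/mapP; exists k => //.
  by rewrite mem_iota.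
pose S p := sval (cid (step p)).
have S0 p : S p != [::] by rewrite /S; case: cid => s [].
have SP p k : (k <= p.2)%N -> osc_le (mean (S p) (mean p.1 (d k))) (p.2.+1%:R^-1).
  by have [_ hs] := svalP (cid (step p)); exact: hs.
pose fix r (n : nat) : seq G :=
  if n is m.+1 then [seq (h * k)%g | h <- S (r m, m), k <- r m] else [:: 1%g].
have r0 n : r n != [::].
  elim: n => //= n IH.
  by rewrite -size_eq0 size_allpairs muln_eq0 !size_eq0 negb_or S0 IH.
have rS n a : mean (r n.+1) a = mean (S (r n, n)) (mean (r n) a) by rewrite mean_mean.
have oscS n k : (k <= n)%N -> osc_le (mean (r n.+1) (d k)) (n.+1%:R^-1).
  by move=> kn; rewrite rS; exact: SP.
(* Each later mean is a mean of the earlier one, so it moves an almost invariant element by no more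
   than its oscillation. This is the source of the Cauchy property. *)
have later n i a : (n <= i)%N -> exists2 s, s != [::] & mean (r i) a = mean s (mean (r n) a).
  move=> /subnK <-; elim: (i - n)%N => [|k [s s0 IH]].
    by exists [:: 1%g] => //; rewrite mean_id.
  exists [seq (h * k)%g | h <- S (r (k + n)%N, (k + n)%N), k <- s].
    by rewrite -size_eq0 size_allpairs muln_eq0 !size_eq0 negb_or S0.
  by rewrite addSn rS IH mean_mean.
exists r => // a e e0.
have e8 : 0 < e / 8 by rewrite divr_gt0.
have [k ak] := dD a _ e8.
have [n0 hn0] : exists n0 : nat, n0.+1%:R^-1 < e / 8.
  exists (Num.bound (e / 8)^-1); rewrite invf_plt ?posrE//.
  apply: lt_trans (archi_boundP _) _; first by rewrite invr_ge0 ltW.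
  by rewrite ltr_nat.
pose n := maxn k n0.
have hn : n.+1%:R^-1 < e / 8.
  apply: le_lt_trans hn0; rewrite lef_pV2 ?posrE// ler_nat ltnS leq_max leqnn orbT.
  by [].
have oscn : osc_le (mean (r n.+1) (d k)) (e / 8).
  by move=> g; apply: le_trans (ltW hn); apply: oscS; rewrite leq_maxl.
have near i : cnorm (mean (r i) a - mean (r i) (d k)) < e / 8.
  apply: le_lt_trans ak; have -> : mean (r i) a - mean (r i) (d k) = mean (r i) (a - d k).
    by rewrite addrC -scaleN1r -mean_lin scaleN1r addrC.
  exact: cnorm_mean.
have late i : (n.+1 <= i)%N -> osc_le (mean (r i) (d k)) (e / 8) /\
    cnorm (mean (r i) (d k) - mean (r n.+1) (d k)) <= e / 8.
  by move=> /(later _ _ (d k))[s s0 ->]; exact: osc_mean.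
exists n.+1; split=> [i j ni nj|i ni g].
  have [_ h1] := late i ni; have [_ h2] := late j nj.
  have h3 := near i; have h4 := near j.
  rewrite (nrm_distC hA) in h2; rewrite (nrm_distC hA) in h4.
  have h5 := nrm_tri hA (mean (r i) a) (mean (r i) (d k)) (mean (r j) a).
  have h6 := nrm_tri hA (mean (r i) (d k)) (mean (r n.+1) (d k)) (mean (r j) a).
  have h7 := nrm_tri hA (mean (r n.+1) (d k)) (mean (r j) (d k)) (mean (r j) a).
  lra.
have [/(_ g) h1 _] := late i ni; have h3 := near i.
have h4 : cnorm (alpha g (mean (r i) a) - alpha g (mean (r i) (d k))) < e / 8.
  by rewrite -raddfB cnorm_act.
rewrite (nrm_distC hA) in h3.
have h5 := nrm_tri hA (alpha g (mean (r i) a)) (alpha g (mean (r i) (d k))) (mean (r i) a).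
have h6 := nrm_tri hA (alpha g (mean (r i) (d k))) (mean (r i) (d k)) (mean (r i) a).
lra.
Qed.

Lemma cp_map_mean s : cp_map (mean s).
Proof.
apply: cp_map_scale; first by rewrite invr_ge0.
by apply: cp_map_sum => h; apply: cp_map_hom; exact: ast.
Qed.

(** E is the pointwise limit of [mean (r n)]. Linearity, the bimodule property, complete positivity
    and the norm bounds pass from the finite means to the limit; invariance holds because the
    oscillations tend to 0. *)
Lemma exists_invariant_mean : separable A -> exists E : A -> A,
  [/\ forall c a b, E (c *: a + b) = c *: E a + E b,
      forall a, fixed alpha (E a),
      (forall b a c, fixed alpha b -> fixed alpha c -> E (b * a * c) = b * E a * c) /\
      E 1 = 1,
      cp_map E &
      forall a, cnorm (E a) <= cnorm a /\ forall t, osc_le a t -> cnorm (E a - a) <= t].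
Proof.
move=> /exists_mean_sequence[r r0 hr].
have cv a : exists l, tends (fun n => mean (r n) a) l.
  by apply: tends_complete => e /(hr a)[K [hK _]]; exists K.
pose E a := sval (cid (cv a)).
have Ecv a : tends (fun n => mean (r n) a) (E a) by exact: (svalP (cid (cv a))).
exists E; split.
- move=> c a b; apply: tends_unique (Ecv _) _.
  under [X in tends X]funext => n do rewrite mean_lin.
  by apply: aeqD; [apply: aeqZ|]; exact: Ecv.
- move=> a g; apply: (nrm_small hA) => e e0; have e2 : 0 < e / 2 by rewrite divr_gt0.
  apply: le_lt_trans (_ : _ <= e / 2) _; last by rewrite ltr_pdivrMr// ltr_pMr// ltr1n.
  have Ea : tends (fun n => alpha g (mean (r n) a) - mean (r n) a) (alpha g (E a) - E a).
    apply: aeqB; last exact: Ecv.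
    apply: (@lipschitz_aeq _ _ (fun=> alpha g) 1 _ _ _ (Ecv a)) => _ b c.
    by rewrite mul1r -raddfB cnorm_act.
  rewrite -[_ - _]subr0; apply: tends_le Ea _.
  have [K [_ hK]] := hr a _ e2; exists K => // n /= Kn.
  by rewrite subr0; exact: hK.
- split=> [b a c fb fc|].
    apply: tends_unique (Ecv _) _; under [X in tends X]funext => n do rewrite mean_fixed//.
    apply: aeqM (aeq_refl _); try exact: bdd_cst.
    by apply: aeqM (Ecv a); [exact: bdd_cst|exact: bdd_cst|exact: aeq_refl].
  apply: tends_unique (Ecv _) _; under [X in tends X]funext => n do rewrite mean1//.
  exact: aeq_refl.
- apply: (@cp_map_lim _ _ (fun n => mean (r n))) => [n|a e e0]; first exact: cp_map_mean.
  by have [K _ hK] := Ecv a e e0; exists K => k /hK.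
- move=> a; split.
    rewrite -[E a]subr0; apply: tends_le (Ecv a) _; near=> n.
    by rewrite subr0 cnorm_mean.
  move=> t ot; apply: tends_le (Ecv a) _; near=> n.
  by have [] := osc_mean (r0 n) ot.
Unshelve. all: by end_near. Qed.

End Averaging.

(** * Completely positive maps from C(G) *)

Section RokhlinMaps.
Variables (R : realType) (A : cstarAlgType R) (G : topologicalGroupType).
Local Notation hA := (cstar_norm_alg A).

(** Partition functions, their products and translates are all real valued, which makes their images
    under phi self-adjoint. *)
Definition cfun (b : G -> R) : G -> R[i] := fun g => ((b g)%:C)%C.

Lemma cfun_cont (b : G -> R) : continuous b -> contfun R G (cfun b).
Proof.
move=> cb g; apply/cvgrPdist_lt => e e0.
have eR : ((complex.Re e)%:C)%C = e by rewrite RRe_real// realE ltW.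
have r0 : 0 < complex.Re e by rewrite -ltcR eR.
have /cvgrPdist_lt /(_ _ r0) := cb g; apply: filterS => h.
by rewrite -rmorphB normc_def /= expr0n /= addr0 sqrtr_sqr -[in X in _ -> X]eR ltcR.
Qed.

Lemma cfunM b c : cfun (b \* c) = cfun b * cfun c.
Proof. by apply/funext => g; rewrite /cfun /= rmorphM. Qed.

Definition rokhlin_map (p : A) (phi : (G -> R[i]) -> A) : Prop :=
  [/\ forall f, contfun R G f -> corner setT p (phi f),
      linear_on (contfun R G) phi,
      completely_positive (contfun R G) (corner setT p) phi &
      phi 1 = p].

Section OneMap.
Variables (p : A) (phi : (G -> R[i]) -> A).
Hypothesis p_proj : is_projection p.
Hypothesis phiP : rokhlin_map p phi.

Lemma phiD (b c : G -> R) : continuous b -> continuous c ->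
  phi (cfun (b \+ c)) = phi (cfun b) + phi (cfun c).
Proof.
move=> cb cc; case: phiP => _ lin _ _.
have := lin 1 (cfun b) (cfun c) (cfun_cont cb) (cfun_cont cc).
rewrite !scale1r => <-; congr phi; apply/funext => g.
by rewrite /cfun /= rmorphD.
Qed.

Lemma phiZ (r : R) (b : G -> R) : continuous b -> phi (cfun (fun g => r * b g)) = (r%:C)%C *: phi (cfun b).
Proof.
move=> cb; case: phiP => _ lin _ _.
have c0 : contfun R G (cfun (fun=> 0)) by apply: cfun_cont; exact: cst_continuous.
have z0 : phi (cfun (fun=> 0)) = 0.
  have := lin 1 _ _ c0 c0; rewrite !scale1r.
  have -> : cfun (fun=> 0) + cfun (fun=> 0) = cfun (fun=> 0).
    by apply/funext => g; rewrite /cfun /= addr0.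
  by rewrite -{1}[phi _]addr0 => /addrI.
have := lin (r%:C)%C _ _ (cfun_cont cb) c0; rewrite z0 [RHS]addr0 => <-; congr phi.
by apply/funext => g; rewrite /cfun /= addr0 rmorphM.
Qed.

Lemma phi1 : phi (cfun (fun=> 1)) = p.
Proof. by case: phiP => _ _ _ <-; congr phi. Qed.

(** Complete positivity for 1 by 1 matrices, applied to b = u^*u with u the continuous function
    sqrt(b). *)
Lemma phi_pos (b : G -> R) : continuous b -> (forall g, 0 <= b g) -> cspos (phi (cfun b)).
Proof.
move=> cb b0; case: phiP => _ _ cp _.
pose u := cfun (fun g => Num.sqrt (b g)).
have cu : contfun R G u.
  apply: cfun_cont => g; apply: (@continuous_comp _ _ _ b Num.sqrt); first exact: cb.
  exact: sqrt_continuous.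
have [|c _ cE] := cp 1%N (mxstar (\matrix_(i < 1, j < 1) u) *m (\matrix_(i < 1, j < 1) u)).
  by exists (\matrix_(i < 1, j < 1) u) => // i j; rewrite mxE.
apply/(cposP hA); exists (c ord0 ord0).
have := congr1 (fun m : 'M[A]_1 => m ord0 ord0) cE; rewrite !mxE !big_ord1 !mxE => ->; congr phi.
apply/funext => g; rewrite fctE /= /u /cfun.
have sr (r : R) : ((r%:C)^* = r%:C)%C by apply/eqP; rewrite eq_complex /= oppr0 !eqxx.
by rewrite -[star _ g]/(((Num.sqrt (b g))%:C)^*)%C sr -rmorphM -expr2 sqr_sqrtr.
Qed.

(** The functions t + b and t - b are nonnegative, so tp + h and tp - h are positive; adding t(1 -
    p) gives t + h and t - h. *)
Lemma phi_bound (b : G -> R) (t : R) : continuous b -> (forall g, `|b g| <= t) ->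
  star (phi (cfun b)) = phi (cfun b) /\ cnorm (phi (cfun b)) <= t.
Proof.
move=> cb bt; set h := phi (cfun b).
have t0 : 0 <= t by apply: le_trans (bt 1%g).
have [sp pp] := p_proj.
have cb' (s : R) : continuous (fun g => s * b g).
  by move=> g; apply: cvgMr; exact: cb.
have cc : continuous (fun _ : G => t) by exact: cst_continuous.
have tp : phi (cfun (fun=> t)) = (t%:C)%C *: p.
  rewrite -phi1 -phiZ; last exact: cst_continuous.
  by congr phi; congr cfun; apply/funext => g; rewrite mulr1.
have pos1 : cspos ((t%:C)%C *: (1 - p)).
  have -> : (t%:C)%C *: (1 - p) = rsc (in_alg A) t * ((1 - p) * (1 - p)).
    rewrite /rsc /= -scalerAl mul1r; congr (_ *: _).
    by rewrite mulrBr mulr1 mulrBl mul1r pp subrr subr0.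
  by apply: (cpos_rsc hA) => //; apply: (cpos_sqr hA); rewrite (stB hA) (st1 hA) sp.
have H (s : R) : s = 1 \/ s = -1 -> cspos (rsc (in_alg A) t + rsc (in_alg A) s * h).
  move=> s1; have ps : cspos (phi (cfun ((fun=> t) \+ (fun g => s * b g)))).
    apply: phi_pos => [g|g /=]; first by apply: cvgD; [exact: cc|exact: cb'].
    have := bt g; rewrite ler_norml => /andP[b1 b2].
    by case: s1 => ->; lra.
  rewrite (phiD cc (cb' s)) tp phiZ// -/h in ps.
  have := cposD hA pos1 ps; rewrite addrA -scalerDr subrK /rsc /= -scalerAl mul1r.
  by [].
have Hp := H 1 (or_introl erefl); have Hn := H (-1) (or_intror erefl).
rewrite (rsc1 (in_alg A)) mul1r in Hp; rewrite (rscN (in_alg A)) (rsc1 (in_alg A)) mulN1r in Hn.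
have sh : star h = h.
  have := cpos_st Hp; rewrite starD [star (rsc _ _)](st_rsc hA).
  by move=> /addrI.
split=> //.
rewrite -(@ler_pXn2r _ 2) ?nnegrE ?(nrm_ge0 hA)// -(nrm_sa hA sh).
(* t^2 - h^2 = (t + h)(t - h) is a product of commuting positive elements *)
apply: (cpos_le_rsc hA); [by rewrite exprn_ge0|exact: (cpos_sqr hA)|].
pose T := rsc (in_alg A) t.
have E1 : (T + h) * (T - h) = T * T - h * h.
  by rewrite mulrBr !mulrDl -(rscC hA t h) opprD addrA addrK.
have E2 : (T - h) * (T + h) = T * T - h * h.
  by rewrite mulrDr !mulrBl -(rscC hA t h) addrA subrK.
rewrite expr2 rscM -/T -E1; apply: (cpos_mul hA) => //.
by rewrite E1 E2.
Qed.

Lemma phi_corner (b : G -> R) : continuous b -> p * phi (cfun b) = phi (cfun b) /\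
  phi (cfun b) * p = phi (cfun b).
Proof.
move=> /cfun_cont cb; have [_ pp] := p_proj.
case: phiP => /(_ _ cb)[a _ <-] _ _ _.
by rewrite !mulrA pp -!mulrA pp.
Qed.

Lemma phi_sum (I : Type) (r : seq I) (b : I -> G -> R) :
  (forall i, continuous (b i)) ->
  phi (cfun (fun g => \sum_(i <- r) b i g)) = \sum_(i <- r) phi (cfun (b i)).
Proof.
move=> cb; elim: r => [|i r IH].
  rewrite big_nil.
  have := phiZ 0 (@cst_continuous G R 1); rewrite scale0r => <-.
  by congr phi; apply/funext => g; rewrite /cfun big_nil mul0r.
rewrite big_cons -IH -phiD//; first by congr phi; apply/funext => g; rewrite /cfun big_cons.
move=> g; elim: r {IH} => [|j r IH].
  by under [X in continuous_at _ X]funext => h do rewrite big_nil; exact: cst_continuous.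
under [X in continuous_at _ X]funext => h do rewrite big_cons.
by apply: cvgD => //; exact: cb.
Qed.

End OneMap.

(** Cauchy-Schwarz for the columns v and xv: the sum is <v, xv>, and <xv, xv> <= d^2 <v, v>. The
    number of indices does not enter. *)
Lemma kraus_bound (I : finType) (v x : I -> A) (d : R) : 0 <= d ->
  (forall i, star (v i) = v i) -> (forall i, cnorm (x i) <= d) ->
  cnorm (\sum_i v i * x i * v i) <= d * cnorm (\sum_i v i * v i).
Proof.
move=> d0 sv xd.
have E1 : ip v (fun i => x i * v i) = \sum_i v i * x i * v i.
  by apply: eq_bigr => i _; rewrite sv mulrA.
have E2 : ip v v = \sum_i v i * v i by apply: eq_bigr => i _; rewrite sv.
have := ip_CS v (fun i => x i * v i); rewrite E1 E2.
set V := \sum_i v i * v i => h.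
have : cnorm (ip (fun i => x i * v i) (fun i => x i * v i)) <= d ^+ 2 * cnorm V.
  rewrite -(ger0_norm (exprn_ge0 2 d0)) -(nrm_rsc hA).
  apply: (cpos_le_nrm hA); first exact: ip_pos.
  rewrite /V /ip mulr_sumr -sumrB; apply: (cpos_sum hA) => i _.
  have -> : rsc (in_alg A) (d ^+ 2) * (v i * v i) - star (x i * v i) * (x i * v i) =
    star (v i) * (rsc (in_alg A) (d ^+ 2) - star (x i) * x i) * v i.
    by rewrite mulrBr mulrBl sv starM sv -(rscC hA _ (v i)) !mulrA.
  apply: (cpos_conj hA); apply: (cpos_rsc_sub hA); first by rewrite starM starK.
  by rewrite cnorm_star ler_pXn2r ?nnegrE ?(nrm_ge0 hA).
move=> h2; rewrite -(@ler_pXn2r _ 2) ?nnegrE ?mulr_ge0 ?(nrm_ge0 hA)//.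
apply: le_trans h _; apply: le_trans (ler_wpM2l (nrm_ge0 hA _) h2) _.
by rewrite exprMn mulrCA -expr2.
Qed.

(** * Asymptotically multiplicative and central maps on a multiplicative set M of functions *)

Section MapSequence.
Variables (p : nat -> A) (phi : nat -> (G -> R[i]) -> A) (M : set (G -> R)).
Hypothesis p_proj : forall k, is_projection (p k).
Hypothesis phiP : forall k, rokhlin_map (p k) (phi k).
Hypothesis Mcont : forall b, M b -> continuous b.
Hypothesis Mle1 : forall b, M b -> forall g, `|b g| <= 1.
Hypothesis M1 : M (fun=> 1).
Hypothesis MM : forall b c, M b -> M c -> M (b \* c).

Definition Phi (b : G -> R) (k : nat) : A := phi k (cfun b).

Hypothesis Phi_mul : forall b c, M b -> M c ->
  aeq (Phi (b \* c)) (fun k => Phi b k * Phi c k).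
Hypothesis Phi_comm : forall b a, M b -> aeq (fun k => Phi b k * a) (fun k => a * Phi b k).

Lemma Phi_st b k : M b -> star (Phi b k) = Phi b k.
Proof. by move=> Mb; have [] := phi_bound (p_proj k) (phiP k) (Mcont Mb) (Mle1 Mb). Qed.

Lemma Phi_le1 b k : M b -> cnorm (Phi b k) <= 1.
Proof. by move=> Mb; have [] := phi_bound (p_proj k) (phiP k) (Mcont Mb) (Mle1 Mb). Qed.

Lemma Phi_bdd b : M b -> bdd (Phi b).
Proof. by move=> Mb; exists 1 => k; exact: Phi_le1. Qed.

(** The sum psi0 with free coefficients. Products of two such sums, translates and the compression p
    a p are again of this form, at least asymptotically, so that [Theta_close] can compare them
    all. *)
Definition Theta (I : finType) (w : I -> G -> R) (c : I -> A) (k : nat) : A :=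
  \sum_i Phi (w i) k * c i * Phi (w i) k.

Lemma Phi_sandwich b a : M b ->
  aeq (fun k => Phi b k * a * Phi b k) (fun k => Phi (b \* b) k * a).
Proof.
move=> Mb; have bb := Phi_bdd Mb.
apply: (@aeq_trans _ _ (fun k => Phi b k * Phi b k * a)).
  apply: (@aeq_ext _ _ (fun k => Phi b k * (a * Phi b k))
    (fun k => Phi b k * (Phi b k * a))) => [k|k|]; rewrite ?mulrA//.
  apply: (aeqM bb); last by apply: aeq_sym; exact: Phi_comm.
    by apply: bddM => //; exact: bdd_cst.
  exact: aeq_refl.
apply: aeqM; [|exact: bdd_cst| |exact: aeq_refl].
  by apply: Phi_bdd; exact: MM.
by apply: aeq_sym; exact: Phi_mul.
Qed.

Lemma Theta_aeq (I : finType) (w : I -> G -> R) (c : I -> A) : (forall i, M (w i)) ->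
  aeq (Theta w c) (fun k => \sum_i Phi (w i \* w i) k * c i).
Proof. by move=> Mw; apply: aeq_sum => i; exact: Phi_sandwich. Qed.

Definition part_unity (I : finType) (w : I -> G -> R) : Prop :=
  (forall i, M (w i)) /\ forall g, \sum_i w i g ^+ 2 = 1.

Definition pmul (I J : finType) (w : I -> G -> R) (v : J -> G -> R) (ij : I * J) : G -> R :=
  w ij.1 \* v ij.2.

Lemma pmul_unity (I J : finType) (w : I -> G -> R) (v : J -> G -> R) :
  part_unity w -> part_unity v -> part_unity (pmul w v).
Proof.
move=> [Mw w1] [Mv v1]; split=> [ij|g]; first exact: MM.
rewrite -(pair_bigA _ (fun i j => (pmul w v (i, j) g) ^+ 2)) /=.
rewrite -[RHS](w1 g); apply: eq_bigr => i _.
rewrite -[RHS]mulr1 -(v1 g) mulr_sumr; apply: eq_bigr => j _.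
by rewrite /pmul /= exprMn.
Qed.

(* Both sides are asymptotic to the sum of the Phi (w i ^ 2) c_i, since
   w i ^ 2 is the sum over j of the (w i * v j) ^ 2. *)
Lemma Theta_refine (I J : finType) (w : I -> G -> R) (v : J -> G -> R) (c : I -> A) :
  part_unity w -> part_unity v ->
  aeq (Theta w c) (Theta (pmul w v) (fun ij => c ij.1)).
Proof.
move=> pw pv; have [Mw w1] := pw; have [Mv v1] := pv; have [Mwv _] := pmul_unity pw pv.
apply: aeq_trans (Theta_aeq c Mw) _; apply: aeq_sym.
apply: aeq_trans (Theta_aeq _ Mwv) _.
have E k : \sum_ij Phi (pmul w v ij \* pmul w v ij) k * c ij.1 =
    \sum_i Phi (w i \* w i) k * c i.
  rewrite -(pair_bigA _ (fun i j => Phi (pmul w v (i, j) \* pmul w v (i, j)) k * c i)) /=.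
  apply: eq_bigr => i _; rewrite -mulr_suml; congr (_ * _).
  rewrite /Phi -(phi_sum (phiP k)); last by move=> j; apply/Mcont/MM.
  congr (phi k (cfun _)); apply/funext => g.
  rewrite /pmul /= -[RHS]mulr1 -(v1 g) mulr_sumr; apply: eq_bigr => j _.
  by rewrite -!expr2 exprMn.
exact: aeq_eq.
Qed.

(** Each Theta is asymptotic to the sum of the Phi(w_i^2) c_i. There Phi(v_j^2) can be moved past
    c_i by centrality and merged with Phi(w_i^2) by multiplicativity. *)
Lemma Theta_mul (I J : finType) (w : I -> G -> R) (v : J -> G -> R)
    (c : I -> A) (d : J -> A) : (forall i, M (w i)) -> (forall i, M (v i)) ->
  aeq (fun k => Theta w c k * Theta v d k)
      (Theta (pmul w v) (fun ij => c ij.1 * d ij.2)).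
Proof.
move=> Mw Mv.
have Mwv ij : M (pmul w v ij) by exact: MM.
have bS (K : finType) (u : K -> G -> R) (e : K -> A) : (forall i, M (u i)) ->
    bdd (fun k => \sum_i Phi (u i \* u i) k * e i).
  move=> Mu; apply: bdd_sum => i; apply: bddM; last exact: bdd_cst.
  by apply: Phi_bdd; exact: MM.
apply: aeq_trans (aeqM (bS _ _ c Mw) (bS _ _ d Mv) (Theta_aeq c Mw) (Theta_aeq d Mv)) _.
apply: aeq_sym; apply: aeq_trans (Theta_aeq _ Mwv) _.
apply: (@aeq_ext _ _ _ (fun k => \sum_(ij : I * J) Phi (w ij.1 \* w ij.1) k * c ij.1 *
    (Phi (v ij.2 \* v ij.2) k * d ij.2)) _ _ (frefl _)) => [k|].
  rewrite mulr_suml; under eq_bigr => i _ do rewrite mulr_sumr.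
  by rewrite (pair_bigA _ (fun i j => Phi (w i \* w i) k * c i * (Phi (v j \* v j) k * d j))).
apply: aeq_sum => -[i j] /=; rewrite /pmul /=.
have -> : (w i \* v j) \* (w i \* v j) = (w i \* w i) \* (v j \* v j).
  by apply/funext => g /=; ring.
have Mi : M (w i \* w i) by exact: MM.
have Mj : M (v j \* v j) by exact: MM.
have bi := Phi_bdd Mi; have bj := Phi_bdd Mj.
have bc := bdd_cst (c i); have bd := bdd_cst (d j).
apply: (@aeq_trans _ _ (fun k => Phi (w i \* w i) k * (Phi (v j \* v j) k * c i) * d j)).
  apply: (@aeq_ext _ _ (fun k => Phi ((w i \* w i) \* (v j \* v j)) k * c i * d j)
    (fun k => Phi (w i \* w i) k * Phi (v j \* v j) k * c i * d j)) => [k|k|]; rewrite ?mulrA//.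
  apply: aeqM; [by do ?apply: bddM|exact: bdd_cst| |exact: aeq_refl].
  apply: aeqM; [by do ?apply: bddM|exact: bdd_cst| |exact: aeq_refl].
  exact: Phi_mul.
apply: (@aeq_ext _ _ _ (fun k => Phi (w i \* w i) k * (c i * Phi (v j \* v j) k) * d j)
  _ _ (frefl _)) => [k|]; first by rewrite !mulrA.
apply: aeqM; [by do ?apply: bddM|exact: bdd_cst| |exact: aeq_refl].
apply: aeqM; [exact: Phi_bdd|by do ?apply: bddM|exact: aeq_refl|].
exact: Phi_comm.
Qed.

Lemma Theta_unit (I : finType) (w : I -> G -> R) : part_unity w ->
  aeq (fun k => \sum_i Phi (w i) k * Phi (w i) k) p.
Proof.
move=> [Mw w1].
apply: (@aeq_trans _ _ (fun k => \sum_i Phi (w i \* w i) k)).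
  by apply: aeq_sum => i; apply: aeq_sym; exact: Phi_mul.
have E k : \sum_i Phi (w i \* w i) k = p k.
  rewrite /Phi -(phi_sum (phiP k)); last by move=> j; apply/Mcont/MM.
  rewrite -(phi1 (phiP k)); congr (phi k (cfun _)); apply/funext => g.
  by rewrite -[RHS](w1 g); apply: eq_bigr => i _; rewrite expr2.
exact: aeq_eq.
Qed.

Lemma Theta_close (I J : finType) (w : I -> G -> R) (v : J -> G -> R)
    (c : I -> A) (d : J -> A) (t e : R) : part_unity w -> part_unity v ->
  0 <= t -> 0 < e ->
  (forall i j g, w i g != 0 -> v j g != 0 -> cnorm (c i - d j) <= t) ->
  \forall k \near \oo, cnorm (Theta w c k - Theta v d k) < t + e.
Proof.
move=> pw pv t0 e0 close.
have pwv := pmul_unity pw pv; have [Mwv _] := pwv.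
(* Where w_i v_j = 0 the element Phi(w_i v_j) is 0, so the coefficient may be set to 0; then t
   bounds every coefficient, as [kraus_bound] requires. *)
pose x (ij : I * J) := if `[< exists g, pmul w v ij g != 0 >] then c ij.1 - d ij.2 else 0.
have xt ij : cnorm (x ij) <= t.
  rewrite /x; case: asboolP => [[g]|_]; last by rewrite (nrm0 hA).
  by rewrite /pmul /= mulf_eq0 negb_or => /andP[]; exact: close.
have Tx k : Theta (pmul w v) x k = Theta (pmul w v) (fun ij => c ij.1) k -
    Theta (pmul w v) (fun ij => d ij.2) k.
  rewrite /Theta -sumrB; apply: eq_bigr => ij _; rewrite -mulrBl -mulrBr /x.
  case: asboolP => // nz; have -> : Phi (pmul w v ij) k = 0.
    have := phiZ (phiP k) 0 (Mcont M1); rewrite scale0r => <-.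
    congr (phi k (cfun _)); apply/funext => g; rewrite mul0r.
    by apply/eqP; apply: contrapT => /negP h; apply: nz; exists g.
  by rewrite !mul0r.
have pvw := pmul_unity pv pw.
have Tv : aeq (Theta v d) (Theta (pmul w v) (fun ij => d ij.2)).
  apply: aeq_trans (Theta_refine d pv pw) _.
  have E k : Theta (pmul v w) (fun ij => d ij.1) k = Theta (pmul w v) (fun ij => d ij.2) k.
    rewrite /Theta -(pair_bigA _ (fun j i => Phi (pmul v w (j, i)) k * d j * Phi (pmul v w (j, i)) k)) /=.
    rewrite exchange_big /= pair_bigA /=; apply: eq_bigr => -[i j] _ /=.
    have -> // : pmul v w (j, i) = pmul w v (i, j).
    by apply/funext => g; rewrite /pmul /= mulrC.
  exact: aeq_eq.
have hT : aeq (fun k => Theta w c k - Theta v d k) (Theta (pmul w v) x).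
  by apply: aeq_ext (frefl _) Tx _; exact: aeqB (Theta_refine c pw pv) Tv.
have e2 : 0 < e / 2 by rewrite divr_gt0.
have t1 : 0 < t + 1 by rewrite ltr_wpDl.
have e4 : 0 < e / 2 / (t + 1) by rewrite divr_gt0.
near=> k.
have h1 : cnorm (Theta w c k - Theta v d k - Theta (pmul w v) x k) < e / 2.
  by near: k; exact: hT.
have h2 : cnorm (\sum_i Phi (pmul w v i) k * Phi (pmul w v i) k - p k) < e / 2 / (t + 1).
  by near: k; exact: (Theta_unit pwv).
have [sp pp] := p_proj k; have np := nrm_proj hA sp pp.
have h3 := @kraus_bound _ (fun ij => Phi (pmul w v ij) k) x t t0 (fun ij => Phi_st k (Mwv ij)) xt.
rewrite -/(Theta (pmul w v) x k) in h3; set S := \sum_i _ in h2 h3.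
have h4 := cnormD (S - p k) (p k); rewrite subrK in h4.
have h5 := cnormD (Theta w c k - Theta v d k - Theta (pmul w v) x k) (Theta (pmul w v) x k).
rewrite subrK in h5; rewrite ltr_pdivlMr// in h2.
have h6 : t * cnorm S <= t * (cnorm (S - p k) + 1).
  by rewrite ler_wpM2l//; lra.
have := nrm_ge0 hA (S - p k); lra.
Unshelve. all: by end_near. Qed.

End MapSequence.
End RokhlinMaps.

(** * Partitions of unity adapted to the action *)

Lemma near_seq (T : eqType) (l : seq T) (P : T -> nat -> Prop) :
  (forall a, a \in l -> \forall k \near \oo, P a k) ->
  \forall k \near \oo, forall a, a \in l -> P a k.
Proof.
elim: l => [|a l IH] h.
  by near=> k => a; rewrite in_nil.
have h1 := h a (mem_head _ _).
have h2 : \forall k \near \oo, forall a, a \in l -> P a k.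
  by apply: IH => b bl; apply: h; rewrite inE bl orbT.
near=> k => b; rewrite inE => /orP[/eqP ->|]; first by near: k.
by move: b; near: k.
Unshelve. all: by end_near. Qed.

Section Partition.
Variables (R : realType) (A : cstarAlgType R) (G : topologicalGroupType).
Variable alpha : G -> {lrmorphism A -> A}.
Hypothesis alpha_action : continuous_action alpha.
Hypothesis G_compact : compact [set: G].
Local Notation hA := (cstar_norm_alg A).

Lemma continuous_sum (T : topologicalType) (I : Type) (r : seq I) (f : I -> T -> R) :
  (forall i, continuous (f i)) -> continuous (fun t => \sum_(i <- r) f i t).
Proof.
move=> cf; elim: r => [|i r IH] t.
  by under [X in continuous_at _ X]funext => h do rewrite big_nil; exact: cst_continuous.
under [X in continuous_at _ X]funext => h do rewrite big_cons.
by apply: cvgD; [exact: cf|exact: IH].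
Qed.

Lemma continuous_orbit_dist g a : continuous (fun h => cnorm (alpha g a - alpha h a) : R).
Proof.
move=> h; apply/cvgrPdist_lt => e e0.
have := act_nbhs alpha_action a h e0; apply: filterS => k /= hk.
have h1 := nrm_tri hA (alpha g a) (alpha h a) (alpha k a).
have h2 := nrm_tri hA (alpha g a) (alpha k a) (alpha h a).
rewrite (nrm_distC hA (alpha k a)) in h2.
by rewrite ltr_norml; apply/andP; split; lra.
Qed.

(** f_i is twice the positive part of d - D(g_i, h), with D the summed orbit distance over l. The
    squares have to sum to 1, whence the division by the square root of F; F is positive since the
    sets D(g_i, .) < d cover G. *)
Lemma exists_partition (l : seq A) (d : R) : 0 < d ->
  exists n (g : 'I_n -> G) (e : 'I_n -> G -> R),
  [/\ forall i, continuous (e i), forall i h, `|e i h| <= 1,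
      forall h, \sum_i e i h ^+ 2 = 1 &
      forall i h a, a \in l -> e i h != 0 -> cnorm (alpha (g i) a - alpha h a) <= d].
Proof.
move=> d0; pose D x h := \sum_(a <- l) cnorm (alpha x a - alpha h a).
have Dc x : continuous (D x) by apply: continuous_sum => a; exact: continuous_orbit_dist.
have D0 x : D x x = 0 by apply: big1 => a _; rewrite subrr (nrm0 hA).
have U x : [set: G] x -> nbhs x [set h | D x h < d].
  move=> _; have /cvgrPdist_lt /(_ _ d0) := Dc x x; apply: filterS => h.
  by rewrite D0 sub0r normrN; apply: le_lt_trans; exact: ler_norm.
have [s [_ cov]] := compact_finite_cover G_compact U.
pose g (i : 'I_(size s)) := nth 1%g s i.
pose f (i : 'I_(size s)) h := (d - D (g i) h) + `|d - D (g i) h|.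
have fc i : continuous (f i).
  have c1 : continuous (fun h => d - D (g i) h).
    by move=> h; apply: cvgB; [exact: cst_continuous|exact: Dc].
  by move=> h; apply: cvgD; [exact: c1|apply: cvg_norm; exact: c1].
pose F h := \sum_i f i h ^+ 2.
have Fc : continuous F.
  apply: continuous_sum => i h; under [X in continuous_at _ X]funext => k do rewrite expr2.
  by apply: cvgM; exact: fc.
have Fp h : 0 < F h.
  have [x xs xh] := cov h I; move/(nthP 1%g): xs => [i ilt xE].
  rewrite /F (bigD1 (Ordinal ilt))//= ltr_wpDr ?sumr_ge0//; first by move=> j _; exact: sqr_ge0.
  have p : 0 < d - D (g (Ordinal ilt)) h by rewrite subr_gt0 /g /= xE.
  by rewrite exprn_gt0// /f addr_gt0// gtr0_norm.
have sqF h : Num.sqrt (F h) != 0 by rewrite gt_eqF// sqrtr_gt0.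
exists (size s), g, (fun i h => f i h / Num.sqrt (F h)).
have E h : \sum_i (f i h / Num.sqrt (F h)) ^+ 2 = 1.
  under eq_bigr => i _ do rewrite exprMn exprVn sqr_sqrtr ?(ltW (Fp h))//.
  rewrite -mulr_suml divff//; apply: lt0r_neq0; exact: Fp.
split=> //.
- move=> i h; apply: cvgM; first exact: fc.
  apply: cvgV => //; apply: (@continuous_comp _ _ _ F Num.sqrt); first exact: Fc.
  exact: sqrt_continuous.
- move=> i h; rewrite -(@expr_le1 _ 2)// -normrX ger0_norm ?sqr_ge0// -(E h).
  by rewrite (bigD1 i)//= lerDl sumr_ge0// => j _; exact: sqr_ge0.
- move=> i h a al; rewrite mulf_eq0 negb_or => /andP[fn _].
  have dD : D (g i) h <= d.
    rewrite leNgt; apply: contra fn => Dd; rewrite /f ltr0_norm ?subr_lt0//.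
    by rewrite subrr.
  apply: le_trans dD; rewrite /D (big_rem a al)/= lerDl sumr_ge0// => b _.
  exact: (nrm_ge0 hA).
Qed.

Definition ltr (g : G) (b : G -> R) : G -> R := fun h => b (g^-1 * h)%g.

Lemma ltr_continuous g b : continuous b -> continuous (ltr g b).
Proof.
move=> cb h; apply: (@continuous_comp _ _ _ (fun h => (g^-1 * h)%g) b); last exact: cb.
apply: (@continuous_comp _ _ _ (fun h => (g^-1%g, h)) (fun xy : G * G => (xy.1 * xy.2)%g)).
  by apply: cvg_pair; [exact: cst_continuous|exact: cvg_id].
exact: mulg_continuous.
Qed.

(** Joint continuity of (k, h) -> b(h^-1 k) becomes uniform in k by compactness. *)
Lemma ltr_nbhs b g (e : R) : continuous b -> 0 < e ->
  nbhs g [set h | forall k, `|ltr g b k - ltr h b k| < e].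
Proof.
move=> cb e0; have e2 : 0 < e / 2 by rewrite divr_gt0.
have /compact_near_coveringP cov := G_compact.
suff H : \forall h \near g, [set: G] `<=` (fun k => `|ltr g b k - ltr h b k| < e).
  by apply: filterS H => h hk k; exact: hk.
apply: cov => k _.
have c2 : {for (k, g), continuous (fun kh : G * G => kh.2^-1%g)}.
  apply: (@continuous_comp _ _ _ (fun kh : G * G => kh.2) (fun h : G => h^-1%g)); first exact: cvg_snd.
  exact: invg_continuous.
have jc : {for (k, g), continuous (fun kh : G * G => ltr kh.2 b kh.1)}.
  apply: (@continuous_comp _ _ _ (fun kh : G * G => (kh.2^-1 * kh.1)%g) b); last exact: cb.
  apply: (@continuous_comp _ _ _ (fun kh : G * G => (kh.2^-1%g, kh.1)) (fun xy : G * G => (xy.1 * xy.2)%g)).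
    by apply: cvg_pair; [exact: c2|exact: cvg_fst].
  exact: mulg_continuous.
move/cvgrPdist_lt: jc => /(_ _ e2) /= jc.
have gc := @ltr_continuous g b cb; move/(_ k)/cvgrPdist_lt: gc => /(_ _ e2) /= gc.
have gc2 : \forall x' \near k & i \near g, `|ltr g b k - ltr g b x'| < e / 2.
  exists ([set x' | `|ltr g b k - ltr g b x'| < e / 2], setT) => /=.
    by split; [exact: gc|exact: filterT].
  by move=> [x' i] [].
apply: filterS2 jc gc2 => -[k' h] /= h1 h2.
have := ler_distD (ltr g b k) (ltr g b k') (ltr h b k').
by rewrite (distrC (ltr g b k') (ltr g b k)); lra.
Qed.

(** Reduces almost invariance under all of G to finitely many translations, which the limit in k can
    handle at once. *)
Lemma exists_net (n : nat) (e : 'I_n -> G -> R) (l : seq A) (c : R) : 0 < c ->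
  (forall i, continuous (e i)) -> exists s : seq G, forall g, exists2 h, h \in s &
   (forall i k, `|ltr g (e i) k - ltr h (e i) k| <= c) /\
   (forall a, a \in l -> cnorm (alpha g a - alpha h a) <= c).
Proof.
move=> c0 ec.
pose U (h : G) : set G := [set g | (forall i k, `|ltr h (e i) k - ltr g (e i) k| < c) /\
   (forall a, a \in l -> cnorm (alpha h a - alpha g a) < c)].
have hU h : [set: G] h -> nbhs h (U h).
  move=> _; apply: filterI.
    by apply: filter_forall => i; exact: ltr_nbhs.
  elim: l {U} => [|a l IH]; first by apply: filterS filterT => g _ a; rewrite in_nil.
  apply: filterS (filterI (act_nbhs alpha_action a h c0) IH) => g [hg hl] b.
  by rewrite inE => /orP[/eqP ->|/hl].
have [s [_ hs]] := compact_finite_cover G_compact hU.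
exists s => g; have [h hin [h1 h2]] := hs g I; exists h => //; split=> [i k|a al].
  by rewrite distrC ltW.
by rewrite (nrm_distC hA) ltW// h2.
Qed.

End Partition.

(** * The maps of the theorem *)

Section ApproximateMaps.
Variables (R : realType) (A : cstarAlgType R) (G : topologicalGroupType).
Variable alpha : G -> {lrmorphism A -> A}.
Hypothesis alpha_action : continuous_action alpha.
Hypothesis G_compact : compact [set: G].
Hypothesis A_separable : separable A.
Hypothesis alpha_Rokhlin : tracial_Rokhlin_comparison alpha.
Variables (x y : A).
Hypothesis x_pos : pos setT x.
Hypothesis x_norm : cnorm x = 1.
Hypothesis y_pos : pos (fixed alpha) y.
Hypothesis y_neq0 : y <> 0.
Local Notation hA := (cstar_norm_alg A).

(** The conclusions that concern p alone. They come with the Rokhlin property and are passed on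
    untouched while the map is modified. *)
Definition large_projection (e : R) (p : A) : Prop :=
  (fixed alpha p /\ is_projection p) /\
  [/\ cuntz setT (1 - p) x, cuntz (fixed alpha) (1 - p) y,
      cuntz (fixed alpha) (1 - p) p & 1 - e < cnorm (p * x * p)].

(** The k-th map treats the first k + 1 members of an enumeration of M and of a dense sequence of A,
    whence the countability. Centrality extends to all of A by density, since the images of M have
    norm at most 1. *)
Lemma rokhlin_sequence (M : set (G -> R)) : countable M -> M (fun=> 1) ->
  (forall b, M b -> continuous b) -> (forall b, M b -> forall g, `|b g| <= 1) ->
  exists (p : nat -> A) (phi : nat -> (G -> R[i]) -> A),
  [/\ forall k, large_projection (k.+1%:R^-1) (p k) /\ rokhlin_map (p k) (phi k),
      forall b c, M b -> M c ->
        aeq (Phi phi (b \* c)) (fun k => Phi phi b k * Phi phi c k),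
      forall b a, M b -> aeq (fun k => Phi phi b k * a) (fun k => a * Phi phi b k) &
      forall b (e : R), M b -> 0 < e -> \forall k \near \oo, forall g,
        cnorm (Phi phi (ltr g b) k - alpha g (Phi phi b k)) <= e].
Proof.
move=> /countable_injP[f fI] M1 Mc Mle.
have [d dD] := separable_seq A_separable.
(* The default 1 lies in M, so m i belongs to M even for indices outside the range of f. *)
pose m i : G -> R := xget (fun=> 1) [set b | M b /\ f b = i].
have mM i : M (m i) by rewrite /m; case: xgetP => // b _ [].
have mf b : M b -> m (f b) = b.
  move=> Mb; rewrite /m; case: xgetP => [c _ [Mc' fc]|/(_ b)[]//].
  by apply: fI => //; exact: mem_set.
have H k : exists pphi : A * ((G -> R[i]) -> A),
  [/\ large_projection (k.+1%:R^-1) pphi.1 /\ rokhlin_map pphi.1 pphi.2,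
      forall i j, (i <= k)%N -> (j <= k)%N ->
        cnorm (pphi.2 (cfun (m i) * cfun (m j)) - pphi.2 (cfun (m i)) * pphi.2 (cfun (m j))) < k.+1%:R^-1,
      forall i j, (i <= k)%N -> (j <= k)%N ->
        cnorm (pphi.2 (cfun (m i)) * d j - d j * pphi.2 (cfun (m i))) < k.+1%:R^-1 &
      forall i g, (i <= k)%N ->
        cnorm (pphi.2 (Lt g (cfun (m i))) - alpha g (pphi.2 (cfun (m i)))) <= k.+1%:R^-1].
  have k0 : 0 < k.+1%:R^-1 :> R by rewrite invr_gt0.
  have fS : finite_set [set cfun (m i) | i in `I_k.+1] by apply: finite_image; exact: finite_II.
  have fF : finite_set [set d i | i in `I_k.+1] by apply: finite_image; exact: finite_II.
  have Sc : [set cfun (m i) | i in `I_k.+1] `<=` contfun R G.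
    by move=> _ [i _ <-]; apply: cfun_cont; exact: Mc.
  have [p [phi [hp [hphi [[h1 h2 h3] [h4 [h5 [h6 h7]]]]]]]] :=
    alpha_Rokhlin fF fS Sc k0 x_pos x_norm y_pos y_neq0.
  exists (p, phi); split=> //=.
  - by move=> i j ik jk; apply: h1; [exists i|exists j].
  - by move=> i j ik jk; apply: h2; [exists i|exists j].
  - move=> i g ik; have := h3 (cfun (m i)) _; rewrite /= => h; apply/ltW.
    rewrite -lte_fin; apply: le_lt_trans (h _); last by exists i.
    by apply: ereal_sup_ubound; exists g.
pose p k := (sval (cid (H k))).1; pose phi k := (sval (cid (H k))).2.
have HP k := svalP (cid (H k)).
have late (e : R) n : 0 < e -> \forall k \near \oo, (n <= k)%N /\ k.+1%:R^-1 < e.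
  move=> e0; near=> k; split; first by near: k; exact: nbhs_infty_ge.
  rewrite invf_plt ?posrE//; apply: lt_trans (archi_boundP _) _.
    by rewrite invr_ge0 ltW.
  rewrite ltr_nat ltnS; near: k; exact: nbhs_infty_ge.
have Phim k i : Phi phi (m i) k = (sval (cid (H k))).2 (cfun (m i)) by [].
exists p, phi; split.
- by move=> k; have [] := HP k.
- move=> b c Mb Mc' e e0; apply: filterS (late e (maxn (f b) (f c)) e0) => k [].
  rewrite geq_max => /andP[bk ck] ke; apply: lt_trans ke.
  have [_ /(_ _ _ bk ck) + _ _] := HP k.
  by rewrite !mf// -cfunM.
- move=> b a Mb e e0; have e3 : 0 < e / 3 by rewrite divr_gt0.
  have [j aj] := dD a _ e3.
  apply: filterS (late _ (maxn (f b) j) e3) => k [].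
  rewrite geq_max => /andP[bk jk] ke.
  have [[[[_ pk] _] rk] _ /(_ _ _ bk jk) + _] := HP k; rewrite mf// => h.
  have {}h : cnorm (Phi phi b k * d j - d j * Phi phi b k) < e / 3 by apply: lt_trans ke.
  have [_ n1] : star (Phi phi b k) = Phi phi b k /\ cnorm (Phi phi b k) <= 1.
    by apply: (phi_bound pk rk (Mc _ Mb)); exact: Mle.
  set z := Phi phi b k in h n1 *.
  have -> : z * a - a * z = (z * (a - d j) - (a - d j) * z) + (z * d j - d j * z).
    by rewrite mulrBr mulrBl opprB addrAC [X in _ = X + _]addrA subrK addrA subrK.
  have h1 := cnormD (z * (a - d j) - (a - d j) * z) (z * d j - d j * z).
  have h2 := nrmB hA (z * (a - d j)) ((a - d j) * z).
  have h3 := cnormM z (a - d j); have h4 := cnormM (a - d j) z.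
  have h5 := nrm_ge0 hA (a - d j); have h6 := nrm_ge0 hA z.
  have h7 : cnorm z * cnorm (a - d j) <= cnorm (a - d j) by rewrite ler_piMl.
  rewrite (mulrC (cnorm (a - d j))) in h4.
  lra.
- move=> b e Mb e0; apply: filterS (late e (f b) e0) => k [bk ke] g.
  have [_ _ _ /(_ _ g bk)] := HP k; rewrite mf// => h; apply: le_trans (ltW ke).
  exact: h.
Unshelve. all: by end_near. Qed.

Lemma cnorm_sandwich_dist (u u' c c' : A) (B t s : R) : cnorm u <= 1 -> cnorm u' <= 1 ->
  cnorm c <= B -> cnorm c' <= B -> cnorm (u - u') <= t -> cnorm (c - c') <= s ->
  cnorm (u * c * u - u' * c' * u') <= 2 * B * t + s.
Proof.
move=> u1 u1' cB cB' ut cs.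
have -> : u * c * u - u' * c' * u' =
    (u - u') * c * u + (u' * (c - c') * u + u' * c' * (u - u')).
  rewrite !(mulrBl, mulrBr) [X in _ = _ + X]addrA subrK.
  by rewrite addrA subrK.
have n0 z := nrm_ge0 hA z.
have b1 : cnorm ((u - u') * c * u) <= t * B * 1.
  apply: le_trans (cnormM _ _) _; apply: ler_pM => //.
  by apply: le_trans (cnormM _ _) _; apply: ler_pM.
have b2 : cnorm (u' * (c - c') * u) <= 1 * s * 1.
  apply: le_trans (cnormM _ _) _; apply: ler_pM => //.
  by apply: le_trans (cnormM _ _) _; apply: ler_pM.
have b3 : cnorm (u' * c' * (u - u')) <= 1 * B * t.
  apply: le_trans (cnormM _ _) _; apply: ler_pM => //.
  by apply: le_trans (cnormM _ _) _; apply: ler_pM.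
apply: le_trans (cnormD _ _) _; apply: le_trans (lerD b1 (cnormD _ _)) _.
by apply: le_trans (lerD (lexx _) (lerD b2 b3)) _; rewrite !mul1r !mulr1; lra.
Qed.

Lemma exists_almost_invariant_map (l : seq A) (e : R) : 0 < e -> exists (p : A) (psi : A -> A),
  [/\ large_projection e p,
      [/\ forall c a b, psi (c *: a + b) = c *: psi a + psi b,
          forall a, p * psi a = psi a /\ psi a * p = psi a,
          cp_map psi & forall a, cnorm (psi a) <= cnorm a * cnorm (psi 1)],
      forall a b, a \in l -> b \in l -> cnorm (psi a * psi b - psi (a * b)) <= e,
      forall a, a \in l -> osc_le alpha (psi a) e &
      (forall a, a \in l -> cnorm (p * a - a * p) <= e) /\
      (forall a, a \in l -> fixed alpha a -> cnorm (psi a - p * a * p) <= e)].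
Proof.
move=> e0; pose B := 1 + \sum_(a <- l) cnorm a.
have n0 z := nrm_ge0 hA z.
have s0 : 0 <= \sum_(a <- l) cnorm a by apply: sumr_ge0.
have Bp : 0 < B by rewrite ltr_pwDl.
have lB a : a \in l -> cnorm a <= B.
  move=> al; rewrite /B (big_rem a al)/=.
  have : 0 <= \sum_(b <- rem a l) cnorm b by apply: sumr_ge0.
  lra.
(* Two points within d0 of a common orbit point differ by at most 2 d0; with factors of norm at most
   B a product then changes by at most 4 d0 B = e/4. *)
have d0 : 0 < e / (16 * B) by rewrite divr_gt0// mulr_gt0.
have [n [g [w [wc w1 wsum wclose]]]] := exists_partition alpha_action G_compact l d0.
(* Replacing a translation by a net point costs at most 4 B c0 + c0 per term, hence at most 4 c0 (n
   + 1)(B + 1) = e/4 in all; the successor avoids a division by 0. *)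
pose c0 := e / (16 * (n.+1%:R * (B + 1))).
have c0p : 0 < c0 by rewrite divr_gt0// !mulr_gt0// addr_gt0.
pose orb a (i : 'I_n) := alpha (g i) a.
have [s hs] := exists_net alpha_action G_compact
  [seq orb a i | a <- l, i <- enum 'I_n] c0p wc.
(* M consists of the finite products of the w_i and their translates by the net: words over a finite
   alphabet, so M is countable and closed under products. Index 0 is the unit of G and gives w_i
   itself; the net points are shifted by one. *)
pose letter (ij : 'I_(size s).+1 * 'I_n) : G -> R := ltr (nth 1%g (1%g :: s) ij.1) (w ij.2).
pose word (ws : seq ('I_(size s).+1 * 'I_n)) : G -> R := fun h => \prod_(ij <- ws) letter ij h.
pose M : set (G -> R) := range word.
have cM : countable M by apply: (sub_countable (card_image_le _ _)); exact: countableP.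
have M1 : M (fun=> 1) by exists [::] => //; apply/funext => h; rewrite /word big_nil.
have MM b c : M b -> M c -> M (b \* c).
  move=> [u _ <-] [v _ <-]; exists (u ++ v) => //.
  by apply/funext => h; rewrite /word big_cat.
have Mc b : M b -> continuous b.
  move=> [u _ <-]; elim: u => [|ij u IH] h.
    rewrite /word; under [X in continuous_at _ X]funext => k do rewrite big_nil.
    exact: cst_continuous.
  rewrite /word; under [X in continuous_at _ X]funext => k do rewrite big_cons.
  by apply: cvgM; [exact: ltr_continuous|exact: IH].
have Ml b : M b -> forall h, `|b h| <= 1.
  move=> [u _ <-] h; rewrite /word; elim: u => [|ij u IH]; first by rewrite big_nil normr1.
  by rewrite big_cons normrM mulr_ile1// w1.
have Ms h i : h \in s -> M (ltr h (w i)).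
  move=> /(nthP 1%g)[j js <-]; exists [:: (Ordinal (js : (j.+1 < (size s).+1)%N), i)] => //.
  by apply/funext => k; rewrite /word big_seq1.
have Mw i : M (w i).
  exists [:: (ord0, i)] => //; apply/funext => k.
  by rewrite /word big_seq1 /letter /ltr /= invg1 mul1g.
have [p [phi [hp Pm Pc Pe]]] := rokhlin_sequence cM M1 Mc Ml.
have pP k : is_projection (p k) by case: (hp k) => -[[]].
have rP k : rokhlin_map (p k) (phi k) by case: (hp k).
pose T a := Theta phi w (orb a).
have puw : part_unity M w by [].
have e8 : 0 < e / 8 by rewrite divr_gt0.
have e4 : 0 < e / 4 by rewrite divr_gt0.
have mulT : \forall k \near \oo, forall a, a \in l -> forall b, b \in l ->
    cnorm (T a k * T b k - T (a * b) k) <= e.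
  apply: near_seq => a al; apply: near_seq => b bl.
  have h1 := Theta_mul pP rP Mc Ml MM Pm Pc (orb a) (orb b) Mw Mw e4.
  (* At a point h where w_i, w_j and w_k are all nonzero, the coefficients are close to alpha_h(a),
     alpha_h(b) and alpha_h(ab). *)
  have h2 : \forall k \near \oo, cnorm (Theta phi (pmul w w) (fun ij => orb a ij.1 * orb b ij.2) k - T (a * b) k) < e / 2 + e / 4.
    apply: (Theta_close pP rP Mc Ml M1 MM Pm Pc (pmul_unity MM puw puw) puw) => //.
      by rewrite divr_ge0// ltW.
    move=> [i j] k h /=; rewrite /pmul /= mulf_eq0 negb_or => /andP[wi wj] wk.
    have c1 := wclose i h a al wi; have c2 := wclose j h b bl wj.
    have c3 := wclose k h a al wk; have c4 := wclose k h b bl wk.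
    have -> : orb a i * orb b j - orb (a * b) k =
        (orb a i - orb a k) * orb b j + orb a k * (orb b j - orb b k).
      by rewrite /orb rmorphM mulrBl mulrBr addrA subrK.
    have t1 := nrm_tri hA (orb a i) (alpha h a) (orb a k).
    have t2 := nrm_tri hA (orb b j) (alpha h b) (orb b k).
    rewrite (nrm_distC hA (alpha h a)) in t1; rewrite (nrm_distC hA (alpha h b)) in t2.
    have m1 : cnorm ((orb a i - orb a k) * orb b j) <= (2 * (e / (16 * B))) * B.
      apply: le_trans (cnormM _ _) _; apply: ler_pM => //; last by rewrite /orb cnorm_act// lB.
      by rewrite /orb in t1 *; lra.
    have m2 : cnorm (orb a k * (orb b j - orb b k)) <= B * (2 * (e / (16 * B))).
      apply: le_trans (cnormM _ _) _; apply: ler_pM => //; first by rewrite /orb cnorm_act// lB.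
      by rewrite /orb in t2 *; lra.
    have E : e / (16 * B) * B = e / 16 by field; rewrite gt_eqF.
    apply: le_trans (cnormD _ _) _; apply: le_trans (lerD m1 m2) _; lra.
  apply: filterS2 h1 h2 => k h1 h2; have h3 := nrm_tri hA (T a k * T b k) _ (T (a * b) k).
  by apply: le_trans (h3 _) _; apply: le_trans (lerD (ltW h1) (ltW h2)) _; lra.
have invT : \forall k \near \oo, forall a, a \in l -> osc_le alpha (T a k) e.
  (* The translate of the partition by h, with coefficients alpha_h alpha_{g_i}(a), is adapted to a
     again: if w_i is nonzero at h^-1 k, then alpha_{g_i}(a) is close to alpha_{h^-1 k}(a). *)
  have I1 : \forall k \near \oo, forall h, h \in s -> forall a, a \in l ->
      cnorm (Theta phi (fun i => ltr h (w i)) (fun i => alpha h (orb a i)) k - T a k) < e / 4 + e / 4.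
    apply: near_seq => h hins; apply: near_seq => a al.
    apply: (Theta_close pP rP Mc Ml M1 MM Pm Pc _ puw) => //; rewrite ?(ltW e4)//.
      by split=> [i|k]; [exact: Ms|rewrite -[RHS](wsum (h^-1 * k)%g)].
    move=> i j k wi wj; have c1 := wclose i _ a al wi; have c2 := wclose j k a al wj.
    have {}c1 : cnorm (alpha h (orb a i) - alpha k a) <= e / (16 * B).
      have -> : alpha k a = alpha h (alpha (h^-1 * k)%g a).
        by case: alpha_action => _ _ <- _; rewrite mulgA mulgV mul1g.
      by rewrite -raddfB cnorm_act.
    have t1 := nrm_tri hA (alpha h (orb a i)) (alpha k a) (orb a j).
    rewrite (nrm_distC hA (alpha k a)) in t1.
    have E : e / (16 * B) <= e / 16.
      by rewrite ler_pM2l// lef_pV2 ?posrE ?mulr_gt0// ler_peMr// /B lerDl.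
    by rewrite /orb in t1 *; lra.
  have I2 : \forall k \near \oo, forall i g,
      cnorm (Phi phi (ltr g (w i)) k - alpha g (Phi phi (w i) k)) <= c0.
    by apply: filter_forall => i; exact: Pe.
  apply: filterS2 I1 I2 => k I1 I2 a al h'.
  have [h hins [n1 n2]] := hs h'.
  have J : cnorm (alpha h' (T a k) - Theta phi (fun i => ltr h (w i)) (fun i => alpha h (orb a i)) k) <= e / 4.
    rewrite /T /Theta raddf_sum -sumrB; apply: le_trans (nrm_sum hA _ _ _) _.
    have J1 i : cnorm (alpha h' (Phi phi (w i) k * orb a i * Phi phi (w i) k) -
        Phi phi (ltr h (w i)) k * alpha h (orb a i) * Phi phi (ltr h (w i)) k) <=
        2 * B * (2 * c0) + c0.
      rewrite !rmorphM; apply: cnorm_sandwich_dist.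
      - by rewrite cnorm_act//; exact: (Phi_le1 pP rP Mc Ml).
      - by apply: (Phi_le1 pP rP Mc Ml); exact: Ms.
      - by rewrite /orb !cnorm_act// lB.
      - by rewrite /orb !cnorm_act// lB.
      - have t1 := nrm_tri hA (alpha h' (Phi phi (w i) k)) (Phi phi (ltr h' (w i)) k) (Phi phi (ltr h (w i)) k).
        have t2 := I2 i h'; rewrite (nrm_distC hA) in t2.
        (* The translate by an arbitrary h' need not lie in M. The difference of the two translates
           is one continuous function bounded by c0, to which [phi_bound] applies. *)
        have t3 : cnorm (Phi phi (ltr h' (w i)) k - Phi phi (ltr h (w i)) k) <= c0.
          have cm : continuous (fun u => -1 * ltr h (w i) u).
            by move=> u; apply: cvgMr; exact: ltr_continuous.
          have -> : Phi phi (ltr h' (w i)) k - Phi phi (ltr h (w i)) k =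
              phi k (cfun (ltr h' (w i) \+ (fun u => -1 * ltr h (w i) u))).
            rewrite (phiD (rP k))//; last exact: ltr_continuous.
            rewrite (phiZ (rP k)); last exact: ltr_continuous.
            by rewrite rmorphN rmorph1 scaleN1r.
          apply: (phi_bound (pP k) (rP k) _ _).2 => [u|u /=].
            by apply: cvgD; [exact: ltr_continuous|exact: cm].
          by rewrite mulN1r.
        lra.
      - by apply: n2; apply/allpairsP; exists (a, i); rewrite mem_enum.
    apply: le_trans (ler_sum _ (fun i _ => J1 i)) _.
    rewrite sumr_const card_ord -[leLHS]mulr_natl.
    have E : c0 * (n.+1%:R * (B + 1)) = e / 16.
      rewrite /c0; field; rewrite !gt_eqF//; last by rewrite addr_gt0.
    have : n%:R * (2 * B * (2 * c0) + c0) <= 4 * (c0 * (n.+1%:R * (B + 1))).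
      rewrite -natr1; have : 0 <= n%:R :> R by [].
      set N := n%:R => N0; have : 0 <= c0 * N by rewrite mulr_ge0// ltW.
      have : 0 <= c0 * B by rewrite mulr_ge0// ltW.
      have : 0 <= c0 * N * B by rewrite mulr_ge0 ?(ltW Bp)// mulr_ge0 ?(ltW c0p).
      by nra.
    lra.
  have t1 := nrm_tri hA (alpha h' (T a k)) _ (T a k).
  apply: le_trans (t1 _) _; apply: le_trans (lerD J (ltW (I1 h hins a al))) _; lra.
have fixT : \forall k \near \oo, forall a, a \in l -> fixed alpha a ->
    cnorm (T a k - p k * a * p k) <= e.
  apply: near_seq => a al; have [fa|nfa] := pselect (fixed alpha a); last first.
    by near=> k => /nfa.
  (* p a p is the Theta of the trivial partition {1}. For invariant a all coefficients equal a, so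
     [Theta_close] applies with t = 0. *)
  have pu : part_unity M (fun _ : unit => fun=> 1).
    by split=> // h; rewrite sumr_const card_unit expr1n.
  have := Theta_close pP rP Mc Ml M1 MM Pm Pc (c := orb a) (d := fun _ : unit => a)
    (t := 0) puw pu (lexx 0) e0.
  have cl i (j : unit) h : w i h != 0 -> (1 : R) != 0 -> cnorm (orb a i - a) <= 0.
    by move=> _ _; rewrite /orb fa subrr (nrm0 hA).
  move=> /(_ cl); apply: filterS => k + _; rewrite add0r => /ltW.
  by rewrite [X in _ - X](bigD1 tt)//= big1 ?addr0 => [|[]//]; rewrite /Phi (phi1 (rP k)).
have commT : \forall k \near \oo, forall a, a \in l -> cnorm (p k * a - a * p k) <= e.
  apply: near_seq => a al; have := Pc _ a M1 _ e0; apply: filterS => k.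
  by rewrite /Phi (phi1 (rP k)); exact: ltW.
near \oo => k.
have ke : k.+1%:R^-1 <= e.
  rewrite invf_ple ?posrE//; apply: le_trans (ltW (archi_boundP _)) _.
    by rewrite invr_ge0 ltW.
  by rewrite ler_nat; apply: leqW; near: k; exact: nbhs_infty_ge.
have mk : forall a, a \in l -> forall b, b \in l ->
    cnorm (T a k * T b k - T (a * b) k) <= e by near: k.
exists (p k), (fun a => T a k); split.
- have [[fp pr] [x1 y1 z1 nx]] := (hp k).1; split => //; split => //.
  by apply: le_lt_trans nx; rewrite lerD2l lerN2.
- split.
  + move=> c a b; rewrite /T /Theta scaler_sumr -big_split /=; apply: eq_bigr => i _.
    by rewrite /orb linearD linearZ /= mulrDr mulrDl -scalerAr -scalerAl.
  + move=> a; rewrite /T /Theta mulr_sumr mulr_suml; split; apply: eq_bigr => i _.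
      by rewrite !mulrA (phi_corner (pP k) (rP k) (Mc _ (Mw i))).1.
    by rewrite -mulrA (phi_corner (pP k) (rP k) (Mc _ (Mw i))).2.
  + rewrite /T /Theta; apply: cp_map_sum => i.
    have := cp_map_conj (Phi phi (w i) k) (cp_map_hom (f := alpha (g i)) _).
    rewrite (Phi_st pP rP Mc Ml)//; apply; by case: alpha_action.
  + move=> a; rewrite /T /Theta.
    have -> : \sum_i Phi phi (w i) k * orb 1 i * Phi phi (w i) k = \sum_i Phi phi (w i) k * Phi phi (w i) k.
      by apply: eq_bigr => i _; rewrite /orb rmorph1 mulr1.
    apply: kraus_bound => // i; first by rewrite (Phi_st pP rP Mc Ml).
    by rewrite /orb cnorm_act.
- by move=> a b al bl; exact: mk.
- by near: k.
- by split; near: k.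
Unshelve. all: by end_near. Qed.

End ApproximateMaps.

(** * From almost invariant maps to unital maps into a corner of the fixed point algebra *)

Section CompressedMaps.
Variables (R : realType) (A : cstarAlgType R) (G : topologicalGroupType).
Variable alpha : G -> {lrmorphism A -> A}.
Hypothesis alpha_action : continuous_action alpha.
Local Notation hA := (cstar_norm_alg A).

Lemma fixed_closed : closed_subalg (in_alg A) (@cnorm R A) (fixed alpha).
Proof.
split=> [a b fa fb g|a b fa fb g|r a fa g|a ad g].
- by rewrite raddfD /= fa fb.
- by rewrite rmorphM /= fa fb.
- by rewrite /rsc /= -scalerAl mul1r linearZ /= fa.
- apply: (fixed_adherent hA (k := 1)) => // [b|e /ad[b fb ba]]; last by exists b.
  by rewrite -raddfB cnorm_act// mul1r.
Qed.

Lemma fixed1 : fixed alpha 1. Proof. by move=> g; rewrite rmorph1. Qed.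

Lemma cornerP (D : set A) p a : closed_subalg (in_alg A) (@cnorm R A) D -> D p ->
  is_projection p -> corner D p a <-> [/\ D a, p * a = a & a * p = a].
Proof.
move=> cD Dp [_ pp]; split=> [[b Db <-]|[Da pa ap]]; last by exists a => //; rewrite pa ap.
split; first by do 2?apply: (csa_M cD).
  by rewrite !mulrA pp.
by rewrite -!mulrA pp.
Qed.

Lemma corner_closed (D : set A) p : closed_subalg (in_alg A) (@cnorm R A) D -> D p ->
  is_projection p -> closed_subalg (in_alg A) (@cnorm R A) (corner D p).
Proof.
move=> cD Dp pp; have cP a := cornerP a cD Dp pp.
split=> [a b /cP[Da pa ap] /cP[Db pb bp]|a b /cP[Da pa ap] /cP[Db pb bp]
        |r a /cP[Da pa ap]|a ad]; apply/cP; split.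
- exact: (csa_D cD).
- by rewrite mulrDr pa pb.
- by rewrite mulrDl ap bp.
- exact: (csa_M cD).
- by rewrite mulrA pa.
- by rewrite -mulrA bp.
- exact: (csa_sc cD).
- by rewrite mulrA -(rscC hA) -mulrA pa.
- by rewrite -mulrA ap.
- by apply: (csa_closed cD) => e /ad[b /cP[Db _ _] ba]; exists b.
- apply: (fixed_adherent hA (k := cnorm p)) => [|b|e /ad[b /cP[_ pb _] ba]].
  + exact: (nrm_ge0 hA).
  + by rewrite -mulrBr cnormM.
  + by exists b.
- apply: (fixed_adherent hA (f := fun b => b * p) (k := cnorm p)) => [|b|e /ad[b /cP[_ _ bp] ba]].
  + exact: (nrm_ge0 hA).
  + by rewrite -mulrBl mulrC cnormM.
  + by exists b.
Qed.

(* The defect p - lambda E(psi0 1) of the compressed map at 1 is a square c^2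
   in the corner; adding c E(.) c restores psi 1 = p. *)
Lemma exists_unital_correction (E psi0 : A -> A) (p : A) (t : R) :
  (forall c a b, E (c *: a + b) = c *: E a + E b) -> (forall a, fixed alpha (E a)) ->
  (forall b a c, fixed alpha b -> fixed alpha c -> E (b * a * c) = b * E a * c) ->
  E 1 = 1 -> cp_map E -> (forall a, cnorm (E a) <= cnorm a) ->
  (forall a s, osc_le alpha a s -> cnorm (E a - a) <= s) ->
  fixed alpha p -> is_projection p -> 0 < t <= 1 ->
  (forall c a b, psi0 (c *: a + b) = c *: psi0 a + psi0 b) ->
  (forall a, p * psi0 a = psi0 a /\ psi0 a * p = psi0 a) -> cp_map psi0 ->
  (forall a, cnorm (psi0 a) <= cnorm a * cnorm (psi0 1)) ->
  cnorm (psi0 1 - p) <= t -> osc_le alpha (psi0 1) t ->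
  exists psi : A -> A,
  [/\ forall c a b, psi (c *: a + b) = c *: psi a + psi b,
      forall a, corner (fixed alpha) p (psi a), cp_map psi, psi 1 = p &
      forall a, osc_le alpha (psi0 a) t -> cnorm (psi a - psi0 a) <= t * (1 + 8 * cnorm a)].
Proof.
move=> Elin Efix Ebi E1 Ecp En Eosc fp pp /andP[t0 t1] lin0 cor0 cp0 n0 p1 osc1.
have [sp p2] := pp; have np := nrm_proj hA sp p2.
have ng z := nrm_ge0 hA z.
have f1 := fixed1.
have cE a : [/\ fixed alpha (E (psi0 a)), p * E (psi0 a) = E (psi0 a) & E (psi0 a) * p = E (psi0 a)].
  split; first exact: Efix.
    by have := Ebi p (psi0 a) 1 fp f1; rewrite !mulr1 (cor0 a).1.
  by have := Ebi 1 (psi0 a) p f1 fp; rewrite !mul1r (cor0 a).2.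
(* Since |d| <= 1 + 2t, the factor s makes |s d| <= 1, and this is |p - h| for h = p - s d, as
   [sqrt_unit] with e = p requires. *)
pose d := E (psi0 1); pose s : R := (1 + 2 * t)^-1.
have S0 : 0 < 1 + 2 * t by rewrite addr_gt0// mulr_gt0.
have s0 : 0 < s by rewrite invr_gt0.
have sS : s * (1 + 2 * t) = 1 by rewrite mulVf// gt_eqF.
have s1 : s <= 1 by nra.
have s2 : 1 - s <= 2 * t by nra.
have dp : cnorm (d - p) <= 2 * t.
  by have := nrm_tri hA d (psi0 1) p; have := Eosc _ _ osc1; rewrite -/d; lra.
have dn : cnorm d <= 1 + 2 * t.
  by have := cnormD (d - p) p; rewrite subrK; lra.
pose S := (s%:C)%C; pose h := p - S *: d.
have [fd pd dpp] := cE 1; rewrite -/d in fd pd dpp.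
have d_pos : cspos d.
  have c1 : mxcpos (1%:M : 'M[A]_1).
    apply/mxcposP; exists 1%:M; rewrite mulmx1; apply/matrixP => i j.
    by rewrite !mxE eq_sym; case: eqP => _; rewrite ?mulr1n ?mulr0n ?(st1 hA) ?(st0 hA).
  have /mxcposP[b bE] := Ecp _ _ (cp0 _ _ c1).
  apply/(cposP hA); exists (b ord0 ord0).
  have := congr1 (fun m : 'M[A]_1 => m ord0 ord0) bE.
  by rewrite !mxE big_ord1 !mxE.
have sh : star h = h.
  rewrite /h (stB hA) sp starZ (cpos_st d_pos); congr (_ - _ *: _).
  by apply/eqP; rewrite eq_complex /= oppr0 !eqxx.
have ph : p * h = h by rewrite mulrBr p2 -scalerAr pd.
have nS z : cnorm (S *: z) = s * cnorm z by rewrite cnormZr ger0_norm ?(ltW s0).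
have hn1 : cnorm (p - h) <= 1.
  by rewrite opprB addrC subrK nS; have := ng d; nra.
have [c [sc cc _ cD]] := sqrt_unit hA sp p2 sh ph hn1.
have cclosed := corner_closed fixed_closed fp pp.
have crP a := cornerP a fixed_closed fp pp.
have [fc pc cp] : [/\ fixed alpha c, p * c = c & c * p = c].
  apply/crP; apply: cD => //; first by apply/crP; split.
  apply/crP; split => //; last by rewrite mulrBl p2 -scalerAl dpp.
  move=> g; rewrite /h raddfB /= linearZ /= fp; congr (_ - _ *: _); exact: fd.
(* 1 - s and |p - d| are both at most 2t. Hence |c|^2 <= 4t, and the final error is t from
   averaging, 4t|a| from the factor s and 4t|a| from c E(a) c. *)
have hn : cnorm h <= 4 * t.
  have -> : h = (p - S *: p) + S *: (p - d) by rewrite scalerBr addrA subrK.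
  apply: le_trans (cnormD _ _) _; rewrite nS (nrm_distC hA p d).
  have -> : p - S *: p = ((1 - s)%:C)%C *: p by rewrite rmorphB rmorph1 scalerBl scale1r.
  have s3 : 0 <= 1 - s by rewrite subr_ge0.
  by rewrite cnormZr ger0_norm//; have := ng p; have := ng (d - p); nra.
have cn2 : cnorm c * cnorm c <= 4 * t by rewrite -expr2 -(nrm_sa hA sc) cc.
exists (fun a => S *: E (psi0 a) + star c * E a * c); split.
- move=> k a b; rewrite lin0 !Elin mulrDr mulrDl -scalerAr -scalerAl sc.
  by rewrite !scalerDr addrACA scalerA mulrC -scalerA.
- move=> a; have [h1 h2 h3] := cE a; rewrite sc; apply/crP; split.
  + move=> g; rewrite raddfD /= linearZ /= !rmorphM /=.
    by rewrite h1 fc Efix.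
  + by rewrite mulrDr -scalerAr h2 !mulrA pc.
  + by rewrite mulrDl -scalerAl h3 -!mulrA cp.
- apply: cp_mapD; last exact: cp_map_conj.
  by apply: (cp_map_scale (th := E \o psi0)); [exact: ltW|exact: cp_map_comp].
- by rewrite E1 mulr1 sc cc -/d addrC subrK.
move=> a oa; have o1 := Eosc _ _ oa; rewrite sc.
have -> : S *: E (psi0 a) + c * E a * c - psi0 a =
    (E (psi0 a) - psi0 a) - ((1 - s)%:C)%C *: E (psi0 a) + c * E a * c.
  rewrite rmorphB rmorph1 scalerBl scale1r opprB addrAC; congr (_ + _).
  by rewrite [RHS]addrC addrA subrK.
have c1 := cnormD (E (psi0 a) - psi0 a - ((1 - s)%:C)%C *: E (psi0 a)) (c * E a * c).
have c2 := nrmB hA (E (psi0 a) - psi0 a) (((1 - s)%:C)%C *: E (psi0 a)).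
have s3 : 0 <= 1 - s by rewrite subr_ge0.
rewrite cnormZr (ger0_norm s3) in c2.
have c3 : cnorm (c * E a * c) <= 4 * t * cnorm a.
  apply: le_trans (cnormM _ _) _; apply: le_trans (ler_wpM2r (ng _) (cnormM _ _)) _.
  rewrite mulrAC; apply: le_trans (ler_wpM2l _ (En a)) _; first by rewrite mulr_ge0.
  by rewrite ler_wpM2r.
have c4 : (1 - s) * cnorm (E (psi0 a)) <= 2 * t * (2 * cnorm a).
  apply: ler_pM => //; apply: le_trans (En _) _; apply: le_trans (n0 a) _.
  rewrite mulrC ler_wpM2r//.
  by have := cnormD (psi0 1 - p) p; rewrite subrK; lra.
lra.
Qed.

End CompressedMaps.

(** * A sequence of maps into the fixed point algebra, asymptotically multiplicative on all of A *)

Section FixedPointMaps.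
Variables (R : realType) (A : cstarAlgType R) (G : topologicalGroupType).
Variable alpha : G -> {lrmorphism A -> A}.
Hypothesis alpha_action : continuous_action alpha.
Hypothesis G_compact : compact [set: G].
Hypothesis A_separable : separable A.
Hypothesis alpha_Rokhlin : tracial_Rokhlin_comparison alpha.
Variables (x y : A).
Hypothesis x_pos : pos setT x.
Hypothesis x_norm : cnorm x = 1.
Hypothesis y_pos : pos (fixed alpha) y.
Hypothesis y_neq0 : y <> 0.
Local Notation hA := (cstar_norm_alg A).
Let ng z := nrm_ge0 hA z.

Definition fixed_cp_map (e : R) (p : A) (psi : A -> A) : Prop :=
  large_projection alpha x y e p /\
  [/\ forall c a b, psi (c *: a + b) = c *: psi a + psi b,
      forall a, corner (fixed alpha) p (psi a), cp_map psi,
      forall a, cnorm (psi a) <= cnorm a & psi 1 = p].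

Lemma exists_cp_map (l : seq A) (e : R) : 0 < e -> exists (p : A) (psi : A -> A),
  [/\ fixed_cp_map e p psi,
      forall a b, a \in l -> b \in l -> cnorm (psi (a * b) - psi a * psi b) <= e,
      forall a, a \in l -> cnorm (p * a - a * p) <= e &
      forall a, a \in l -> fixed alpha a -> cnorm (psi a - p * a * p) <= e].
Proof.
(* psi has to be close to psi0 at the products ab as well. The entry 1 yields |psi0(1) - p| <= t and
   the oscillation bound there, which the unital correction needs. *)
move=> e0; pose l' := 1 :: l ++ [seq a * b | a <- l, b <- l].
pose B := 1 + \sum_(a <- l') cnorm a.
have s0 : 0 <= \sum_(a <- l') cnorm a by apply: sumr_ge0.
have B1 : 1 <= B by rewrite lerDl.
have lB a : a \in l' -> cnorm a <= B.
  move=> al; rewrite /B (big_rem a al)/=.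
  have : 0 <= \sum_(b <- rem a l') cnorm b by apply: sumr_ge0.
  lra.
have B2 : 1 <= B * B by nra.
(* psi and psi0 differ by at most 9Bt on l', and |psi0(a)| <= 2B, so the multiplicativity defect is
   at most 9Bt + t + 9B^2 t + 18B^2 t <= 37 B^2 t. *)
pose t := Num.min 1 (e / (40 * (B * B))).
have t0 : 0 < t by rewrite lt_min ltr01 divr_gt0// mulr_gt0// (lt_le_trans ltr01).
have t1 : t <= 1 by rewrite ge_min lexx.
have te : 40 * (B * B) * t <= e.
  have S : 0 < 40 * (B * B) by rewrite mulr_gt0// (lt_le_trans ltr01).
  by rewrite mulrC -ler_pdivlMr// /t ge_min lexx orbT.
have B0 : 0 <= B by exact: le_trans B1.
have Bt : B * t <= B * B * t by rewrite -mulrA ler_peMl// mulr_ge0// ltW.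
have tB : t <= B * B * t by rewrite ler_peMl// ltW.
have te' : t <= e by lra.
have [p [psi0 [[[fp pp] [k1 k2 k3 k4]] [lin0 cor0 cp0 n0] mul0 osc0 [com0 fix0]]]] :=
  exists_almost_invariant_map alpha_action G_compact A_separable alpha_Rokhlin
    x_pos x_norm y_pos y_neq0 l' t0.
have in1 : 1 \in l' by rewrite inE eqxx.
have inl a : a \in l -> a \in l' by move=> al; rewrite inE mem_cat al orbT.
have inll a b : a \in l -> b \in l -> a * b \in l'.
  move=> al bl; rewrite inE mem_cat; apply/orP; right; apply/orP; right.
  by apply/allpairsP; exists (a, b).
have p1 : cnorm (psi0 1 - p) <= t.
  by have := fix0 1 in1 (fixed1 alpha); rewrite mulr1 (pp.2).
have [E [Elin Efix [Ebi E1] Ecp En]] :=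
  exists_invariant_mean alpha_action G_compact A_separable.
have t01 : 0 < t <= 1 by rewrite t0 t1.
have [psi [lin cor cp u1 close]] := exists_unital_correction alpha_action Elin Efix Ebi E1 Ecp
  (fun a => (En a).1) (fun a s => (En a).2 s) fp pp t01 lin0 cor0 cp0 n0 p1 (osc0 1 in1).
have contr : forall a, cnorm (psi a) <= cnorm a.
  apply: (cp_map_contractive (p := p)) => // r a.
  have z : psi 0 = 0 by have := lin (-1) 1 1; rewrite !scaleN1r !addNr.
  by have := lin (r%:C)%C a 0; rewrite z !addr0.
have close' a : a \in l' -> cnorm (psi a - psi0 a) <= 9 * B * t.
  move=> al; apply: le_trans (close a (osc0 a al)) _.
  by have := lB a al; nra.
exists p, psi; split.
- split; last by [].
  split=> //; split=> //; apply: le_lt_trans k4; lra.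
- move=> a b al bl.
  have h1 := close' _ (inll a b al bl); have h2 := close' _ (inl a al).
  have h3 := close' _ (inl b bl); have h4 := mul0 a b (inl a al) (inl b bl).
  have E2 : psi (a * b) - psi a * psi b = (psi (a * b) - psi0 (a * b)) -
     (psi0 a * psi0 b - psi0 (a * b)) -
     ((psi a - psi0 a) * psi b + psi0 a * (psi b - psi0 b)).
    rewrite mulrBl mulrBr addrA subrK opprB addrA subrK opprB addrA.
    by rewrite subrK.
  rewrite E2; apply: le_trans (nrmB hA _ _) _.
  apply: le_trans (lerD (nrmB hA _ _) (cnormD _ _)) _.
  have m1 : cnorm ((psi a - psi0 a) * psi b) <= 9 * B * t * B.
    apply: le_trans (cnormM _ _) _; apply: ler_pM => //.
    exact: le_trans (contr b) (lB b (inl b bl)).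
  have m2 : cnorm (psi0 a * (psi b - psi0 b)) <= (B * 2) * (9 * B * t).
    apply: le_trans (cnormM _ _) _; apply: ler_pM => //.
    apply: le_trans (n0 a) _; apply: ler_pM => //; first exact: lB (inl a al).
    have := cnormD (psi0 1 - p) p; rewrite subrK.
    by have := nrm_proj hA pp.1 pp.2; lra.
  lra.
- by move=> a /inl al; apply: le_trans (com0 a al) _.
- move=> a /inl al fa; have := nrm_tri hA (psi a) (psi0 a) (p * a * p).
  have := fix0 a al fa; have := close' a al.
  lra.
Qed.

Lemma exists_cp_map_sequence : exists (p : nat -> A) (psi : nat -> A -> A),
  [/\ forall k, fixed_cp_map (k.+1%:R^-1) (p k) (psi k),
      forall a b, aeq (fun k => psi k (a * b)) (fun k => psi k a * psi k b),
      forall a, aeq (fun k => p k * a) (fun k => a * p k) &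
      forall a, fixed alpha a -> aeq (fun k => psi k a) (fun k => p k * a * p k)].
Proof.
have [d dD] := separable_seq A_separable.
have [E [Elin Efix [Ebi E1] Ecp En]] :=
  exists_invariant_mean alpha_action G_compact A_separable.
have Ef a : fixed alpha a -> E a = a.
  by move=> fa; have := Ebi a 1 1 fa (fixed1 alpha); rewrite !mulr1 E1 mulr1.
clear E1 Ebi.
(* The E(d_i) are dense among the invariant elements, where the d_i themselves need not be; they are
   needed for psi_k(a) close to p_k a p_k. *)
pose L k : seq A := [seq d i | i <- iota 0 k.+1] ++ [seq E (d i) | i <- iota 0 k.+1].
have dL i k : (i <= k)%N -> d i \in L k.
  by move=> ik; rewrite mem_cat; apply/orP; left; apply/mapP; exists i; rewrite ?mem_iota.
have EL i k : (i <= k)%N -> E (d i) \in L k.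
  by move=> ik; rewrite mem_cat; apply/orP; right; apply/mapP; exists i; rewrite ?mem_iota.
have H k : exists ppsi : A * (A -> A),
  [/\ fixed_cp_map (k.+1%:R^-1) ppsi.1 ppsi.2,
      forall a b, a \in L k -> b \in L k ->
        cnorm (ppsi.2 (a * b) - ppsi.2 a * ppsi.2 b) <= k.+1%:R^-1,
      forall a, a \in L k -> cnorm (ppsi.1 * a - a * ppsi.1) <= k.+1%:R^-1 &
      forall a, a \in L k -> fixed alpha a ->
        cnorm (ppsi.2 a - ppsi.1 * a * ppsi.1) <= k.+1%:R^-1].
  have k0 : 0 < k.+1%:R^-1 :> R by rewrite invr_gt0.
  by have [p [psi h]] := exists_cp_map (L k) k0; exists (p, psi).
pose p k := (sval (cid (H k))).1; pose psi k := (sval (cid (H k))).2.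
have HP k := svalP (cid (H k)).
have late (e : R) n : 0 < e -> \forall k \near \oo, (n <= k)%N /\ k.+1%:R^-1 < e.
  move=> e0; near=> k; split; first by near: k; exact: nbhs_infty_ge.
  rewrite invf_plt ?posrE//; apply: lt_trans (archi_boundP _) _.
    by rewrite invr_ge0 ltW.
  rewrite ltr_nat ltnS; near: k; exact: nbhs_infty_ge.
have pn k : cnorm (p k) <= 1.
  by have [[[[_ [sp pp]] _] _] _ _ _] := HP k; exact: (nrm_proj hA).
have lin k c a b : psi k (c *: a + b) = c *: psi k a + psi k b.
  by have [[_ [h _ _ _ _]] _ _ _] := HP k; exact: h.
have psiB k a b : psi k (a - b) = psi k a - psi k b.
  by rewrite addrC -scaleN1r lin scaleN1r addrC.
have contr k a : cnorm (psi k a) <= cnorm a.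
  by have [[_ [_ _ _ h _]] _ _ _] := HP k; exact: h.
exists p, psi; split.
- by move=> k; have [] := HP k.
- move=> a b e e0; pose C := 2 * (cnorm a + cnorm b + 1).
  have C1 : 2 <= C by rewrite /C; have := ng a; have := ng b; lra.
  have c0 : 0 < Num.min 1 (e / (4 * C)) by rewrite lt_min ltr01 divr_gt0// mulr_gt0//; lra.
  have [i ai] := dD a _ c0; have [j bj] := dD b _ c0.
  have C4 : 0 < 4 * C by lra.
  rewrite !lt_min !(ltr_pdivlMr _ _ C4) in ai bj.
  move: ai bj => /andP[ai ai'] /andP[bj bj'].
  have e2 : 0 < e / 4 by rewrite divr_gt0.
  apply: filterS (late _ (maxn i j) e2) => k []; rewrite geq_max => /andP[ik jk] ke.
  have [_ /(_ _ _ (dL i k ik) (dL j k jk)) + _ _] := HP k; rewrite -/(psi k) => h.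
  have h1 := nrm_tri hA (psi k (a * b)) (psi k (d i * d j)) (psi k a * psi k b).
  have h2 := nrm_tri hA (psi k (d i * d j)) (psi k (d i) * psi k (d j)) (psi k a * psi k b).
  have Db u v u' v' : u * v - u' * v' = (u - u') * v + u' * (v - v') :> A.
    by rewrite mulrBl mulrBr addrA subrK.
  have dn : cnorm (d i) <= cnorm a + 1.
    by have := nrm_tri hA (d i) a 0; rewrite !subr0 (nrm_distC hA (d i)); lra.
  have h3 : cnorm (psi k (a * b) - psi k (d i * d j)) <=
      cnorm (a - d i) * cnorm b + (cnorm a + 1) * cnorm (b - d j).
    rewrite -psiB; apply: le_trans (contr _ _) _; rewrite Db.
    apply: le_trans (cnormD _ _) _; apply: lerD; first exact: cnormM.
    by apply: le_trans (cnormM _ _) _; rewrite ler_wpM2r.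
  have h4 : cnorm (psi k (d i) * psi k (d j) - psi k a * psi k b) <=
      cnorm (a - d i) * cnorm b + (cnorm a + 1) * cnorm (b - d j).
    rewrite (nrm_distC hA) Db -!psiB.
    apply: le_trans (cnormD _ _) _; apply: lerD; apply: le_trans (cnormM _ _) _.
      by apply: ler_pM.
    by apply: ler_pM => //; apply: le_trans (contr _ _) _.
  have h5 : cnorm (a - d i) * cnorm b + (cnorm a + 1) * cnorm (b - d j) < e / 4.
    rewrite /C in ai' bj'.
    have na := ng a; have nb := ng b; have nx := ng (a - d i); have ny := ng (b - d j).
    pose m := Num.max (cnorm (a - d i)) (cnorm (b - d j)).
    have m1 : cnorm (a - d i) <= m by rewrite le_max lexx.
    have m2 : cnorm (b - d j) <= m by rewrite le_max lexx orbT.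
    have m3 : m * (4 * (2 * (cnorm a + cnorm b + 1))) < e by rewrite /m /Num.max; case: ifP.
    have : cnorm (a - d i) * cnorm b <= m * cnorm b by rewrite ler_wpM2r.
    have : (cnorm a + 1) * cnorm (b - d j) <= (cnorm a + 1) * m.
      by rewrite ler_wpM2l// addr_ge0.
    have : 0 <= m * (cnorm a + cnorm b + 1).
      by apply: mulr_ge0; [exact: le_trans nx m1|rewrite !addr_ge0].
    lra.
  have g1 := le_lt_trans h2 (ltrD (le_lt_trans h ke) (le_lt_trans h4 h5)).
  apply: le_lt_trans h1 _; apply: lt_trans (ltrD (le_lt_trans h3 h5) g1) _; lra.
- move=> a e e0; have e3 : 0 < e / 3 by rewrite divr_gt0.
  have [i ai] := dD a _ e3.
  apply: filterS (late _ i e3) => k [ik ke].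
  have [_ _ /(_ _ (dL i k ik)) + _] := HP k; rewrite -/(p k) => h.
  have -> : p k * a - a * p k = (p k * d i - d i * p k) + (p k * (a - d i) - (a - d i) * p k).
    by rewrite mulrBr mulrBl opprB [RHS]addrCA [X in _ = _ + X]addrA subrK addrA subrK.
  have h1 := cnormM (p k) (a - d i); have h2 := cnormM (a - d i) (p k).
  have h3 : cnorm (p k) * cnorm (a - d i) <= cnorm (a - d i) by rewrite ler_piMl.
  rewrite (mulrC _ (cnorm (p k))) in h2.
  apply: le_lt_trans (cnormD _ _) _; apply: le_lt_trans (lerD (lexx _) (nrmB hA _ _)) _.
  have g2 := ltrD (le_lt_trans (le_trans h1 h3) ai) (le_lt_trans (le_trans h2 h3) ai).
  apply: lt_le_trans (ltrD (le_lt_trans h ke) g2) _; lra.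
- move=> a fa e e0; have e3 : 0 < e / 3 by rewrite divr_gt0.
  have [i ai] := dD a _ e3.
  have {}ai : cnorm (a - E (d i)) < e / 3.
    rewrite -(Ef a fa); apply: le_lt_trans ai.
    have -> : E a - E (d i) = E (a - d i) by rewrite addrC -scaleN1r -Elin scaleN1r addrC.
    exact: (En _).1.
  apply: filterS (late _ i e3) => k [ik ke].
  have [_ _ _ /(_ _ (EL i k ik) (Efix _))] := HP k; rewrite -/(p k) -/(psi k) => h.
  have -> : psi k a - p k * a * p k = (psi k (a - E (d i))) +
     (psi k (E (d i)) - p k * E (d i) * p k) - p k * (a - E (d i)) * p k.
    by rewrite psiB mulrBr mulrBl opprB [X in _ = X + _]addrA subrK addrA subrK.
  apply: le_lt_trans (nrmB hA _ _) _; apply: le_lt_trans (lerD (cnormD _ _) (lexx _)) _.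
  have h1 := contr k (a - E (d i)).
  have h2 : cnorm (p k * (a - E (d i)) * p k) <= cnorm (a - E (d i)).
    apply: le_trans (cnormM _ _) _; apply: le_trans (ler_piMr (ng _) (pn k)) _.
    by apply: le_trans (cnormM _ _) _; rewrite ler_piMl.
  have g1 := ltrD (le_lt_trans h1 ai) (le_lt_trans h ke).
  apply: lt_le_trans (ltrD g1 (le_lt_trans h2 ai)) _; lra.
Unshelve. all: by end_near. Qed.

End FixedPointMaps.

(** * Asymptotic isometry *)

Section AsymptoticIsometry.
Variables (R : realType) (A : cstarAlgType R).
Local Notation hA := (cstar_norm_alg A).
Let ng z := nrm_ge0 hA z.

(* With c = |h - t| + (h - t) the witness is c^3. *)
Lemma exists_spectral_cutoff (h : A) (t : R) : 0 <= t -> cspos h -> t < cnorm h ->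
  exists b w : A, [/\ b != 0, cspos b, cspos w & h * b = (t%:C)%C *: b + w].
Proof.
move=> t0 ph th; pose T := rsc (in_alg A) t; pose z := h - T.
have sz : star z = z by rewrite (stB hA) (cpos_st ph) [star T](st_rsc hA).
have [q [sq qE pq qD]] := cpos_sqrt hA (cpos_sqr hA sz).
have qz : q * z = z * q.
  by apply: (qD _ (commutant_closed hA z)); rewrite ?mul1r ?mulr1 ?mulrA.
pose b := q + z; have sb : star b = b by rewrite starD sq sz.
have qb : q * b = b * q by rewrite /b [LHS]mulrDr [RHS]mulrDl qz.
have zb : z * b = q * b by rewrite /b [LHS]mulrDr [RHS]mulrDr qE -qz addrC.
have bb : b * b = q * b + q * b by rewrite {1}/b mulrDl zb.
have pbb : cspos (b * b) by exact: (cpos_sqr hA).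
have pqbb : cspos (q * (b * b)).
  by apply: (cpos_mul hA) => //; rewrite mulrA qb -mulrA qb mulrA.
(* The cube is used because b^3 = 2 q b^2 is visibly a product of commuting positive elements;
   likewise q b^3 is half of the square of b^2. *)
have bbb : b * (b * b) = q * (b * b) + q * (b * b).
  by rewrite mulrA {1}bb mulrDl -!mulrA.
exists (b * (b * b)), (q * b * (b * b)); split.
- apply/eqP => b3.
  have b0 : b = 0.
    apply: (cnorm0_eq0); apply/eqP; rewrite -sqrf_eq0 -(nrm_sa hA sb) -sqrf_eq0.
    by rewrite -(nrm_sa hA (cpos_st pbb)) -mulrA b3 mulr0 (nrm0 hA).
  (* If b = 0 then t - h = q is positive, so |h| <= t against the hypothesis. *)
  have : cspos (T - h).
    have -> // : T - h = q.
    by rewrite -[LHS]opprB -/z; apply/esym/eqP; rewrite -addr_eq0 -/b b0.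
  move=> /(cpos_le_rsc hA t0 ph) h1; move: th; rewrite ltNge => /negP; exact.
- by rewrite bbb; apply: (cposD hA).
- have -> : q * b * (b * b) = rsc (in_alg A) 2^-1 * ((b * b) * (b * b)).
    by rewrite {2}bb [X in _ = _ * X]mulrDl [RHS]mulrDr (rsc_half (in_alg A)).
  apply: (cpos_rsc hA); first by rewrite invr_ge0.
  exact: (cpos_sqr hA (cpos_st pbb)).
- have -> : h = z + T by rewrite subrK.
  rewrite mulrDl addrC; congr (_ + _); first by rewrite /T /rsc /= -scalerAl mul1r.
  by rewrite [LHS]mulrA zb.
Qed.

Section Sequence.
Variable th : nat -> A -> A.
Hypothesis A_simple : cstar_simple A.
Hypothesis th_lin : forall k c a b, th k (c *: a + b) = c *: th k a + th k b.
Hypothesis th_pos : forall k a, cspos a -> cspos (th k a).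
Hypothesis th_contr : forall k a, cnorm (th k a) <= cnorm a.
Hypothesis th_mul : forall a b, aeq (fun k => th k (a * b)) (fun k => th k a * th k b).
Hypothesis th_1 : \forall k \near \oo, 2^-1 <= cnorm (th k 1).

(** Asymptotic multiplicativity and the uniform bound make the null set a two-sided ideal,
    contractivity makes it closed; simplicity leaves only 0 because of [th_1]. *)
Lemma th_null_eq0 b : aeq (fun k => th k b) (fun=> 0) -> b = 0.
Proof.
pose I : set A := [set b | aeq (fun k => th k b) (fun=> 0)].
have thD k a c : th k (a + c) = th k a + th k c by rewrite -[a]scale1r th_lin !scale1r.
have th0 k : th k 0 = 0 by have := th_lin k (-1) 1 1; rewrite !scaleN1r !addNr.
have I0 : ideal I.
  split; first by apply: aeq_eq => k; rewrite th0.
    move=> a c Ia Ic; have := aeqD Ia Ic; apply: aeq_ext => [k|k]; last by rewrite addr0.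
    by rewrite thD.
  move=> a c Ic; have bth d : bdd (fun k => th k d) by exists (cnorm d).
  split; apply: (aeq_trans (th_mul _ _)).
    have := aeqM (bth a) (bdd_cst 0) (aeq_refl _) Ic.
    by apply: aeq_ext => k //; rewrite mulr0.
  have := aeqM (bdd_cst 0) (bth a) Ic (aeq_refl _).
  by apply: aeq_ext => k //; rewrite mul0r.
have cI : closed I.
  move=> a cla e e0; have e2 : 0 < e / 2 by rewrite divr_gt0.
  have [c [Ic ac]] := cla _ (cnorm_nbhs a e2).
  have := Ic _ e2; apply: filterS => k; rewrite !subr0 => hk.
  have -> : th k a = th k (a - c) + th k c by rewrite -thD subrK.
  apply: le_lt_trans (cnormD _ _) _; rewrite (splitr e); apply: ltrD => //.
  exact: le_lt_trans (th_contr _ _) ac.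
case: (A_simple I0 cI) => IE Ib; first by have : I b by []; rewrite IE.
have : I 1 by rewrite IE.
have i2 : 0 < 2^-1 :> R by rewrite invr_gt0.
move=> /(_ _ i2) h1.
have [k [/= h2 h3]] : exists k, cnorm (th k 1 - 0) < 2^-1 /\ 2^-1 <= cnorm (th k 1).
  near \oo => k; exists k; split; near: k => //.
by move: h2; rewrite subr0 ltNge h3.
Unshelve. all: by end_near. Qed.

Lemma th_not_decreasing a (e : R) : 0 < e ->
  ~ (forall k, cnorm (th k a) <= cnorm a - e).
Proof.
move=> e0 dec; have s0 : e <= cnorm a.
  by rewrite -subr_ge0; apply: le_trans (dec 0%N).
set s := cnorm a in dec s0; pose h := star a * a.
have ph : cspos h by exact: (cpos_mulst hA).
have hn : cnorm h = s ^+ 2 by exact: cnorm_star.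
have se : 0 < s * e by rewrite mulr_gt0// (lt_le_trans e0).
have es : s * e <= s ^+ 2 by rewrite expr2 ler_wpM2l// (le_trans (ltW e0)).
pose t := s ^+ 2 - s * e / 2.
have t0 : 0 <= t by rewrite /t; lra.
have [|b [w [b0 pb pw hb]]] := @exists_spectral_cutoff h t t0 ph.
  by rewrite hn /t; lra.
have h_small : \forall k \near \oo, cnorm (th k h) <= t - s * e / 4.
  have se4 : 0 < s * e / 4 by rewrite divr_gt0.
  have := th_mul (star a) a se4; apply: filterS => k hk.
  have h1 := cnormD (th k h - th k (star a) * th k a) (th k (star a) * th k a).
  rewrite subrK in h1; apply: le_trans h1 _.
  have h2 : cnorm (th k (star a) * th k a) <= s * (s - e).
    apply: le_trans (cnormM _ _) _; apply: ler_pM => //.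
    by apply: le_trans (th_contr _ _) _; rewrite (nrm_st hA).
  by apply: le_trans (lerD (ltW hk) h2) _; rewrite /t expr2; lra.
suff /th_null_eq0 : aeq (fun k => th k b) (fun=> 0) by move/eqP; rewrite (negbTE b0).
move=> d d0; have d1 : 0 < d * (s * e / 4) by rewrite mulr_gt0// divr_gt0.
have := th_mul h b d1; apply: filterS2 h_small => k hk1 hk2; rewrite subr0.
(* From hb = tb + w with w positive, |th_k(hb)| is at least t|th_k(b)|. Multiplicativity bounds it,
   up to a null error, by (t - s e/4)|th_k(b)|, so th_k(b) tends to 0. *)
have h1 : t * cnorm (th k b) <= cnorm (th k (h * b)).
  have -> : t * cnorm (th k b) = cnorm ((t%:C)%C *: th k b) by rewrite cnormZr ger0_norm.
  rewrite hb th_lin; apply: (cpos_le_nrm hA); last by rewrite addrC addKr; exact: th_pos.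
  by have := cpos_rsc hA t0 (th_pos k pb); rewrite /rsc /= -scalerAl mul1r.
have h2 := cnormD (th k (h * b) - th k h * th k b) (th k h * th k b).
rewrite subrK in h2.
have h3 : cnorm (th k h * th k b) <= (t - s * e / 4) * cnorm (th k b).
  by apply: le_trans (cnormM _ _) _; rewrite ler_wpM2r.
have h4 : t * cnorm (th k b) < d * (s * e / 4) + (t - s * e / 4) * cnorm (th k b).
  by apply: le_lt_trans h1 _; apply: le_lt_trans h2 _; exact: ltr_leD.
have h5 : cnorm (th k b) * (s * e / 4) < d * (s * e / 4).
  by move: h4; rewrite [X in _ < _ + X]mulrBl addrCA ltrDl subr_gt0 (mulrC (cnorm (th k b))).
by move: h5; rewrite ltr_pM2r// divr_gt0.
Qed.

End Sequence.

(** A failure gives a subsequence along which the bound is violated at every index. All hypotheses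
    pass to it, and [th_not_decreasing] applies. *)
Lemma asymptotically_isometric (th : nat -> A -> A) : cstar_simple A ->
  (forall k c a b, th k (c *: a + b) = c *: th k a + th k b) ->
  (forall k a, cspos a -> cspos (th k a)) ->
  (forall k a, cnorm (th k a) <= cnorm a) ->
  (forall a b, aeq (fun k => th k (a * b)) (fun k => th k a * th k b)) ->
  (\forall k \near \oo, 2^-1 <= cnorm (th k 1)) ->
  forall a (e : R), 0 < e -> \forall k \near \oo, cnorm a - e < cnorm (th k a).
Proof.
move=> sA lin pos' contr mul one a e e0; apply: contrapT => nn.
have bad n : exists k, (n <= k)%N /\ cnorm (th k a) <= cnorm a - e.
  apply: contrapT => nb; apply: nn; exists n => // k nk; rewrite ltNge.
  by apply/negP => h; apply: nb; exists k.
pose s n := sval (cid (bad n)).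
have sn n : (n <= s n)%N /\ cnorm (th (s n) a) <= cnorm a - e := svalP (cid (bad n)).
have sub (P : nat -> Prop) : (\forall k \near \oo, P k) -> \forall k \near \oo, P (s k).
  move=> [K _ hK]; exists K => // k Kk; apply: hK.
  exact: leq_trans Kk (sn k).1.
apply: (@th_not_decreasing (fun n => th (s n)) sA _ _ _ _ _ a e e0) => //.
- by move=> k; exact: pos'.
- by move=> u v d d0; exact: (sub _ (mul u v d d0)).
- exact: (sub _ one).
- by move=> k; have [] := sn k.
Qed.

End AsymptoticIsometry.

(** * Products of several factors and finite nets *)

Section Products.
Variables (R : realType) (A : cstarAlgType R).
Local Notation hA := (cstar_norm_alg A).
Let ng z := nrm_ge0 hA z.

Lemma cnorm_prod m (a : 'I_m -> A) (B : R) : 1 <= B -> (forall i, cnorm (a i) <= B) ->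
  cnorm (\prod_(i < m) a i) <= B ^+ m.
Proof.
move=> B1; elim: m a => [|m IH] a aB; first by rewrite big_ord0 expr0 (nrm1 hA).
rewrite big_ord_recl exprS; apply: le_trans (cnormM _ _) _.
by apply: ler_pM => //; apply: IH.
Qed.

Lemma cnorm_prod_dist m (a b : 'I_m -> A) (B d : R) : 1 <= B -> 0 <= d ->
  (forall i, cnorm (a i) <= B) -> (forall i, cnorm (b i) <= B) ->
  (forall i, cnorm (a i - b i) <= d) ->
  cnorm (\prod_(i < m) a i - \prod_(i < m) b i) <= m%:R * B ^+ m * d.
Proof.
move=> B1 d0; elim: m a b => [|m IH] a b aB bB ab.
  by rewrite !big_ord0 subrr (nrm0 hA) !mul0r.
rewrite !big_ord_recl.
set P := \prod_(i < m) a _; set Q := \prod_(i < m) b _.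
have -> : a ord0 * P - b ord0 * Q = (a ord0 - b ord0) * P + b ord0 * (P - Q).
  by rewrite mulrBl mulrBr addrA subrK.
have h1 : cnorm ((a ord0 - b ord0) * P) <= d * B ^+ m.
  by apply: le_trans (cnormM _ _) _; apply: ler_pM => //; apply: cnorm_prod.
have h2 : cnorm (b ord0 * (P - Q)) <= B * (m%:R * B ^+ m * d).
  by apply: le_trans (cnormM _ _) _; apply: ler_pM => //; apply: IH.
apply: le_trans (cnormD _ _) _; apply: le_trans (lerD h1 h2) _.
have B0 : 0 <= B by exact: le_trans B1.
have Bm : d * B ^+ m <= d * B ^+ m.+1.
  by rewrite ler_wpM2l// exprS ler_peMl// exprn_ge0.
apply: le_trans (lerD Bm (lexx _)) _.
by rewrite exprS -natr1 le_eqVlt; apply/orP; left; apply/eqP; ring.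
Qed.

Lemma compact_net (K : set A) (d : R) : compact K -> 0 < d ->
  exists s : seq A, (forall a, a \in s -> K a) /\
    forall a, K a -> exists2 b, b \in s & cnorm (a - b) < d.
Proof.
move=> cK d0.
have [s [sK cov]] := compact_finite_cover cK (fun a _ => cnorm_nbhs a d0).
exists s; split=> // a /cov[b bs ab]; exists b => //.
by rewrite (nrm_distC hA).
Qed.

Lemma cp_map_pos (th : A -> A) a : cp_map th -> cspos a -> cspos (th a).
Proof.
move=> cth /(cposP hA)[b aE].
have c1 : mxcpos ((mxstar (b%:M : 'M[A]_1)) *m b%:M) by apply/mxcposP; exists b%:M.
have /mxcposP[c cE] := cth _ _ c1.
apply/(cposP hA); exists (c ord0 ord0).
have := congr1 (fun m : 'M[A]_1 => m ord0 ord0) cE.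
by rewrite !mxE !big_ord1 !mxE !eqxx !mulr1n aE.
Qed.

End Products.

(** * From null sequences to compact sets *)

Theorem theorem2p17 (R : realType) (A : cstarAlgType R)
    (G : topologicalGroupType) (alpha : G -> {lrmorphism A -> A})
    (A_infinite : infinite_dimensional A) (A_simple : cstar_simple A)
    (A_separable : separable A)
    (G_compact : compact_group G) (G_second : @second_countable G)
    (alpha_action : continuous_action alpha)
    (alpha_Rokhlin : tracial_Rokhlin_comparison alpha)
    (eps : R) (eps_gt0 : 0 < eps) (n : nat) (n_gt0 : (0 < n)%N)
    (F1 F2 : set A) (F1_compact : compact F1) (F2_compact : compact F2)
    (F2_fixed : F2 `<=` fixed alpha)
    (x : A) (x_pos : pos setT x) (x_norm : cnorm x = 1)
    (y : A) (y_pos : pos (fixed alpha) y) (y_neq0 : y <> 0) :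
  exists (p : A) (psi : A -> A),
    (fixed alpha p /\ is_projection p) /\
    [/\ forall a, corner (fixed alpha) p (psi a),
        linear_on setT psi,
        completely_positive setT (corner (fixed alpha) p) psi,
        forall a, cnorm (psi a) <= cnorm a &
        psi 1 = p] /\
    (forall (m : nat) (a : 'I_m -> A), (0 < m)%N -> (m <= n)%N ->
       (forall i, (F1 `|` F2) (a i)) ->
       cnorm (psi (\prod_(i < m) a i) - \prod_(i < m) psi (a i)) < eps) /\
    (forall a, (F1 `|` F2) a -> cnorm (p * a - a * p) < eps) /\
    (forall a, F2 a -> cnorm (psi a - p * a * p) < eps) /\
    (forall a, (F1 `|` F2) a -> cnorm a - eps < cnorm (psi a)) /\
    cuntz setT (1 - p) x /\
    cuntz (fixed alpha) (1 - p) y /\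
    cuntz (fixed alpha) (1 - p) p /\
    1 - eps < cnorm (p * x * p).
Proof.
have [cG _] := G_compact; pose hA := cstar_norm_alg A.
pose ng (z : A) : 0 <= cnorm z := nrm_ge0 hA z.
have [p [psi [hpsi mul comm fix_]]] := exists_cp_map_sequence alpha_action cG A_separable
  alpha_Rokhlin x_pos x_norm y_pos y_neq0.
have lin k c a b : psi k (c *: a + b) = c *: psi k a + psi k b.
  by have [_ [h _ _ _ _]] := hpsi k; exact: h.
have psiB k a b : psi k (a - b) = psi k a - psi k b.
  by rewrite addrC -scaleN1r lin scaleN1r addrC.
have contr k a : cnorm (psi k a) <= cnorm a by have [_ [_ _ _ h _]] := hpsi k; exact: h.
have cp k : cp_map (psi k) by have [_ [_ _ h _ _]] := hpsi k.
have psi1 k : psi k 1 = p k by have [_ [_ _ _ _ h]] := hpsi k.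
have pP k : is_projection (p k) by have [[[_ h] _] _] := hpsi k.
have pn k : cnorm (p k) <= 1 by exact: (nrm_proj hA (pP k).1 (pP k).2).
have smallk (d : R) : 0 < d -> \forall k \near \oo, k.+1%:R^-1 < d.
  move=> d0; near=> k; rewrite invf_plt ?posrE//.
  apply: lt_trans (archi_boundP _) _; first by rewrite invr_ge0 ltW.
  by rewrite ltr_nat ltnS; near: k; exact: nbhs_infty_ge.
(* |p x p| <= |p|^2 <= |p|, so the last clause on p_k gives |p_k| > 1 - 1/(k+1). *)
have one : \forall k \near \oo, 2^-1 <= cnorm (psi k 1).
  have i2 : 0 < 2^-1 :> R by rewrite invr_gt0.
  apply: filterS (smallk _ i2) => k hk; rewrite psi1.
  have [[_ [_ _ _ h]] _] := hpsi k.
  have h1 := cnormM (p k * x) (p k); have h2 := cnormM (p k) x; rewrite x_norm mulr1 in h2.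
  have h3 : cnorm (p k * x) * cnorm (p k) <= cnorm (p k) * cnorm (p k) by rewrite ler_wpM2r.
  have h4 : cnorm (p k) * cnorm (p k) <= cnorm (p k) by rewrite ler_piMl.
  have h5 := le_trans h1 (le_trans h3 h4).
  apply/ltW/(le_lt_trans _ (lt_le_trans h h5)).
  have {1}-> : 2^-1 = 1 - 2^-1 :> R by lra.
  by rewrite lerD2l lerN2 ltW.
have iso := asymptotically_isometric A_simple lin (fun k a => cp_map_pos (cp k)) contr mul one.
have prod_mul m (a : 'I_m.+1 -> A) :
    aeq (fun k => psi k (\prod_(i < m.+1) a i)) (fun k => \prod_(i < m.+1) psi k (a i)).
  elim: m a => [|m IH] a; first by apply: aeq_eq => k; rewrite !big_ord1.
  apply: (@aeq_ext _ _ (fun k => psi k (a ord0 * \prod_(i < m.+1) a (lift ord0 i)))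
    (fun k => psi k (a ord0) * \prod_(i < m.+1) psi k (a (lift ord0 i)))) => [k|k|].
  - by rewrite big_ord_recl.
  - by rewrite big_ord_recl.
  apply: aeq_trans (mul _ _) _; apply: aeqM; [| |exact: aeq_refl|exact: IH].
    by exists (cnorm (a ord0)).
  pose B := 1 + \sum_(i < m.+1) cnorm (a (lift ord0 i)).
  exists (B ^+ m.+1) => k; apply: cnorm_prod.
    by rewrite /B lerDl sumr_ge0.
  move=> i; apply: le_trans (contr _ _) _; rewrite /B (bigD1 i)//=.
  have : 0 <= \sum_(j < m.+1 | j != i) cnorm (a (lift ord0 j)) by apply: sumr_ge0.
  lra.
have cF := compactU F1_compact F2_compact.
have [s1 [_ hs1]] := compact_net cF ltr01.
(* One unit for the radius of the net s1, one to spare. *)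
pose B : R := 2 + \sum_(b <- s1) cnorm b.
have sB : 0 <= \sum_(b <- s1) cnorm b by apply: sumr_ge0.
have B1 : 1 <= B by rewrite /B; lra.
have FB a : (F1 `|` F2) a -> cnorm a <= B.
  move=> /hs1[b bs ab]; rewrite /B (big_rem b bs)/=.
  have : 0 <= \sum_(j <- rem b s1) cnorm j by apply: sumr_ge0.
  have := cnormD (a - b) b; rewrite subrK; lra.
(* Replacing the factors of a product of length at most n by net points costs at most n B^n d =
   eps/4, once before and once after applying psi. *)
pose d := eps / (4 * (n%:R * B ^+ n)).
have Bn : 1 <= B ^+ n by rewrite exprn_ege1.
have nR : 1 <= n%:R :> R by rewrite ler1n.
have nB : 1 <= n%:R * B ^+ n by rewrite mulr_ege1.
have nB0 : 0 < n%:R * B ^+ n by exact: lt_le_trans nB.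
have d0 : 0 < d by rewrite divr_gt0// mulr_gt0.
have dE : (n%:R * B ^+ n) * d = eps / 4 by rewrite /d; field; rewrite !gt_eqF// (lt_le_trans ltr01).
have de : d <= eps / 4 by rewrite -dE ler_peMl// ltW.
have [s [sF hs]] := compact_net cF d0.
(* A second net inside F2, because the comparison of psi(a) with p a p is available only at
   invariant points. *)
have [r [rF hr]] := compact_net F2_compact d0.
have e4 : 0 < eps / 4 by rewrite divr_gt0.
(* Finitely many words: an index m of 'I_n stands for length m + 1, and c picks the letters from s,
   so one k serves them all. *)
have N1 : \forall k \near \oo, forall (m : 'I_n) (c : {ffun 'I_m.+1 -> 'I_(size s)}),
    cnorm (psi k (\prod_(i < m.+1) s`_(c i)) - \prod_(i < m.+1) psi k (s`_(c i))) < eps / 4.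
  apply: filter_forall => m; apply: filter_forall => c.
  exact: (prod_mul _ (fun i => s`_(c i)) _ e4).
have N2 : \forall k \near \oo, forall a, a \in s ->
    cnorm (p k * a - a * p k) < eps / 4 /\ cnorm a - eps / 4 < cnorm (psi k a).
  by apply: near_seq => a _; apply: filterI; [exact: comm|exact: iso].
have N3 : \forall k \near \oo, forall a, a \in r -> cnorm (psi k a - p k * a * p k) < eps / 4.
  by apply: near_seq => a /rF/F2_fixed fa; exact: fix_.
near \oo => k.
have n1 : forall (m : 'I_n) (c : {ffun 'I_m.+1 -> 'I_(size s)}),
    cnorm (psi k (\prod_(i < m.+1) s`_(c i)) - \prod_(i < m.+1) psi k (s`_(c i))) < eps / 4.
  by near: k.
have n2 : forall a, a \in s ->
    cnorm (p k * a - a * p k) < eps / 4 /\ cnorm a - eps / 4 < cnorm (psi k a) by near: k.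
have n3 : forall a, a \in r -> cnorm (psi k a - p k * a * p k) < eps / 4 by near: k.
have n4 : k.+1%:R^-1 < eps by near: k; exact: smallk.
have [[[fp pp] [c1 c2 c3 c4]] [_ cor _ _ _]] := hpsi k.
have cornP a := cornerP a (fixed_closed alpha_action) fp pp.
exists (p k), (psi k); split; first by [].
split; first split.
- exact: cor.
- by move=> c u v _ _; exact: lin.
- apply: (cp_map_corner (p := p k)) => //.
  + exact: corner_closed (fixed_closed alpha_action) fp pp.
  + by apply: (cornP _).2; split=> //; exact: pp.2.
  + by move=> a; have [] := (cornP _).1 (cor a).
- exact: contr.
- exact: psi1.
split.
  move=> [//|m] a _ mn aF.
  have H i : exists j : 'I_(size s), cnorm (a i - s`_j) < d.
    have [b /(nthP 0)[j js <-] ab] := hs _ (aF i); by exists (Ordinal js).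
  pose c := [ffun i => sval (cid (H i))].
  have ac i : cnorm (a i - s`_(c i)) <= d by rewrite ffunE; exact/ltW/(svalP (cid (H i))).
  have sc i : cnorm (s`_(c i)) <= B by apply/FB/sF/mem_nth.
  have aB i : cnorm (a i) <= B by exact: FB.
  have pB (u : A) : cnorm u <= B -> cnorm (psi k u) <= B by exact: le_trans (contr _ _).
  have mB : m.+1%:R * B ^+ m.+1 * d <= eps / 4.
    rewrite -dE ler_wpM2r ?(ltW d0)//; apply: ler_pM => //.
    - by rewrite exprn_ge0// (le_trans _ B1).
    - by rewrite ler_nat.
    - by rewrite ler_weXn2l.
  have h1 : cnorm (psi k (\prod_(i < m.+1) a i) - psi k (\prod_(i < m.+1) s`_(c i))) <= eps / 4.
    rewrite -psiB; apply: le_trans (contr _ _) _; apply: le_trans mB.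
    exact: cnorm_prod_dist B1 (ltW d0) aB sc ac.
  have h2 : cnorm (\prod_(i < m.+1) psi k (s`_(c i)) - \prod_(i < m.+1) psi k (a i)) <= eps / 4.
    apply: le_trans mB; apply: cnorm_prod_dist B1 (ltW d0) _ _ _ => i; try exact: pB.
    by rewrite -psiB (le_trans (contr _ _))// (nrm_distC hA).
  have h3 := n1 (Ordinal mn) c.
  have h4 := nrm_tri hA (psi k (\prod_(i < m.+1) a i)) (psi k (\prod_(i < m.+1) s`_(c i))) (\prod_(i < m.+1) psi k (a i)).
  have h5 := nrm_tri hA (psi k (\prod_(i < m.+1) s`_(c i))) _ (\prod_(i < m.+1) psi k (a i)).
  apply: le_lt_trans h4 _; apply: le_lt_trans (lerD h1 (h5 _)) _.
  apply: lt_le_trans (ler_ltD (lexx _) (ltr_leD h3 h2)) _; lra.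
split.
  move=> a /hs[b bs ab]; have [h1 _] := n2 b bs.
  have -> : p k * a - a * p k = (p k * b - b * p k) + (p k * (a - b) - (a - b) * p k).
    by rewrite mulrBr mulrBl opprB [RHS]addrCA [X in _ = _ + X]addrA subrK addrA subrK.
  have h2 : cnorm (p k * (a - b)) <= cnorm (a - b).
    by apply: le_trans (cnormM _ _) _; rewrite ler_piMl.
  have h3 : cnorm ((a - b) * p k) <= cnorm (a - b).
    by apply: le_trans (cnormM _ _) _; rewrite ler_piMr.
  have h4 := lerD (le_trans h2 (ltW ab)) (le_trans h3 (ltW ab)).
  apply: le_lt_trans (cnormD _ _) _.
  apply: lt_le_trans (ltr_leD h1 (le_trans (nrmB hA _ _) h4)) _; lra.
split.
  move=> a /hr[b br ab]; have h1 := n3 b br.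
  have -> : psi k a - p k * a * p k = psi k (a - b) + (psi k b - p k * b * p k) - p k * (a - b) * p k.
    by rewrite psiB mulrBr mulrBl opprB [X in _ = X + _]addrA subrK addrA subrK.
  have h2 : cnorm (p k * (a - b) * p k) <= cnorm (a - b).
    apply: le_trans (cnormM _ _) _; apply: le_trans (ler_piMr (ng _) (pn k)) _.
    by apply: le_trans (cnormM _ _) _; rewrite ler_piMl.
  apply: le_lt_trans (nrmB hA _ _) _; apply: le_lt_trans (lerD (cnormD _ _) (lexx _)) _.
  have h3 := ler_ltD (le_trans (contr k (a - b)) (ltW ab)) h1.
  apply: lt_le_trans (ltr_leD h3 (le_trans h2 (ltW ab))) _; lra.
split.
  move=> a /hs[b bs ab]; have [_ h1] := n2 b bs.
  have h2 := cnormD (a - b) b; rewrite subrK in h2.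
  have h3 := cnormD (psi k b - psi k a) (psi k a); rewrite subrK in h3.
  have h4 := contr k (b - a); rewrite psiB (nrm_distC hA b) in h4.
  have h5 := le_lt_trans h4 ab; have h6 := lt_le_trans h1 h3.
  have h7 := le_lt_trans h2 (ltr_leD ab (lexx _)); lra.
split=> //; split=> //; split=> //.
by apply: le_lt_trans c4; rewrite lerD2l lerN2 ltW.
Unshelve. all: by end_near. Qed.
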